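(* A distinguished nilpotent pair $\mathbf e$ in a classical simple Lie algebra $\mathfrak g$ is wonderful if and only if one of the following conditions is satisfied: (a) $\mathfrak g$ is of type A, B or C; (b) $\mathfrak g$ is of type D and the associated triple $(\Gamma^1,\Gamma^2,\Gamma^3)$ of centrally symmetric skew diagrams is such that the pair $(\Gamma^2,\Gamma^3)$ satisfies one of the following two conditions: (i) $\Gamma^2=\{(0,0)\}$ and $\Gamma^3$ has exactly one southwest corner $(i,j)$ such that $i,j\le 0$; (ii) $\Gamma^2$ and $\Gamma^3$ are both rectangular, i.e. they both have exactly one southwest corner and one northeast corner.
   Context: Nilpotent pairs. $K$ is an algebraically closed field of characteristic $0$. A nilpotent pair in a semisimple Lie algebra $\mathfrak g$ over $K$ is a pair $\mathbf e=(e_1,e_2)$ of commuting nilpotent elements for which there is a pair $\mathbf h=(h_1,h_2)$ of commuting semisimple elements with rational eigenvalues in the adjoint action and $[h_i,e_j]=\delta_{i,j}e_j$; $\mathbf h$ is called an associated semisimple pair. $Z(\mathbf e)$, $Z(\mathbf h)$ denote the simultaneous centralizers in $\mathfrak g$, and $Z_{p,q}(\mathbf e)=\{x\in Z(\mathbf e):[h_1,x]=px,[h_2,x]=qx\}$. The pair $\mathbf e$ is distinguished if $Z(\mathbf e)$ contains no nonzero semisimple element and $Z(\mathbf h)$ is a Cartan subalgebra. The pair $\mathbf e$ is wonderful if $\dim\bigoplus_{p,q\in\mathbb Z,\ p,q\ge0}Z_{p,q}(\mathbf e)=\mathrm{rk}\,\mathfrak g$. Diagrams. A diagram is a subset $\Gamma\subset\mathbb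 R^2$ with $\Gamma\subset\mathbb Z^2+(x,y)$ for some $x,y\in\mathbb R$. It is connected if any two of its elements are joined by a finite sequence of elements of $\Gamma$ with consecutive elements at Euclidean distance $1$. A skew diagram is a finite connected diagram $\Gamma$ such that $(i,j),(i+1,j+1)\in\Gamma$ implies $(i+1,j),(i,j+1)\in\Gamma$. It is centrally symmetric if $\Gamma=-\Gamma$; then it is integral if $\Gamma\subset\mathbb Z^2$ and non-integral if $\Gamma\subset\mathbb Z^2+(1/2,1/2)$. A southwest (resp. northeast) corner of $\Gamma$ is $(i,j)\in\Gamma$ with $(i-1,j),(i,j-1)\notin\Gamma$ (resp. $(i+1,j),(i,j+1)\notin\Gamma$). Associated diagrams (Elashvili–Panyushev classification). Diagram data: Type A: a skew diagram $\Gamma=\Gamma^1$ with $|\Gamma|=\mathrm{rk}\,\mathfrak g+1$ and barycentre $(0,0)$; $\Gamma^2=\Gamma^3=\emptyset$. Type B: centrally symmetric skew diagrams $\Gamma^1$ integral, $\Gamma^2$ non-integral (empty allowed), $|\Gamma^1|+|\Gamma^2|=2\,\mathrm{rk}\,\mathfrak g+1$; $\Gamma^3=\emptyset$. Type C: centrally symmetric skew diagrams $\Gamma^1\subset\mathbb Z^2+(0,1/2)$, $\Gamma^2\subset\mathbb Z^2+(1/2,0)$ (empty allowed), $|\Gamma^1|+|\Gamma^2|=2\,\mathrm{rk}\,\mathfrak g$; $\Gamma^3=\emptyset$. Type D: centrally symmetric skew diagrams $\Gamma^1,\Gamma^2,\Gamma^3$ (empty allowed) with $|\Gamma^1|+|\Gamma^2|+|\Gamma^3|=2\,\mathrm{rk}\,\mathfrak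 g$, $\Gamma^1$ non-integral, and either $\Gamma^2=\Gamma^3=\emptyset$, or $\Gamma^2,\Gamma^3$ both non-empty and integral with $\Gamma^2\cap\Gamma^3=\{(0,0)\}\neq\Gamma^3$. Model pair: let $V=V_1\oplus V_2\oplus V_3$, $V_k=\bigoplus_{(i,j)\in\Gamma^k}K v^k_{i,j}$, with $v^k_{i,j}=0$ if $(i,j)\notin\Gamma^k$; $h_1v^k_{i,j}=i\,v^k_{i,j}$, $h_2v^k_{i,j}=j\,v^k_{i,j}$. Type A: $\mathfrak g=\mathfrak{sl}(V)$, $e_1v^1_{i,j}=v^1_{i+1,j}$, $e_2v^1_{i,j}=v^1_{i,j+1}$. Types B, D: $\mathfrak g=\mathfrak{so}(V)$ for the symmetric form $(v^n_{i,j},v^m_{k,l})=\delta_{i,-k}\delta_{j,-l}\delta_{n,m}$; $e_1v^k_{i,j}=(-1)^{i+j}v^k_{i+1,j}$, $e_2v^k_{i,j}=(-1)^{i+j+1}v^k_{i,j+1}$. Type C: $\mathfrak g=\mathfrak{sp}(V)$ for the alternating form $(v^n_{i,j},v^m_{k,l})=(-1)^{i+j+1/2}\delta_{i,-k}\delta_{j,-l}\delta_{n,m}$; $e_1v^k_{i,j}=v^k_{i+1,j}$, $e_2v^k_{i,j}=v^k_{i,j+1}$. These are distinguished nilpotent pairs with associated semisimple pair $\mathbf h=(h_1,h_2)$. By the known classification of Elashvili and Panyushev, every distinguished nilpotent pair in a classical simple $\mathfrak g$ is conjugate (under $GL(V)$ in type A, $O(V)$ in types B, D, $Sp(V)$ in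 type C) to such a model pair; the diagrams $\Gamma^k$ of the model are the diagrams associated to $\mathbf e$.
   Formalization: In type D the case where Γ² and Γ³ are both empty is added as a third alternative in (b): such pairs are always wonderful (e.g. so_8 with Γ¹ a 4×2 rectangle), though (i) and (ii) fail because an empty diagram has no corners. *)

(* Defs.v *)
From mathcomp Require Import all_boot all_order all_algebra.
From mathcomp Require Import finmap.

Set Implicit Arguments.
Unset Strict Implicit.
Unset Printing Implicit Defensive.

Import Order.TTheory GRing.Theory Num.Theory.

Local Open Scope ring_scope.

(* Lie subalgebras of gl_N(K), given as subspaces of 'M[K]_N; the bracket is
   [X, Y] = X *m Y - Y *m X and matrices act on column vectors. *)
Section LieAlgebra.

Variables (K : fieldType) (N : nat).
Implicit Types (g H U W : {vspace 'M[K]_N}) (x y z : 'M[K]_N).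
Implicit Types (e h : 'M[K]_N * 'M[K]_N).

Definition ad x : 'End('M[K]_N) := linfun (mulmx x) - linfun (mulmxr x).

Definition lie_nilpotent_elt g x : Prop :=
  exists m : nat, forall y, y \in g -> iter m (ad x) y = 0.

Definition lie_semisimple_elt g x : Prop :=
  exists2 b : seq 'M[K]_N, basis_of g b &
    forall y, y \in b -> exists a : K, ad x y = a *: y.

Definition rational_eigenvalues g x : Prop :=
  forall (a : K) y, y \in g -> y != 0 -> ad x y = a *: y ->
    exists q : rat, a = ratr q.

(* [U, W], spanned by all brackets of an element of U with one of W *)
Definition lie_bracket U W : {vspace 'M[K]_N} :=
  <<[seq ad x y | x <- vbasis U, y <- vbasis W]>>%VS.

Definition lie_subalgebra g H : Prop :=
  (H <= g)%VS /\ (lie_bracket H H <= H)%VS.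

Definition lie_nilpotent H : Prop :=
  exists m : nat, iter m (lie_bracket H) H = 0%VS.

Definition cartan_subalgebra g H : Prop :=
  [/\ lie_subalgebra g H,
      lie_nilpotent H &
      forall x, x \in g -> (forall y, y \in H -> ad x y \in H) -> x \in H].

Definition pair_centralizer g e : {vspace 'M[K]_N} :=
  (g :&: lker (ad e.1) :&: lker (ad e.2))%VS.

Definition associated_semisimple_pair g e h : Prop :=
  [/\ h.1 \in g /\ h.2 \in g,
      ad h.1 h.2 = 0,
      lie_semisimple_elt g h.1 /\ lie_semisimple_elt g h.2,
      rational_eigenvalues g h.1 /\ rational_eigenvalues g h.2 &
      [/\ ad h.1 e.1 = e.1, ad h.1 e.2 = 0, ad h.2 e.1 = 0
        & ad h.2 e.2 = e.2]].

(* e is a nilpotent pair and h one of its associated semisimple pairs; the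
   notions below that depend on the choice of h take it as an argument. *)
Definition nilpotent_pair g e h : Prop :=
  [/\ e.1 \in g /\ e.2 \in g,
      ad e.1 e.2 = 0,
      lie_nilpotent_elt g e.1 /\ lie_nilpotent_elt g e.2 &
      associated_semisimple_pair g e h].

Definition distinguished g e h : Prop :=
  [/\ nilpotent_pair g e h,
      forall x, x \in pair_centralizer g e -> lie_semisimple_elt g x -> x = 0 &
      cartan_subalgebra g (pair_centralizer g h)].

(* Z_{p,q}(e), with respect to h *)
Definition weight_centralizer g e h (p q : K) : {vspace 'M[K]_N} :=
  (pair_centralizer g e
     :&: passmx.leigenspace (ad h.1) p
     :&: passmx.leigenspace (ad h.2) q)%VS.

(* W is the sum of all Z_{p,q}(e) with p, q >= 0 integers; in characteristic 0
   this sum is direct, being a sum of joint eigenspaces. *)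
Definition nonneg_part g e h W : Prop :=
  forall x, x \in W <->
    exists m : nat,
      x \in (\sum_(p < m) \sum_(q < m) weight_centralizer g e h p%:R q%:R)%VS.

(* rk stands for the rank of g *)
Definition wonderful g (rk : nat) e h : Prop :=
  exists2 W, nonneg_part g e h W & \dim W = rk.

End LieAlgebra.

Inductive lie_type := TypeA | TypeB | TypeC | TypeD.

Definition natural_dim (T : lie_type) (r : nat) : nat :=
  match T with
  | TypeA => r.+1
  | TypeB => (2 * r).+1
  | TypeC => 2 * r
  | TypeD => 2 * r
  end%N.

(* so_2 is abelian and so_4 is not simple *)
Definition simple_rank (T : lie_type) (r : nat) : Prop :=
  match T with TypeD => 3 <= r | _ => 1 <= r end%N.

(* The Gram matrix J of the form (u, w) |-> u^T *m J *m w preserved by g; there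
   is no form, and J is irrelevant, in type A. *)
Definition classical_form (K : fieldType) (T : lie_type) (N : nat)
    (J : 'M[K]_N) : Prop :=
  match T with
  | TypeA => True
  | TypeB | TypeD => J \in unitmx /\ J^T = J
  | TypeC => J \in unitmx /\ J^T = - J
  end.

Definition special_linear (K : fieldType) (N : nat) : {vspace 'M[K]_N} :=
  lker (linfun (fun X : 'M[K]_N => \tr X : K^o)).

Definition form_algebra (K : fieldType) (N : nat) (J : 'M[K]_N) :
    {vspace 'M[K]_N} :=
  lker ((linfun (mulmxr J) \o linfun trmx)%VF + linfun (mulmx J)).

Definition classical (K : fieldType) (T : lie_type) (N : nat) (J : 'M[K]_N) :
    {vspace 'M[K]_N} :=
  match T with
  | TypeA => special_linear K N
  | _ => form_algebra J
  end.

Lemma special_linearE (K : fieldType) (N : nat) (X : 'M[K]_N) :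
  (X \in special_linear K N) = (\tr X == 0).
Proof. by rewrite memv_ker lfunE. Qed.

Lemma form_algebraE (K : fieldType) (N : nat) (J X : 'M[K]_N) :
  (X \in form_algebra J) = (X^T *m J + J *m X == 0).
Proof. by rewrite memv_ker add_lfunE comp_lfunE !lfunE. Qed.

Lemma adE (K : fieldType) (N : nat) (x y : 'M[K]_N) :
  ad x y = x *m y - y *m x.
Proof. by rewrite /ad add_lfunE opp_lfunE !lfunE. Qed.

(* A finite subset of the plane; rational coordinates lose nothing, since the
   diagrams that occur lie in 1/2 Z^2. *)

Definition diagram := {fset rat * rat}.

Section Diagrams.

Implicit Types (G : diagram) (a b : rat * rat).

Definition in_lattice G (x y : rat) : Prop :=
  forall a, a \in G -> a.1 - x \is a Num.int /\ a.2 - y \is a Num.int.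

(* Euclidean distance 1 *)
Definition adjacent a b : bool :=
  (a.1 - b.1) ^+ 2 + (a.2 - b.2) ^+ 2 == 1.

Definition connected_diagram G : Prop :=
  forall a b, a \in G -> b \in G ->
    exists s : seq (rat * rat),
      [/\ path adjacent a s, {subset s <= G} & last a s = b].

Definition skew_diagram G : Prop :=
  [/\ exists x y, in_lattice G x y,
      connected_diagram G &
      forall i j, (i, j) \in G -> (i + 1, j + 1) \in G ->
        (i + 1, j) \in G /\ (i, j + 1) \in G].

Definition centrally_symmetric G : Prop :=
  forall i j, ((i, j) \in G) = ((- i, - j) \in G).

Definition integral G : Prop := in_lattice G 0 0.
Definition non_integral G : Prop := in_lattice G (1 / 2%:R) (1 / 2%:R).

Definition sw_corner G a : Prop :=
  [/\ a \in G, (a.1 - 1, a.2) \notin G & (a.1, a.2 - 1) \notin G].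

Definition ne_corner G a : Prop :=
  [/\ a \in G, (a.1 + 1, a.2) \notin G & (a.1, a.2 + 1) \notin G].

Definition rectangular G : Prop :=
  (exists! a, sw_corner G a) /\ (exists! a, ne_corner G a).

Definition origin : diagram := [fset ((0, 0) : rat * rat)]%fset.

Definition typeD_triple (r : nat) (G1 G2 G3 : diagram) : Prop :=
  [/\ forall G, G \in [:: G1; G2; G3] ->
        skew_diagram G /\ centrally_symmetric G,
      (#|` G1| + #|` G2| + #|` G3| = 2 * r)%N,
      non_integral G1 &
      G2 = fset0%fset /\ G3 = fset0%fset \/
      [/\ G2 != fset0%fset /\ G3 != fset0%fset, integral G2 /\ integral G3,
          (G2 `&` G3)%fset = origin & G3 != origin]].

(* When G2 and G3 are empty there is nothing to require: so(V) = so(V_1) and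
   the pair is wonderful, although an empty diagram has no corner at all (e.g.
   the 4 x 2 rectangle G1, which gives a principal nilpotent pair of so_8). *)
Definition typeD_condition (G2 G3 : diagram) : Prop :=
  [\/ G2 = fset0%fset /\ G3 = fset0%fset,
      G2 = origin /\
        (exists! a, sw_corner G3 a /\ (a.1 <= 0 /\ a.2 <= 0)) |
      rectangular G2 /\ rectangular G3].

End Diagrams.

Section ModelD.

Variables (K : fieldType) (N : nat).
Implicit Types (J : 'M[K]_N) (e h : 'M[K]_N * 'M[K]_N).

(* (-1) ^ z for an integer z *)
Definition ratsign (z : rat) : K := (-1) ^ Num.floor z.

(* v is a basis of K^N indexed by the disjoint union of the diagrams, in which
   e, h and the form J are given by the formulas of the model pair. Such a basis
   is the same as an isometry from the model space onto (K^N, J) that carries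
   the model pairs to e and h. *)
Definition typeD_model_basis J e h (G : 'I_3 -> diagram)
    (v : 'I_3 -> rat * rat -> 'cV[K]_N) : Prop :=
  [/\ forall k a, a \notin G k -> v k a = 0,
      basis_of fullv [seq v k a | k <- enum 'I_3, a <- enum_fset (G k)],
      forall k m i j i' j', (i, j) \in G k -> (i', j') \in G m ->
        ((v k (i, j))^T *m J *m v m (i', j')) 0 0
          = [&& i == - i', j == - j' & k == m]%:R,
      forall k i j, (i, j) \in G k ->
        h.1 *m v k (i, j) = ratr i *: v k (i, j) /\
        h.2 *m v k (i, j) = ratr j *: v k (i, j) &
      forall k i j, (i, j) \in G k ->
        e.1 *m v k (i, j) = ratsign (i + j) *: v k (i + 1, j) /\
        e.2 *m v k (i, j) = ratsign (i + j + 1) *: v k (i, j + 1)].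

Definition typeD_associated (r : nat) J e h (G1 G2 G3 : diagram) : Prop :=
  typeD_triple r G1 G2 G3 /\
  exists v, typeD_model_basis J e h (tnth [tuple G1; G2; G3]) v.

End ModelD.

(* Main.v *)
(* Write the natural representation as a graded module over K[e_1, e_2]; it
   splits into blocks on which the h-weights are distinct. A shortest walk
   between two cells of a block is monotone, so inside a block some e_1^p e_2^q
   joins any two cells whose difference (p, q) is >= 0. Hence, on the
   block-diagonal part of g and in degrees >= 0, ad e_1 is onto and ad e_2 is
   onto on the kernel of ad e_1, and the dimensions of the Z_{p,q}(e) telescope
   to the dimension of the block-diagonal part of weight 0.

   In types A, B and C two different blocks never have an integral weight
   difference: the block-diagonal part is everything that matters and its weight
   0 part has dimension rk g. In type D the blocks V_2 and V_3 interact: the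
   block-diagonal part yields rk g - 1, and the rest is the sum over p, q >= 0 of
   the dimensions of Hom(V_2, V_3) in degree (p, q), so that the pair is
   wonderful iff this sum is 1. If Gamma^2 is a point, it counts the northeast
   corners of Gamma^3 in the first quadrant. Otherwise one of Gamma^2, Gamma^3
   crosses the centre horizontally and the other one vertically; there is always
   the homomorphism from the west end of the horizontal row to the north end of
   the vertical column, and there is another one unless the two diagrams are
   this row and this column. *)

From HB Require Import structures.
Require Import Defs.
From mathcomp Require Import all_boot all_order all_algebra.
From mathcomp Require Import finmap.
From mathcomp Require Import zify ring.
From Stdlib Require Import Classical.

Set Implicit Arguments.
Unset Strict Implicit.
Unset Printing Implicit Defensive.

Import Order.TTheory GRing.Theory Num.Theory.

Local Open Scope ring_scope.

(** * Walks along two commuting partial injections *)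

(** Types A, B and C never use diagrams; both halves of distinguishedness act directly. Nilpotency
    of Z(h) makes the weights distinct: a repeated weight would give an element of Z(h) that is an
    eigenvector, with non-zero eigenvalue, of the bracket with another one. Absence of semisimple
    elements in Z(e) makes every block self-dual (and unique in type A), since scalars on blocks
    commute with e. In so_2n the zero weight may have multiplicity 2, because so_2 is a torus: this
    is the origin shared by Gamma^2 and Gamma^3, and type D starts from the model basis instead. The
    rank comes from N = 2d + f, where d is the dimension of the block-diagonal part of weight 0 and
    f counts the basis vectors that the form pairs with themselves: f is 1 in type B, 0 in type C, 0
    or 2 in type D. Weights lie in K, which has no order, so positivity is expressed by adding
    natural numbers. Surjectivity of ad e_1 and ad e_2 amounts to difference equations solved by
    finite sums along rays; it is proved in gl and descends to g by a projection that commutes with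
    both operators. *)

Section Walks.

Variable I : Type.
Implicit Types (E F : I -> I -> Prop) (x y z : I).

Definition step (s : bool) E x y := if s then E x y else E y x.

Definition partial_injection E :=
  (forall x y z, E x y -> E x z -> y = z) /\
  (forall x y z, E x z -> E y z -> x = y).

(** For the cells of a diagram this is the skew condition; for matrices it comes from commutation,
    see [fills_arrows]. *)
Definition fills E F := forall x y z, E x y -> F y z -> exists2 t, F x t & E t z.

(* [p] steps along [E] and [q] steps along [F], in some order; the booleans
   tell whether the arrows are followed forwards or backwards. *)
Inductive mono E F (s t : bool) : nat -> nat -> I -> I -> Prop :=
| MonoRefl x : mono E F s t 0 0 x x
| MonoE p q x y z :
    mono E F s t p q x y -> step s E y z -> mono E F s t p.+1 q x z
| MonoF p q x y z :
    mono E F s t p q x y -> step t F y z -> mono E F s t p q.+1 x z.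

Lemma step_injective E s x y z :
  partial_injection E -> step s E x y -> step (~~ s) E y z -> x = z.
Proof. by case=> EF EI; case: s => /= h1 h2; [apply: EI h1 h2 | apply: EF h1 h2]. Qed.

Lemma fills_step E F s x y z : fills E F -> fills F E ->
  step s E x y -> step s F y z -> exists2 t, step s F x t & step s E t z.
Proof.
move=> EF FE; case: s => /= h1 h2; first exact: EF h1 h2.
by have [t ? ?] := FE _ _ _ h2 h1; exists t.
Qed.

Lemma mono_swap E F s t p q x y : mono E F s t p q x y -> mono F E t s q p x y.
Proof.
elim=> {p q x y} [x|p q x y z _ h st|p q x y z _ h st].
- exact: MonoRefl.
- exact: MonoF h st.
- exact: MonoE h st.
Qed.

Lemma mono_inv E F s t p q x z : mono E F s t p q x z ->
  [\/ [/\ p = 0, q = 0 & x = z]%N,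
      exists p' y, [/\ p = p'.+1, mono E F s t p' q x y & step s E y z] |
      exists q' y, [/\ q = q'.+1, mono E F s t p q' x y & step t F y z]].
Proof.
case=> {p q x z} [x|p q x y z h st|p q x y z h st]; first by constructor 1.
  by constructor 2; exists p, y.
by constructor 3; exists q, y.
Qed.

(** An [E]-step moves to the end by completing a square with each [F]-step after it. Both directions
    must agree: a right step followed by a down step need not have its fourth corner. *)
Lemma mono_lastE E F s p q x z : fills E F -> fills F E ->
  mono E F s s p.+1 q x z -> exists2 y, mono E F s s p q x y & step s E y z.
Proof.
move=> EF FE; elim: q z => [|q IH] z /mono_inv[[]|[p' [y [[<-] h st]]]|[q' [y [//]]]] //.
- by exists y.
- by exists y.
- case=> <- h st; have [u m1 s1] := IH _ h.
  have [v s2 s3] := fills_step EF FE s1 st.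
  by exists v => //; apply: MonoF m1 s2.
Qed.

(** With equal directions the last [E]-step is brought to the end and cancels there. With opposite
    directions the backward [E]-arrow has the direction of the [F]-steps, so it travels back through
    them to the [E]-step that it cancels. *)
Lemma mono_cancelE E F s t p q x y z :
  partial_injection E -> fills E F -> fills F E ->
  mono E F s t p.+1 q x y -> step (~~ s) E y z -> mono E F s t p q x z.
Proof.
move=> inj EF FE.
case: (boolP (s == t)) => [/eqP <- /mono_lastE h st|nst].
  have [u m1 s1] := h EF FE.
  by rewrite -(step_injective inj s1 st).
have -> : t = ~~ s by case: s t nst => [] [].
elim: q y z => [|q IH] y z /mono_inv[[]|[p' [u [[<-] h su]]]|[q' [u [//]]]] //.
- by move=> st; rewrite -(step_injective inj su st).
- by move=> st; rewrite -(step_injective inj su st).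
- case=> <- h su st; have [v s1 s2] := fills_step FE EF su st.
  by apply: MonoF s2; apply: IH s1.
Qed.

Lemma mono0E E F s s' t q x y : mono E F s t 0 q x y -> mono E F s' t 0 q x y.
Proof.
elim: q y => [|q IH] y /mono_inv[[]|[? [? []]]|[q' [u [//]]]] // => [_ _ ->|].
  exact: MonoRefl.
by case=> <- h su; apply: MonoF su; apply: IH.
Qed.

Lemma mono_backE E F s t p q x y z :
  partial_injection E -> fills E F -> fills F E ->
  mono E F s t p q x y -> step (~~ s) E y z ->
  exists s' p', mono E F s' t p' q x z.
Proof.
move=> inj EF FE; case: p => [|p] h st.
  (* Without [E]-steps the direction flag is free, so the new arrow sets it. *)
  exists (~~ s), 1; apply: MonoE st.
  exact: mono0E h.
by exists s, p; apply: mono_cancelE st.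
Qed.

Lemma mono_step E F s t p q b x y z :
  partial_injection E -> fills E F -> fills F E ->
  mono E F s t p q x y -> step b E y z ->
  exists s' p', mono E F s' t p' q x z.
Proof.
move=> inj EF FE h; case: (boolP (b == s)) => [/eqP ->|ne] st.
  by exists s, p.+1; apply: MonoE st.
have eb : b = ~~ s by case: b s ne {h st} => [] [].
by apply: mono_backE h _ => //; rewrite -eb.
Qed.

Lemma mono_prefix E F s p q p' q' x z : fills E F -> fills F E ->
  mono E F s s p q x z -> (p' <= p)%N -> (q' <= q)%N ->
  exists y, mono E F s s p' q' x y.
Proof.
move=> EF FE h le_p le_q.
have {h} [y h] : exists y, mono E F s s p' q x y.
  elim: p z h le_p => [|p IH] z h; first by rewrite leqn0 => /eqP ->; exists z.
  rewrite leq_eqVlt ltnS => /orP[/eqP ->|]; first by exists z.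
  by have [u mu _] := mono_lastE EF FE h; exact: IH mu.
elim: q y h le_q => [|q IH] y h; first by rewrite leqn0 => /eqP ->; exists y.
rewrite leq_eqVlt ltnS => /orP[/eqP ->|]; first by exists y.
have [u mu _] := mono_lastE FE EF (mono_swap h).
exact: IH (mono_swap mu).
Qed.

Lemma mono_forward E F s t p q x y : mono E F s t p q x y ->
  s \/ p = 0%N -> t \/ q = 0%N -> mono E F true true p q x y.
Proof.
move=> m sp tq; have {}m : mono E F true t p q x y.
  by case: sp m => [->//|->]; apply: mono0E.
by case: tq m => [->//|->] m; apply: mono_swap (mono0E _ (mono_swap m)).
Qed.

End Walks.

(* A shortest walk never uses both an arrow and the inverse of a parallel one:
   the commuting squares would let the two cancel. *)
Lemma walk_mono (I : eqType) (E F : I -> I -> Prop) (r : rel I) x s :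
  partial_injection E -> partial_injection F -> fills E F -> fills F E ->
  (forall y z, r y z -> exists b, step b E y z \/ step b F y z) ->
  path r x s -> exists b c p q, mono E F b c p q x (last x s).
Proof.
move=> iE iF EF FE rEF; elim/last_ind: s => [_|s z IH].
  by exists true, true, 0, 0; apply: MonoRefl.
rewrite rcons_path last_rcons => /andP[/IH[b [c [p [q h]]]] /rEF[d [st|st]]].
  have [b' [p' h']] := mono_step iE EF FE h st.
  by exists b', c, p', q.
have [c' [q' h']] := mono_step iF FE EF (mono_swap h) st.
by exists b, c', p, q'; apply: mono_swap.
Qed.

(** * Counting kernels in a bigraded space *)

Section Koszul.

Variables (F : fieldType) (L : vectType F).
Implicit Types (U V : {vspace L}) (f : 'End(L)).

Lemma leigenspaceP f a v :
  reflect (f v = a *: v) (v \in passmx.leigenspace f a).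
Proof.
rewrite /passmx.leigenspace memv_ker add_lfunE opp_lfunE scale_lfunE id_lfunE.
by rewrite subr_eq0; apply: eqP.
Qed.

(* The surjectivity hypotheses are the vanishing of the higher cohomology of
   the Koszul complex of the commuting pair [(f1, f2)]. *)
Lemma koszul_count (G : nat -> nat -> {vspace L}) f1 f2 m :
    (forall p q, f1 @: G p q = G p.+1 q)%VS ->
    (forall p q, f2 @: (G p q :&: lker f1) = G p q.+1 :&: lker f1)%VS ->
    (forall p q, (m <= p)%N \/ (m <= q)%N -> G p q = 0%VS) ->
  (\sum_(p < m) \sum_(q < m) \dim (G p q :&: lker f1 :&: lker f2)
     = \dim (G 0 0))%N.
Proof.
move=> G1 G2 G0; have inner p n :
    (\sum_(q < n) \dim (G p q :&: lker f1 :&: lker f2)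
       + \dim (G p n :&: lker f1) = \dim (G p 0 :&: lker f1))%N.
  elim: n => [|n IH]; first by rewrite big_ord0.
  by rewrite big_ord_recr /= -addnA -G2 limg_ker_dim.
have outer n : (\sum_(p < n) \dim (G p 0 :&: lker f1)
       + \dim (G n 0) = \dim (G 0 0))%N.
  elim: n => [|n IH]; first by rewrite big_ord0.
  by rewrite big_ord_recr /= -addnA -G1 limg_ker_dim.
rewrite -(outer m) G0 ?dimv0 ?addn0; last by left.
apply: eq_bigr => p _; rewrite -(inner p m) G0; last by right.
by rewrite cap0v dimv0 addn0.
Qed.

(** Applying powers of [f] to a relation among eigenvectors weights its terms by the values of any
    polynomial at the eigenvalues; a product over the other eigenvalues isolates one term. *)
Lemma leigen_directv (I : finType) (a : I -> F) (U : I -> {vspace L}) f :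
    injective a -> (forall i, U i <= passmx.leigenspace f (a i))%VS ->
  directv (\sum_i U i).
Proof.
move=> inj_a Ua; apply/directv_sum_independent => us us_in us0 j _.
have fus i : f (us i) = a i *: us i.
  by apply/leigenspaceP/(subvP (Ua i))/us_in.
have pw k : \sum_i a i ^+ k *: us i = 0.
  elim: k => [|k IH]; first by under eq_bigr do rewrite scale1r.
  have := congr1 f IH; rewrite linear_sum linear0 => fIH; rewrite -[RHS]fIH.
  by apply: eq_bigr => i _; rewrite linearZ /= fus scalerA exprSr.
have pol (P : {poly F}) : \sum_i P.[a i] *: us i = 0.
  under eq_bigr do rewrite horner_coef scaler_suml.
  rewrite exchange_big big1 // => k _.
  under eq_bigr do rewrite -scalerA.
  by rewrite -scaler_sumr pw scaler0.
have := pol (\prod_(i | i != j) ('X - (a i)%:P)).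
rewrite (bigD1 j) //= [X in _ + X]big1 ?addr0 => [/eqP|i ne_ij].
  rewrite scaler_eq0 => /orP[|/eqP//].
  rewrite horner_prod prodf_seq_eq0 => /hasP[i _ /andP[ne_ij]].
  by rewrite hornerXsubC subr_eq0 (inj_eq inj_a) eq_sym (negbTE ne_ij).
by rewrite horner_prod (bigD1 i) //= hornerXsubC subrr mul0r scale0r.
Qed.

(** The eigencomponents of a vector of [U] are only assumed to lie in the ambient space.
    Interpolation writes each one as a polynomial in [f] applied to the vector, so stability under
    [f] puts it in [U]. *)
Lemma eigenbasis U f (rs : seq F) : uniq rs ->
    (forall x, x \in U -> f x \in U) ->
    (forall x, x \in U -> exists y : 'I_(size rs) -> L,
       x = \sum_i y i /\ forall i, f (y i) = rs`_i *: y i) ->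
  exists2 b : seq L, basis_of U b &
    forall y, y \in b -> exists a : F, f y = a *: y.
Proof.
move=> Urs fU Udec; pose V i := passmx.leigenspace f rs`_(i : 'I_(size rs)).
have inj_a : injective (fun i : 'I_(size rs) => rs`_i).
  by move=> i j /eqP; rewrite nth_uniq // => /eqP /val_inj.
have dV : directv (\sum_i (U :&: V i)).
  by apply: leigen_directv inj_a _ => i; apply: capvSr.
have defU : U = (\sum_i (U :&: V i))%VS.
  apply/eqP; rewrite eqEsubv; apply/andP; split; last first.
    by apply/subv_sumP => i _; apply: capvSl.
  apply/subvP => x Ux; have [y [def_x fy]] := Udec x Ux; rewrite def_x.
  have pw k : \sum_(i < size rs) rs`_i ^+ k *: y i \in U.
    elim: k => [|k /fU]; first by under eq_bigr do rewrite scale1r; rewrite -def_x.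
    rewrite linear_sum; under eq_bigr do rewrite linearZ /= fy scalerA -exprSr.
    by [].
  have pol (P : {poly F}) : \sum_(i < size rs) P.[rs`_i] *: y i \in U.
    under eq_bigr do rewrite horner_coef scaler_suml.
    rewrite exchange_big; apply: memv_suml => k _ /=.
    under eq_bigr do rewrite -scalerA.
    by rewrite -scaler_sumr memvZ.
  apply: memv_sumr => i _; rewrite memv_cap; apply/andP; split; last first.
    exact/leigenspaceP.
  have := pol (\prod_(j : 'I_(size rs) | j != i) ('X - (rs`_j)%:P)).
  rewrite (bigD1 i) //= [X in _ + X]big1 ?addr0 => [cyU|j ne_ij].
    have nz : (\prod_(j : 'I_(size rs) | j != i) ('X - (rs`_j)%:P)).[rs`_i] != 0.
      rewrite horner_prod; apply/prodf_neq0 => j ne_ji.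
      by rewrite hornerXsubC subr_eq0 (inj_eq inj_a) eq_sym.
    by rewrite -(scalerK nz (y i)) memvZ.
  by rewrite horner_prod (bigD1 j) //= hornerXsubC subrr mul0r scale0r.
exists (\big[cat/[::]]_i (vbasis (U :&: V i)%VS : seq L)).
  by rewrite [X in basis_of X]defU; apply: bigcat_basis => // i _; apply: vbasisP.
elim/big_ind: _ => [//|b1 b2 h1 h2 y|i _ y /vbasis_mem].
  by rewrite mem_cat => /orP[/h1|/h2].
by rewrite memv_cap => /andP[_ /leigenspaceP fy]; exists rs`_i.
Qed.

End Koszul.

(** * Weight centralizers in coordinates *)

Lemma natr_inj0 (K : fieldType) : [pchar K] =i pred0 ->
  injective (fun n : nat => n%:R : K).
Proof.
move=> K0; have z n : (n%:R == 0 :> K) = (n == 0)%N by move/pcharf0P: K0; apply.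
suff le m n : m%:R = n%:R :> K -> (m <= n)%N.
  by move=> m n e; apply/eqP; rewrite eqn_leq !le.
move=> e; rewrite leqNgt; apply/negP => lt.
have := z (m - n)%N; rewrite natrB ?(ltnW lt) // e subrr eqxx => /esym.
by rewrite subn_eq0 leqNgt lt.
Qed.

Section WeightCentralizers.

Variables (K : fieldType) (N : nat).
Hypothesis K_char0 : [pchar K] =i pred0.
Implicit Types (g U W : {vspace 'M[K]_N}) (X Y P J : 'M[K]_N).
Implicit Types (e h : 'M[K]_N * 'M[K]_N).

Lemma weight_centralizerP g e h p q X :
  reflect [/\ X \in g, ad e.1 X = 0, ad e.2 X = 0, ad h.1 X = p *: X
            & ad h.2 X = q *: X]
          (X \in weight_centralizer g e h p q).
Proof.
rewrite /weight_centralizer /pair_centralizer.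
apply: (iffP memv_capP) => [[/memv_capP[/memv_capP[/memv_capP[Xg e1] e2]]]|].
  rewrite !memv_ker in e1 e2 => /leigenspaceP h1 /leigenspaceP h2.
  by split=> //; apply/eqP.
case=> Xg e1 e2 h1 h2; split; last exact/leigenspaceP.
apply/memv_capP; split; last exact/leigenspaceP.
by apply/memv_capP; split; [apply/memv_capP; split|]; rewrite // memv_ker ?e1 ?e2.
Qed.

(** Past [m0] nothing is added, so the required space is one finite sum. Distinct naturals stay
    distinct in characteristic 0, so the summands are independent and the dimensions add up. *)
Lemma wonderfulE g rk e h m0 :
    (forall p q, (m0 <= p)%N \/ (m0 <= q)%N ->
       weight_centralizer g e h p%:R q%:R = 0%VS) ->
  wonderful g rk e h <->
    (\sum_(p < m0) \sum_(q < m0) \dim (weight_centralizer g e h p%:R q%:R)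
       = rk)%N.
Proof.
pose Z p q := weight_centralizer g e h p%:R q%:R.
move=> Z0; pose S m := (\sum_(p < m) \sum_(q < m) Z p q)%VS.
have Zsub p q : (Z p q <= S m0)%VS.
  have [lt_p|le_p] := ltnP p m0; last by rewrite /Z Z0 ?sub0v //; left.
  have [lt_q|le_q] := ltnP q m0; last by rewrite /Z Z0 ?sub0v //; right.
  apply: subv_trans (sumv_sup (Ordinal lt_p) _ (subvv _)) => //.
  exact: subv_trans (sumv_sup (Ordinal lt_q) _ (subvv _)).
have Ssub m : (S m <= S m0)%VS.
  by apply/subv_sumP => p _; apply/subv_sumP => q _.
have inj m : injective (fun i : 'I_m => i%:R : K).
  by move=> i j /(natr_inj0 K_char0) /val_inj.
have dS : (\dim (S m0) = \sum_(p < m0) \sum_(q < m0) \dim (Z p q))%N.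
  apply: directvP => /=; apply/directv_sumE; split=> [p _ /=|].
    by apply: leigen_directv (inj _) _ => q; apply: capvSr.
  apply: leigen_directv (inj _) _ => p /=; apply/subv_sumP => q _.
  exact: subv_trans (capvSl _ _) (capvSr _ _).
rewrite -dS; split=> [[W WP <-]|<-].
  congr (\dim _); apply/eqP; rewrite eqEsubv; apply/andP; split; apply/subvP=> x.
    by move=> Sx; apply/WP; exists m0.
  by case/WP=> m /(subvP (Ssub m)).
exists (S m0) => // x; split=> [Sx|[m /(subvP (Ssub m))//]]; by exists m0.
Qed.

End WeightCentralizers.

(** * Supports of matrices and change of basis *)

Section Masks.

Variables (K : fieldType) (N : nat).
Implicit Types (X Y : 'M[K]_N) (b : 'I_N -> 'I_N -> bool).

Definition mask b X := \matrix_(i, j) (if b i j then X i j else 0).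

Fact mask_is_linear b : linear (mask b).
Proof.
move=> a X Y; apply/matrixP => i j; rewrite !mxE.
by case: (b i j); rewrite ?mulr0 ?addr0.
Qed.

HB.instance Definition _ b :=
  GRing.isLinear.Build K 'M[K]_N 'M[K]_N _ (mask b) (mask_is_linear b).

Definition mask_space b : {vspace 'M[K]_N} :=
  lker (linfun (mask (fun i j => ~~ b i j))).

Lemma mask_spaceP b X :
  reflect (forall i j, X i j != 0 -> b i j) (X \in mask_space b).
Proof.
rewrite memv_ker lfunE; apply: (iffP eqP) => [/matrixP X0 i j|Xb].
  by apply: contraR => nb; have := X0 i j; rewrite !mxE nb => ->.
apply/matrixP => i j; rewrite !mxE; case: ifPn => //.
by move/(contra (Xb i j)); rewrite negbK => /eqP.
Qed.

End Masks.

Section Conjugation.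

Variables (K : fieldType) (T : lie_type) (N : nat) (J P : 'M[K]_N).
Hypothesis P_unit : P \in unitmx.
Implicit Types (X Y : 'M[K]_N) (e h : 'M[K]_N * 'M[K]_N).

Definition cj X := invmx P *m X *m P.
Definition cj_pair e := (cj e.1, cj e.2).
Definition cj_form := P^T *m J *m P.

Fact cj_is_linear : linear cj.
Proof. by move=> a X Y; rewrite /cj mulmxDr -scalemxAr mulmxDl -scalemxAl. Qed.

HB.instance Definition _ :=
  GRing.isLinear.Build K 'M[K]_N 'M[K]_N _ cj cj_is_linear.

Lemma cjM X Y : cj (X *m Y) = cj X *m cj Y.
Proof. by rewrite /cj !mulmxA mulmxK. Qed.

Lemma cjV X : cj (P *m X *m invmx P) = X.
Proof. by rewrite /cj !mulmxA mulVmx // mul1mx mulmxKV. Qed.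

Lemma cj_inj : injective cj.
Proof.
move=> X Y /(congr1 (fun Z => P *m Z *m invmx P)).
by rewrite /cj !mulmxA mulmxV // !mul1mx !mulmxK.
Qed.

Lemma cj_ad X Y : cj (ad X Y) = ad (cj X) (cj Y).
Proof. by rewrite !adE linearB /= !cjM. Qed.

Lemma cj_classical X : (cj X \in classical T cj_form) = (X \in classical T J).
Proof.
have form : (cj X \in form_algebra cj_form) = (X \in form_algebra J).
  rewrite !form_algebraE /cj_form /cj !trmx_mul !mulmxA.
  have PV : (invmx P)^T *m P^T = 1%:M by rewrite -trmx_mul mulmxV // trmx1.
  have -> : P^T *m X^T *m (invmx P)^T *m P^T *m J *m P + P^T *m J *m P *m invmx P *m X *m P
     = P^T *m (X^T *m J + J *m X) *m P.
    by rewrite mulmxK // -(mulmxA _ _ P^T) PV mulmx1 mulmxDr mulmxDl !mulmxA.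
  apply/eqP/eqP => [h|->]; last by rewrite mulmx0 mul0mx.
  have := congr1 (fun Z => (invmx P)^T *m Z *m invmx P) h.
  by rewrite !mulmxA PV mul1mx mulmxK // mulmx0 mul0mx.
case: T => //=; rewrite !special_linearE /cj mxtrace_mulC mulmxA mulmxV //.
by rewrite mul1mx.
Qed.

Lemma cj_weight_centralizer e h p q :
  \dim (weight_centralizer (classical T cj_form) (cj_pair e) (cj_pair h) p q)
    = \dim (weight_centralizer (classical T J) e h p q).
Proof.
have ker0 : lker (linfun cj) == 0%VS.
  by apply/lker0P => X Y; rewrite !lfunE; apply: cj_inj.
rewrite -[RHS](limg_dim_eq (f := linfun cj)); last by rewrite (eqP ker0) capv0.
congr (\dim _); apply/vspaceP => X; apply/idP/memv_imgP => [|[Y + ->]].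
  have -> : X = cj (P *m X *m invmx P) by rewrite cjV.
  move/weight_centralizerP; cbn [fst snd cj_pair]; rewrite -!cj_ad -!linearZ /= cj_classical.
  case=> Xg; rewrite -[0](linear0 cj) => /cj_inj e1 /cj_inj e2 /cj_inj h1 /cj_inj h2.
  exists (P *m X *m invmx P); rewrite ?lfunE //.
  by apply/weight_centralizerP; split; rewrite ?h1 ?h2 // -scalemxAr.
case/weight_centralizerP => Yg e1 e2 h1 h2; rewrite lfunE /=.
apply/weight_centralizerP; cbn [fst snd cj_pair]; rewrite -!cj_ad cj_classical e1 e2 h1 h2.
by rewrite !linear0 !linearZ.
Qed.

End Conjugation.

(** * Graded modules over a commuting pair *)

Lemma mulmx_neq0 (K : fieldType) (m n p : nat) (A : 'M[K]_(m, n))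
    (B : 'M[K]_(n, p)) i j :
  (A *m B) i j != 0 -> exists2 k, A i k != 0 & B k j != 0.
Proof.
rewrite mxE => nz; have [/existsP[k /andP[]]|] := boolP [exists k, (A i k != 0) && (B k j != 0)].
  by exists k.
rewrite negb_exists => /forallP no; case/eqP: nz; apply: big1 => k _.
by have := no k; rewrite negb_and !negbK => /orP[] /eqP->; rewrite ?mul0r ?mulr0.
Qed.

Lemma mulmx_single (K : fieldType) (m n p : nat) (A : 'M[K]_(m, n))
    (B : 'M[K]_(n, p)) i j k :
  (forall l, A i l != 0 -> B l j != 0 -> l = k) ->
  (A *m B) i j = A i k * B k j.
Proof.
move=> only; rewrite mxE (bigD1 k) //= big1 ?addr0 // => l ne_lk.
have [->|nA] := eqVneq (A i l) 0; first by rewrite mul0r.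
have [->|nB] := eqVneq (B l j) 0; first by rewrite mulr0.
by rewrite (only l) ?eqxx // in ne_lk.
Qed.

Lemma nat_shift_bound (K : fieldType) (I : finType) (w : I -> K) :
    [pchar K] =i pred0 ->
  exists M, forall n i j, (M <= n)%N -> w i != w j + n%:R.
Proof.
move=> K0; have one (ij : I * I) :
    exists M, forall n, (M <= n)%N -> w ij.1 != w ij.2 + n%:R.
  have [[n wn]|no] := classic (exists n, w ij.1 = w ij.2 + n%:R).
    exists n.+1 => k; rewrite wn; apply: contraL => /eqP /addrI.
    by move/(natr_inj0 K0) <-; rewrite ltnn.
  by exists 0 => n _; apply: contra_notN no => /eqP ?; exists n.
have [M MP] := fin_all_exists one.
exists (\max_ij M ij) => n i j le_n; apply: (MP (i, j)).
by apply: leq_trans le_n; apply: leq_bigmax.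
Qed.

Section Graded.

Variables (K : fieldType) (N : nat) (C : eqType).
Hypothesis K_char0 : [pchar K] =i pred0.

Definition edge (e1 e2 : 'M[K]_N) : rel 'I_N := fun i j =>
  [|| e1 i j != 0, e1 j i != 0, e2 i j != 0 | e2 j i != 0].

(** Matrices act on columns, so the entry [(i, j)] sends the [j]-th basis vector to the [i]-th: a
    matrix supported here is block-diagonal of degree [(p, q)]. With a constant [c] only the
    condition on weights remains. *)
Definition shift_by (w1 w2 : 'I_N -> K) (c : 'I_N -> C) (p q : nat) (i j : 'I_N) : bool :=
  [&& c i == c j, w1 i == w1 j + p%:R & w2 i == w2 j + q%:R].

(* The module [K^N] over [K[e1, e2]], graded by [(w1, w2)], is a direct sum of
   blocks, labelled by [c]: in each block the weights are distinct and any two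
   basis vectors are linked by non-zero entries of [e1] and [e2]. *)
Record graded_module (e1 e2 : 'M[K]_N) (w1 w2 : 'I_N -> K) (c : 'I_N -> C) := {
  gm_e1 : forall i j, e1 i j != 0 -> shift_by w1 w2 c 1 0 i j;
  gm_e2 : forall i j, e2 i j != 0 -> shift_by w1 w2 c 0 1 i j;
  gm_comm : e1 *m e2 = e2 *m e1;
  gm_inj : forall i j, shift_by w1 w2 c 0 0 i j -> i = j;
  gm_conn : forall i j, c i = c j -> connect (edge e1 e2) i j }.

Variables (e1 e2 : 'M[K]_N) (w1 w2 : 'I_N -> K) (c : 'I_N -> C).
Hypothesis gm : graded_module e1 e2 w1 w2 c.

Local Notation deg := (shift_by w1 w2 c).

Lemma degP p q i j :
  reflect [/\ c i = c j, w1 i = w1 j + p%:R & w2 i = w2 j + q%:R] (deg p q i j).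
Proof.
by apply: (iffP and3P) => [[/eqP ? /eqP ? /eqP ?]|[-> -> ->]].
Qed.

Lemma deg_trans p q p' q' i j k :
  deg p q i j -> deg p' q' j k -> deg (p' + p) (q' + q) i k.
Proof.
move=> /degP[ci w1i w2i] /degP[cj w1j w2j]; apply/degP.
by rewrite ci cj w1i w1j w2i w2j !natrD !addrA.
Qed.

Lemma deg_inj p q i i' j : deg p q i j -> deg p q i' j -> i = i'.
Proof.
move=> /degP[ci w1i w2i] /degP[ci' w1i' w2i']; apply: gm_inj gm _ _ _.
by apply/degP; rewrite ci ci' w1i w1i' w2i w2i' !addr0.
Qed.

Lemma deg_injr p q i j j' : deg p q i j -> deg p q i j' -> j = j'.
Proof.
move=> /degP[ci w1i w2i] /degP[ci' w1i' w2i']; apply: gm_inj gm _ _ _.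
apply/degP; rewrite !addr0; split; first by rewrite -ci.
  by apply: (addIr p%:R); rewrite -w1i.
by apply: (addIr q%:R); rewrite -w2i.
Qed.

Definition mon p q : 'M[K]_N := iter p (mulmx e1) (iter q (mulmx e2) 1%:M).

Lemma mon_e1 p q : e1 *m mon p q = mon p q *m e1.
Proof.
rewrite /mon; elim: p => [|p IH] /=; last by rewrite {1}IH mulmxA.
elim: q => [|q IH] /=; first by rewrite mulmx1 mul1mx.
by rewrite mulmxA (gm_comm gm) -mulmxA IH mulmxA.
Qed.

Lemma mon_e2 p q : e2 *m mon p q = mon p q *m e2.
Proof.
rewrite /mon; elim: p => [|p IH] /=.
  by elim: q => [|q IH] /=; [rewrite mulmx1 mul1mx | rewrite {1}IH mulmxA].
by rewrite mulmxA -(gm_comm gm) -mulmxA IH mulmxA.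
Qed.

Lemma monS1 p q : mon p.+1 q = e1 *m mon p q.
Proof. by []. Qed.

Lemma monS2 p q : mon p q.+1 = e2 *m mon p q.
Proof.
elim: p => [//|p IH]; rewrite !monS1 IH !mulmxA; congr (_ *m _).
exact: gm_comm gm.
Qed.

Lemma mon0_comm X p : e1 *m X = X *m e1 -> X *m mon p 0 = mon p 0 *m X.
Proof.
move=> X1; elim: p => [|p IH]; first by rewrite /mon /= mulmx1 mul1mx.
by rewrite monS1 mulmxA -X1 -mulmxA IH mulmxA.
Qed.

Lemma deg_e1 p q (X : 'M[K]_N) i j : (forall i j, X i j != 0 -> deg p q i j) ->
  (e1 *m X) i j != 0 -> deg p.+1 q i j.
Proof.
move=> Xd /mulmx_neq0[k /(gm_e1 gm) ik /Xd kj].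
by have := deg_trans ik kj; rewrite addn1 addn0.
Qed.

Lemma deg_e2 p q (X : 'M[K]_N) i j : (forall i j, X i j != 0 -> deg p q i j) ->
  (e2 *m X) i j != 0 -> deg p q.+1 i j.
Proof.
move=> Xd /mulmx_neq0[k /(gm_e2 gm) ik /Xd kj].
by have := deg_trans ik kj; rewrite addn1 addn0.
Qed.

Lemma mon_deg p q i j : mon p q i j != 0 -> deg p q i j.
Proof.
elim: p i j => [|p IH] i j; last by rewrite monS1; apply: deg_e1.
elim: q i j => [|q IH] i j; last by rewrite monS2; apply: deg_e2.
rewrite mxE; have [->|] := eqVneq i j; last by rewrite eqxx.
by move=> _; apply/degP; rewrite !addr0.
Qed.

Definition arrow (e : 'M[K]_N) i j := e j i != 0.

Lemma arrow_partial_injection :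
  partial_injection (arrow e1) /\ partial_injection (arrow e2).
Proof.
split; split=> i j k.
- by move=> /(gm_e1 gm) h1 /(gm_e1 gm); apply: deg_inj.
- by move=> /(gm_e1 gm) h1 /(gm_e1 gm); apply: deg_injr.
- by move=> /(gm_e2 gm) h1 /(gm_e2 gm); apply: deg_inj.
- by move=> /(gm_e2 gm) h1 /(gm_e2 gm); apply: deg_injr.
Qed.

(** Weights in a block being distinct, the entry of the product along a two-step path is a single
    non-zero term. By commutation the product in the other order is non-zero there too, and some
    term of it passes through the fourth corner. *)
Lemma fills_arrows : fills (arrow e1) (arrow e2) /\ fills (arrow e2) (arrow e1).
Proof.
have gen (f g : 'M[K]_N) : f *m g = g *m f ->
    partial_injection (arrow f) -> fills (arrow f) (arrow g).
  move=> fg [finj _] i j k fji gkj.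
  have : (g *m f) k i != 0.
    rewrite (mulmx_single (k := j)) ?mulf_neq0 // => l _ fli.
    exact: finj fli fji.
  by rewrite -fg => /mulmx_neq0[l kl li]; exists l.
have [i1 i2] := arrow_partial_injection.
by split; apply: gen => //; rewrite (gm_comm gm).
Qed.

Lemma connect_mono i j : c i = c j ->
  exists s t p q, mono (arrow e1) (arrow e2) s t p q i j.
Proof.
move/(gm_conn gm)/connectP => [r pr ->].
have [i1 i2] := arrow_partial_injection; have [f1 f2] := fills_arrows.
apply: walk_mono pr => // x y; rewrite /edge.
case/or4P; [exists false; left|exists true; left|exists false; right|exists true; right]; done.
Qed.

Definition signed (s : bool) (p : nat) : K := if s then p%:R else - p%:R.

Lemma mono_weight s t p q i j : mono (arrow e1) (arrow e2) s t p q i j ->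
  [/\ c j = c i, w1 j = w1 i + signed s p & w2 j = w2 i + signed t q].
Proof.
elim=> {p q i j} [i|p q i j k _ [<- hj1 hj2] st|p q i j k _ [<- hj1 hj2] st].
- by rewrite /signed; split=> //; case: s t => [] []; rewrite ?oppr0 addr0.
- have [-> hk1 hk2] : [/\ c k = c j, w1 k = w1 j + signed s 1 & w2 k = w2 j].
    case: s st {hj1} => /= /(gm_e1 gm) /degP[-> -> ->]; rewrite addr0 //.
    by rewrite addrK.
  rewrite hk1 hk2 hj1 hj2; split=> //; rewrite -addrA; congr (_ + _).
  by rewrite /signed; case: s {st hj1 hk1}; rewrite -?opprD -natrD addn1.
- have [-> hk1 hk2] : [/\ c k = c j, w1 k = w1 j & w2 k = w2 j + signed t 1].
    case: t st {hj2} => /= /(gm_e2 gm) /degP[-> -> ->]; rewrite addr0 //.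
    by rewrite addrK.
  rewrite hk1 hk2 hj1 hj2; split=> //; rewrite -addrA; congr (_ + _).
  by rewrite /signed; case: t {st hj2 hk2}; rewrite -?opprD -natrD addn1.
Qed.

Lemma signed_nat s p n : signed s p = n%:R -> p = n /\ (s \/ n = 0%N).
Proof.
rewrite /signed; case: s => [/(natr_inj0 K_char0) ->|]; first by split=> //; left.
move/eqP; rewrite eq_sym -subr_eq0 opprK -natrD.
rewrite -[0](mulr0n 1) => /eqP /(natr_inj0 K_char0) /eqP.
by rewrite addn_eq0 => /andP[/eqP -> /eqP ->]; split=> //; right.
Qed.

Lemma mono_mon p q i j : mono (arrow e1) (arrow e2) true true p q i j ->
  mon p q j i != 0.
Proof.
elim=> {p q i j} [i|p q i j k _ IH st|p q i j k _ IH st].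
- by rewrite mxE eqxx oner_eq0.
- rewrite monS1 (mulmx_single (k := j)) ?mulf_neq0 // => l _ /mon_deg li.
  exact: deg_inj li (mon_deg IH).
- rewrite monS2 (mulmx_single (k := j)) ?mulf_neq0 // => l _ /mon_deg li.
  exact: deg_inj li (mon_deg IH).
Qed.

(** A monotone walk exists by connectivity, and its signed step numbers are read off the weights. In
    characteristic 0 a backward count equal to a natural number must be 0, so the walk goes
    forward. *)
Lemma deg_mono p q i j :
  deg p q i j -> mono (arrow e1) (arrow e2) true true p q j i.
Proof.
case/degP=> cij w1i w2i.
have [s [t [p' [q' m]]]] := connect_mono (esym cij).
have [_] := mono_weight m; rewrite w1i w2i => /addrI/esym/signed_nat[ep s1].
move=> /addrI/esym/signed_nat[eq s2]; subst p' q'.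
exact: mono_forward m s1 s2.
Qed.

(** The entry is a product along one walk, with no other term to cancel it. This non-vanishing is
    what allows division by monomials. *)
Lemma mon_neq0 p q i j : deg p q i j -> mon p q i j != 0.
Proof. by move/deg_mono/mono_mon. Qed.

End Graded.

(** * Surjectivity of the adjoint action on blocks *)

Lemma ad_comm (K : fieldType) (N : nat) (X Y Z : 'M[K]_N) :
  X *m Y = Y *m X -> ad X (ad Y Z) = ad Y (ad X Z).
Proof.
move=> XY; rewrite !adE !mulmxBr !mulmxBl !mulmxA XY -!(mulmxA Z) XY !opprB.
by rewrite [X in _ + X = _]addrC addrACA [X in _ + X = _]addrC.
Qed.

Section Blocks.

Variables (K : fieldType) (N : nat) (C : eqType).
Hypothesis K_char0 : [pchar K] =i pred0.
Variables (e1 e2 : 'M[K]_N) (w1 w2 : 'I_N -> K) (c : 'I_N -> C).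
Hypothesis gm : graded_module e1 e2 w1 w2 c.

Local Notation deg := (shift_by w1 w2 c).
Local Notation mon := (mon e1 e2).

Lemma mulmx_diag (X : 'M[K]_N) (f : 'I_N -> K) i j :
  (X *m diag_mx (\row_k f k)) i j = X i j * f j.
Proof. by rewrite mul_mx_diag !mxE. Qed.

(** A column of [mon p q] has at most one non-zero entry, and has one whenever some vector lies at
    the shifted weight. Dividing by it turns a block matrix of degree [(p, q)] into a function on
    basis vectors, on which [ad e1] and [ad e2] act as difference operators. *)
Lemma deg_diag p q (X : 'M[K]_N) : (forall i j, X i j != 0 -> deg p q i j) ->
  exists f : 'I_N -> K, X = mon p q *m diag_mx (\row_k f k).
Proof.
move=> Xd; exists (fun j => if [pick i | deg p q i j] is Some i
                            then X i j / mon p q i j else 0).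
apply/matrixP => i j; rewrite mulmx_diag; case: pickP => [i' di'|no].
  have [eX|/Xd di] := eqVneq (X i j) 0; last first.
    by rewrite (deg_inj gm di' di) mulrC divfK // (mon_neq0 K_char0 gm).
  have [->|/(mon_deg gm) di] := eqVneq (mon p q i j) 0; first by rewrite mul0r.
  by rewrite (deg_inj gm di' di) eX mul0r mulr0.
by rewrite mulr0; apply/eqP; apply: contraT => /Xd; rewrite no.
Qed.

Let w1_bound := nat_shift_bound w1 K_char0.
Let w2_bound := nat_shift_bound w2 K_char0.

Lemma telescope (F : nat -> K) M :
  F M = 0 -> \sum_(n < M) F n - \sum_(n < M) F n.+1 = F 0.
Proof.
move=> FM; have -> : F 0 = F 0 - F M by rewrite FM subr0.
elim: M {FM} => [|M IH].
  by rewrite !big_ord0 !subrr.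
by rewrite !big_ord_recr /= opprD addrACA IH; ring.
Qed.

Lemma ad1_onto p q (X : 'M[K]_N) : (forall i j, X i j != 0 -> deg p.+1 q i j) ->
  exists2 Y : 'M[K]_N, forall i j, Y i j != 0 -> deg p q i j & ad e1 Y = X.
Proof.
case/deg_diag => g ->; have [M MP] := w1_bound.
(* [G] extends [g] by zero to places without a basis vector, and [F] sums it along the ray to the
   right, so that [F] at a weight minus [F] one step further is [G]. Stopping after [M] terms loses
   nothing, since the ray has left all weights by then. *)
pose G a x y := \sum_(j | [&& c j == a, w1 j == x & w2 j == y]) g j.
pose F a x y := \sum_(n < M) G a (x + n%:R) y.
pose f j := F (c j) (w1 j) (w2 j).
exists (mon p q *m diag_mx (\row_k f k)) => [i j|].
  by rewrite mulmx_diag mulf_eq0 negb_or => /andP[/(mon_deg gm)].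
apply/matrixP => i j; rewrite adE mulmxA mxE mulmx_diag [X in _ + X]mxE.
have -> : (mon p q *m diag_mx (\row_k f k) *m e1) i j
        = (mon p q *m e1) i j * F (c j) (w1 j + 1) (w2 j).
  rewrite !mxE mulr_suml; apply: eq_bigr => k _; rewrite mulmx_diag.
  have [->|/(gm_e1 gm)] := eqVneq (e1 k j) 0; first by rewrite !mulr0 mul0r.
  by case/degP=> ck wk1 wk2; rewrite /f ck wk1 wk2 addr0 mulrAC.
rewrite -(mon_e1 gm) -monS1 mulmx_diag -mulrBr; congr (_ * _).
rewrite /f /F; under [X in _ - X]eq_bigr do rewrite -addrA -[1]/1%:R -natrD add1n.
rewrite (telescope (F := fun n => G (c j) (w1 j + n%:R) (w2 j))) /= /G.
  rewrite addr0 (big_pred1 j) // => k; apply/and3P/eqP => [[/eqP a /eqP b /eqP d]|->//].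
  by apply: (gm_inj gm); apply/degP; rewrite !addr0.
by rewrite big1 // => k /and3P[_ wk _]; rewrite (negbTE (MP M k j _)) in wk.
Qed.

Lemma ad2_onto p q (X : 'M[K]_N) : (forall i j, X i j != 0 -> deg p q.+1 i j) ->
    ad e1 X = 0 ->
  exists2 Y : 'M[K]_N, forall i j, Y i j != 0 -> deg p q i j &
    ad e1 Y = 0 /\ ad e2 Y = X.
Proof.
move=> Xd; rewrite adE; have [g defX] := deg_diag Xd.
move/subr0_eq=> X1; have [M MP] := w2_bound.
(* Commutation with [e1] makes the coefficients of [X] constant along each row of a block, on the
   columns where [mon p q.+1] is non-zero. The solution can then be taken to depend on the block and
   [w2] only, so that it commutes with [e1] too. *)
have row_const i j i' j' : c j = c j' -> w2 j = w2 j' ->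
    deg p q.+1 i j -> deg p q.+1 i' j' -> g j = g j'.
  move=> cj wj dij dij'.
  (* Of two columns in one row of a block, one is [k] steps to the right of the other. Then the
     [(i', j)] entries of both products of [X] with [mon k 0] are compared. *)
  wlog [k jj'] : i j i' j' cj wj dij dij' / exists k, deg k 0 j' j.
    move=> wl; have [s [t [k [l m]]]] := connect_mono gm cj.
    have [_ m1 m2] := mono_weight gm m.
    case: s m1 m => m1 _; first by apply: wl dij dij' _ => //; exists k; apply/degP; rewrite -cj addr0.
    apply/esym/(wl i' j' i j) => //; exists k; apply/degP; rewrite addr0; split=> //.
    by rewrite m1 /signed subrK.
  have di : deg (p + k) q.+1 i' j.
    by have := deg_trans dij' jj'; rewrite addnC add0n.
  have := congr1 (fun Z : 'M_N => Z i' j) (mon0_comm e2 k X1).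
  rewrite {1}defX (mulmx_single (k := j')) => [|l _ /(mon_deg gm) lj]; last first.

 exact: (deg_inj gm lj jj').
  rewrite mulmx_diag defX mulmxA mulmx_diag.
  have -> : (mon k 0 *m mon p q.+1) i' j = mon p q.+1 i' j' * mon k 0 j' j.
    rewrite -(mon0_comm e2 k (mon_e1 gm p q.+1)) (mulmx_single (k := j')) //.
    by move=> l _ /(mon_deg gm) lj; apply: (deg_inj gm lj jj').
  rewrite mulrAC => h; apply/esym; apply: mulfI h.
  by rewrite mulf_neq0 // (mon_neq0 K_char0 gm).
(* Which column is picked is irrelevant by [row_const]; a row where no column carries a coefficient
   gets 0. *)
pose G a y := if [pick ij : 'I_N * 'I_N | [&& c ij.2 == a, w2 ij.2 == y & deg p q.+1 ij.1 ij.2]]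
              is Some ij then g ij.2 else 0.
pose F a y := \sum_(n < M) G a (y + n%:R).
pose f j := F (c j) (w2 j).
have F1 : (mon p q *m diag_mx (\row_k f k)) *m e1 = e1 *m (mon p q *m diag_mx (\row_k f k)).
  rewrite mulmxA (mon_e1 gm); apply/matrixP => i j; rewrite mulmx_diag !mxE mulr_suml.
  apply: eq_bigr => k _; rewrite mulmx_diag.
  have [->|/(gm_e1 gm)] := eqVneq (e1 k j) 0; first by rewrite !mulr0 mul0r.
  by case/degP=> ck wk1 wk2; rewrite /f ck wk2 addr0 mulrAC.
exists (mon p q *m diag_mx (\row_k f k)) => [i j|].
  by rewrite mulmx_diag mulf_eq0 negb_or => /andP[/(mon_deg gm)].
split; first by rewrite adE F1 subrr.
rewrite defX; apply/matrixP => i j; rewrite adE mulmxA mxE mulmx_diag [X in _ + X]mxE.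
have -> : (mon p q *m diag_mx (\row_k f k) *m e2) i j
        = (mon p q *m e2) i j * F (c j) (w2 j + 1).
  rewrite !mxE mulr_suml; apply: eq_bigr => k _; rewrite mulmx_diag.
  have [->|/(gm_e2 gm)] := eqVneq (e2 k j) 0; first by rewrite !mulr0 mul0r.
  by case/degP=> ck wk1 wk2; rewrite /f ck wk2 mulrAC.
rewrite -(mon_e2 gm) -(monS2 gm) mulmx_diag -mulrBr.
have [->|/(mon_deg gm) dij] := eqVneq (mon p q.+1 i j) 0; first by rewrite !mul0r.
congr (_ * _); rewrite /f /F.
under [X in _ - X]eq_bigr do rewrite -addrA -[1]/1%:R -natrD add1n.
rewrite (telescope (F := fun n => G (c j) (w2 j + n%:R))) /= /G.
  case: pickP => [[i' j'] /= /and3P[/eqP cj /eqP wj dij']|no].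
    apply: row_const dij' dij => //; by rewrite wj addr0.
  by have := no (i, j); rewrite /= addr0 !eqxx dij.
by case: pickP => [[i' j'] /= /and3P[_ wk _]|//]; rewrite (negbTE (MP M j' j _)) in wk.
Qed.

(* Descent to a subspace [g] cut out by a projection [pi] that commutes with
   the pair and preserves the grading. *)
Lemma blocks_count (g : {vspace 'M[K]_N}) (pi : 'M[K]_N -> 'M[K]_N) m :
    (forall X, pi X \in g) -> (forall X, X \in g -> pi X = X) ->
    (forall X, ad e1 (pi X) = pi (ad e1 X)) ->
    (forall X, ad e2 (pi X) = pi (ad e2 X)) -> pi 0 = 0 ->
    (forall p q (X : 'M[K]_N), (forall i j, X i j != 0 -> deg p q i j) ->
       forall i j, pi X i j != 0 -> deg p q i j) ->
    (forall n i j, (m <= n)%N -> w1 i != w1 j + n%:R) ->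
    (forall n i j, (m <= n)%N -> w2 i != w2 j + n%:R) ->
  (\sum_(p < m) \sum_(q < m)
      \dim (g :&: mask_space K (deg p q) :&: lker (ad e1) :&: lker (ad e2))
    = \dim (g :&: mask_space K (deg 0 0)))%N.
Proof.
move=> pig gpi pi1 pi2 pi0 pid m1 m2.
apply: (koszul_count (G := fun p q => g :&: mask_space K (deg p q))%VS).
- move=> p q; apply/vspaceP => X; apply/memv_imgP/memv_capP.
    case=> Y /memv_capP[Yg /mask_spaceP Yd] ->; split.
      by rewrite -(gpi Y Yg) pi1.
    apply/mask_spaceP => i j; rewrite adE mxE [X in _ + X]mxE => nz.
    have [e1Y|] := eqVneq ((e1 *m Y) i j) 0; last exact: deg_e1 gm _ _ _ _ _ Yd.
    move: nz; rewrite e1Y add0r oppr_eq0 => /mulmx_neq0[k /Yd ik /(gm_e1 gm) kj].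
    exact: deg_trans ik kj.
  case=> Xg /mask_spaceP /ad1_onto[Y Yd XY]; exists (pi Y).
    by apply/memv_capP; split=> //; apply/mask_spaceP/pid.
  by rewrite pi1 XY gpi.
- move=> p q; apply/vspaceP => X; apply/memv_imgP/memv_capP.
    case=> Y /memv_capP[/memv_capP[Yg /mask_spaceP Yd] Y1] ->; split.
      apply/memv_capP; split; first by rewrite -(gpi Y Yg) pi2.
      apply/mask_spaceP => i j; rewrite adE mxE [X in _ + X]mxE => nz.
      have [e2Y|] := eqVneq ((e2 *m Y) i j) 0; last exact: deg_e2 gm _ _ _ _ _ Yd.
      move: nz; rewrite e2Y add0r oppr_eq0 => /mulmx_neq0[k /Yd ik /(gm_e2 gm) kj].
      exact: deg_trans ik kj.
    move: Y1; rewrite !memv_ker ad_comm ?(gm_comm gm) // => /eqP ->.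
    by rewrite linear0.
  case=> /memv_capP[Xg /mask_spaceP Xd]; rewrite memv_ker => /eqP X1.
  have [Y Yd [Y1 XY]] := ad2_onto Xd X1; exists (pi Y).
    apply/memv_capP; split; last by rewrite memv_ker pi1 Y1 pi0.
    by apply/memv_capP; split=> //; apply/mask_spaceP/pid.
  by rewrite pi2 XY gpi.
- move=> p q le; apply/eqP; rewrite -subv0; apply/subvP => X /memv_capP[_ /mask_spaceP Xd].
  rewrite memv0; apply/eqP/matrixP => i j; rewrite mxE; apply/eqP; apply: contraT.
  case/Xd/degP=> _ a b; case: le => le.
    by have := m1 p i j le; rewrite a eqxx.
  by have := m2 q i j le; rewrite b eqxx.
Qed.

End Blocks.

Section DiagonalCoordinates.

Variables (K : fieldType) (N : nat) (C : eqType).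
Hypothesis K_char0 : [pchar K] =i pred0.
Variables (e1 e2 : 'M[K]_N) (w1 w2 : 'I_N -> K) (c : 'I_N -> C).
Hypothesis gm : graded_module e1 e2 w1 w2 c.

Local Notation deg := (shift_by w1 w2 c).

Definition diagw (w : 'I_N -> K) : 'M[K]_N := diag_mx (\row_i w i).

Lemma ad_diagw w (X : 'M[K]_N) i j : ad (diagw w) X i j = (w i - w j) * X i j.
Proof.
rewrite adE [LHS]mxE [X in _ + X]mxE /diagw mul_diag_mx mul_mx_diag !mxE.
ring.
Qed.

Lemma ad_diagwP w (X : 'M[K]_N) a :
  ad (diagw w) X = a *: X <-> forall i j, X i j != 0 -> w i = w j + a.
Proof.
split=> [/matrixP h i j nz|h].
  have := h i j; rewrite ad_diagw mxE => /(mulIf nz) <-.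
  by rewrite addrC subrK.
apply/matrixP => i j; rewrite ad_diagw mxE.
have [->|/h ->] := eqVneq (X i j) 0; first by rewrite !mulr0.
by rewrite addrC addKr.
Qed.

Lemma weight_centralizer_diag (g : {vspace 'M[K]_N}) p q X :
  reflect [/\ X \in g, ad e1 X = 0, ad e2 X = 0
            & forall i j, X i j != 0 -> w1 i = w1 j + p /\ w2 i = w2 j + q]
          (X \in weight_centralizer g (e1, e2) (diagw w1, diagw w2) p q).
Proof.
apply: (iffP (weight_centralizerP _ _ _ _ _ _)).
  case=> Xg ? ? /ad_diagwP h1 /ad_diagwP h2; split=> // i j nz.
  by split; [apply: h1 | apply: h2].
case=> Xg ? ? h; split=> //; by apply/ad_diagwP => i j /h[].
Qed.

Definition weight_bound m :=
  forall n i j, (m <= n)%N -> w1 i != w1 j + n%:R /\ w2 i != w2 j + n%:R.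

Lemma weight_bound_ex : exists m, weight_bound m.
Proof.
have [m1 m1P] := nat_shift_bound w1 K_char0.
have [m2 m2P] := nat_shift_bound w2 K_char0.
exists (maxn m1 m2) => n i j; rewrite geq_max => /andP[le1 le2].
by split; [apply: m1P | apply: m2P].
Qed.

Lemma weight_centralizer_bound m p q g : weight_bound m ->
    (m <= p)%N \/ (m <= q)%N ->
  weight_centralizer g (e1, e2) (diagw w1, diagw w2) p%:R q%:R = 0%VS.
Proof.
move=> mP le; apply/eqP; rewrite -subv0; apply/subvP => X.
case/weight_centralizer_diag => _ _ _ Xd; rewrite memv0; apply/eqP/matrixP => i j.
rewrite mxE; apply/eqP; apply: contraT => /Xd[/eqP a /eqP b]; exfalso.
by case: le => /(mP _ i j)[]; rewrite ?a ?b.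
Qed.

Lemma mask_deg0P (X : 'M[K]_N) :
  reflect (forall i j, i != j -> X i j = 0) (X \in mask_space K (deg 0 0)).
Proof.
apply: (iffP (mask_spaceP _ _)) => h i j.
  by move=> ne; apply/eqP; apply: contraT => /h /(gm_inj gm) e; rewrite e eqxx in ne.
have [<- _|/h ->] := eqVneq i j; last by rewrite eqxx.
by apply/degP; rewrite !addr0.
Qed.

Definition graded_projection (g : {vspace 'M[K]_N}) (pi : 'M[K]_N -> 'M[K]_N) :=
  [/\ forall X, pi X \in g, forall X, X \in g -> pi X = X,
      forall X, ad e1 (pi X) = pi (ad e1 X),
      forall X, ad e2 (pi X) = pi (ad e2 X) &
      pi 0 = 0 /\ forall p q (X : 'M[K]_N), (forall i j, X i j != 0 -> deg p q i j) ->
       forall i j, pi X i j != 0 -> deg p q i j].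

(** The second hypothesis says that different blocks do not interact within [g] in degrees
    [p, q >= 0]; the weight centralizers are then the kernels counted by [blocks_count]. *)
Lemma blocks_total (g : {vspace 'M[K]_N}) pi m :
    graded_projection g pi ->
    (forall p q (X : 'M[K]_N) i j, X \in g -> X i j != 0 ->
       w1 i = w1 j + p%:R -> w2 i = w2 j + q%:R -> c i = c j) ->
    weight_bound m ->
  (\sum_(p < m) \sum_(q < m)
      \dim (weight_centralizer g (e1, e2) (diagw w1, diagw w2) p%:R q%:R)
    = \dim (g :&: mask_space K (deg 0 0)))%N.
Proof.
case=> pig gpi pi1 pi2 [pi0 pid] same mP.
have wcE p q : weight_centralizer g (e1, e2) (diagw w1, diagw w2) p%:R q%:R
     = (g :&: mask_space K (deg p q) :&: lker (ad e1) :&: lker (ad e2))%VS.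
  apply/vspaceP => X; apply/weight_centralizer_diag/memv_capP.
    case=> Xg X1 X2 Xd; split; last by rewrite memv_ker X2.
    apply/memv_capP; split; last by rewrite memv_ker X1.
    apply/memv_capP; split=> //; apply/mask_spaceP => i j nz.
    by have [a b] := Xd i j nz; apply/degP; split=> //; apply: same nz a b.
  case=> /memv_capP[/memv_capP[Xg /mask_spaceP Xd]]; rewrite !memv_ker.
  by move=> /eqP X1 /eqP X2; split=> // i j /Xd /degP[].
rewrite -(@blocks_count _ _ _ K_char0 _ _ _ _ _ gm g pi m) //.
- by apply: eq_bigr => p _; apply: eq_bigr => q _; rewrite wcE.
- by move=> n i j /(mP _ i j)[].
- by move=> n i j /(mP _ i j)[].
Qed.

End DiagonalCoordinates.

Lemma card_involution N (s : 'I_N -> 'I_N) : involutive s ->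
  (#|[set i : 'I_N | (i < s i)%N]| * 2 + #|[set i | s i == i]| = N)%N.
Proof.
move=> sK; pose H := [set i : 'I_N | (i < s i)%N]; pose H' := [set i : 'I_N | (s i < i)%N].
have sH : H' = s @: H.
  apply/setP => i; apply/idP/imsetP => [|[j]]; rewrite !inE.
    by exists (s i); rewrite ?inE sK.
  by move=> lt ->; rewrite sK.
have cH : #|H'| = #|H| by rewrite sH card_imset //; apply: (can_inj sK).
rewrite -/H (_ : #|H| * 2 = #|H :|: H'|)%N.
  rewrite (_ : [set i | s i == i] = ~: (H :|: H')) ?cardsC ?card_ord //.
  by apply/setP => i; rewrite !inE negb_or -!leqNgt -eqn_leq.
rewrite cardsU cH (_ : H :&: H' = set0) ?cards0 ?subn0 ?addnn ?muln2 //.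
apply/setP => i; rewrite !inE; apply/negP => /andP[l1 l2].
by have := ltn_trans l1 l2; rewrite ltnn.
Qed.

(** * Diagonal matrices and projections onto the classical algebras *)

Section DiagonalPart.

Variables (K : fieldType) (N : nat) (C : eqType).
Hypothesis K_char0 : [pchar K] =i pred0.
Variables (e1 e2 : 'M[K]_N) (w1 w2 : 'I_N -> K) (c : 'I_N -> C).
Hypothesis gm : graded_module e1 e2 w1 w2 c.

Local Notation deg := (shift_by w1 w2 c).

Definition diag_entries k (t : 'I_k -> 'I_N) (X : 'M[K]_N) : 'rV[K]_k :=
  \row_l X (t l) (t l).

Fact diag_entries_is_linear k (t : 'I_k -> 'I_N) : linear (diag_entries t).
Proof. by move=> a X Y; apply/rowP => l; rewrite !mxE. Qed.

HB.instance Definition _ k (t : 'I_k -> 'I_N) :=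
  GRing.isLinear.Build K 'M[K]_N 'rV[K]_k _ (diag_entries t)
    (diag_entries_is_linear t).

Lemma dim_diag_entries k (t : 'I_k -> 'I_N) (U : {vspace 'M[K]_N}) :
    (forall X, X \in U -> (forall l, X (t l) (t l) = 0) -> X = 0) ->
    (forall v : 'I_k -> K, exists2 X, X \in U & forall l, X (t l) (t l) = v l) ->
  \dim U = k.
Proof.
move=> inj sur; rewrite -(limg_dim_eq (f := linfun (diag_entries t))).
  suff -> : (linfun (diag_entries t) @: U = fullv)%VS.
    by rewrite dimvf /dim /= mul1n.
  apply/vspaceP => v; rewrite memvf; apply/memv_imgP.
  have [X XU Xv] := sur (fun l => v 0 l); exists X => //.
  by rewrite lfunE; apply/rowP => l; rewrite mxE.
apply/eqP; rewrite -subv0; apply/subvP => X /memv_capP[XU].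
rewrite memv_ker lfunE memv0 => /eqP/rowP X0; apply/eqP/inj => // l.
by have := X0 l; rewrite !mxE.
Qed.

Lemma dim_mask_deg0 : \dim (mask_space K (deg 0 0)) = N.
Proof.
apply: (dim_diag_entries (t := id)) => [X /(mask_deg0P gm) X0 Xii|v].
  apply/matrixP => i j; rewrite mxE.
  by have [<-|/X0] := eqVneq i j; first exact: Xii.
exists (diagw v) => [|l]; last by rewrite !mxE eqxx.
by apply/(mask_deg0P gm) => i j ne; rewrite !mxE (negbTE ne).
Qed.

Lemma dim_special_linear_deg0 : (0 < N)%N ->
  (\dim (special_linear K N :&: mask_space K (deg 0 0))).+1 = N.
Proof.
move=> N0; rewrite -[RHS]dim_mask_deg0.
rewrite -[RHS](limg_ker_dim (linfun (fun X : 'M[K]_N => \tr X : K^o))).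
rewrite (capvC (special_linear K N)) -addn1; congr (_ + _)%N; apply/esym.
suff -> : (linfun (fun X : 'M[K]_N => \tr X : K^o) @: mask_space K (deg 0 0) = fullv)%VS.
  by rewrite dimvf /dim.
apply/vspaceP => a; rewrite memvf; apply/memv_imgP.
exists (diagw (fun i => if i == Ordinal N0 then a else 0)).
  by apply/(mask_deg0P gm) => i j ne; rewrite !mxE (negbTE ne).
rewrite lfunE /= /mxtrace (bigD1 (Ordinal N0)) //= big1 ?addr0 => [|i ne].
  by rewrite !mxE eqxx.
by rewrite !mxE (negbTE ne) eqxx.
Qed.

Lemma special_linear_projection : (0 < N)%N ->
  graded_projection e1 e2 w1 w2 c (special_linear K N)
    (fun X => X - (\tr X / N%:R)%:M).
Proof.
move=> N0; have nz : N%:R != 0 :> K.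
  by rewrite -[0](mulr0n 1) (inj_eq (natr_inj0 K_char0)) -lt0n.
have ad_scalar (x : 'M[K]_N) a : ad x a%:M = 0.
  by rewrite adE scalar_mxC subrr.
have tr_ad (x X : 'M[K]_N) : \tr (ad x X) = 0.
  by rewrite adE linearB /= mxtrace_mulC subrr.
split.
- by move=> X; rewrite special_linearE linearB /= mxtrace_scalar -(mulr_natr (_ / _)) divfK ?subrr.
- by move=> X; rewrite special_linearE => /eqP->; rewrite mul0r raddf0 subr0.
- by move=> X; rewrite linearB /= ad_scalar tr_ad mul0r !raddf0.
- by move=> X; rewrite linearB /= ad_scalar tr_ad mul0r !raddf0.
split=> [|p q X Xd i j]; first by rewrite raddf0 mul0r raddf0 subr0.
(* The subtracted scalar has degree [(0, 0)]. It is non-zero only if the trace is, and then [X] has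
   a non-zero diagonal entry, which forces its own degree to be 0. *)
have [eX|/Xd //] := eqVneq (X i j) 0; rewrite !mxE eX add0r oppr_eq0.
have [<-|_] := eqVneq i j; last by rewrite mulr0n eqxx.
rewrite mulr1n mulf_eq0 negb_or => /andP[trX _].
have [/existsP[k /Xd /degP[_ p0 q0]]|] := boolP [exists k, X k k != 0].
  apply/degP; split=> //; first by apply: (addrI (w1 k)); rewrite addrCA -p0 addrC.
  by apply: (addrI (w2 k)); rewrite addrCA -q0 addrC.
rewrite negb_exists => /forallP no; case/eqP: trX; apply: big1 => k _.
by apply/eqP; have := no k; rewrite negbK.
Qed.

(** In the bases used here the Gram matrix is monomial: [s] is the duality on basis vectors, and
    [fi_c] says that each block is its own dual. *)
Record form_involution (J : 'M[K]_N) (s : 'I_N -> 'I_N) : Prop := {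
  fi_inv : involutive s;
  fi_form : forall i j, (J i j != 0) = (j == s i);
  fi_w1 : forall i, w1 (s i) = - w1 i;
  fi_w2 : forall i, w2 (s i) = - w2 i;
  fi_c : forall i, c (s i) = c i }.

Variables (J : 'M[K]_N) (s : 'I_N -> 'I_N).
Hypothesis fi : form_involution J s.
Hypothesis J_unit : J \in unitmx.

Lemma J_supp i j : J i j != 0 -> j = s i.
Proof. by rewrite (fi_form fi) => /eqP. Qed.

Lemma invmx_supp i j : invmx J i j != 0 -> j = s i.
Proof.
move=> nz; apply/eqP; apply: contraT => ne.
have jn : J j (s j) != 0 by rewrite (fi_form fi).
have : (invmx J *m J) i (s j) = invmx J i j * J j (s j).
  by apply: mulmx_single => l _ /J_supp /(congr1 s); rewrite !(fi_inv fi).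
rewrite mulVmx // mxE => /eqP; rewrite (_ : (i == s j) = false).
  by rewrite eq_sym mulf_eq0 (negbTE nz) (negbTE jn).
by apply: contra_neqF ne => /eqP->; rewrite (fi_inv fi).
Qed.

Lemma form_diagP (X : 'M[K]_N) : (forall i j, i != j -> X i j = 0) ->
  reflect (forall i, X (s i) (s i) = - X i i) (X \in form_algebra J).
Proof.
move=> Xd; have XJ i j : (X^T *m J + J *m X) i j = J i j * (X i i + X j j).
  rewrite mxE (mulmx_single (k := i)) => [|l]; last first.
    by rewrite mxE => nz _; apply/eqP; apply: contraT => /Xd e; rewrite e eqxx in nz.
  rewrite (mulmx_single (k := j)) => [|l _ nz]; last first.
    by apply/eqP; apply: contraT => /Xd e; rewrite e eqxx in nz.
  by rewrite mxE mulrDr mulrC.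
rewrite form_algebraE; apply: (iffP eqP) => [/matrixP h i|h].
  have := h i (s i); rewrite XJ mxE => /eqP; rewrite mulf_eq0.
  by rewrite (negbTE (_ : J i (s i) != 0)) ?(fi_form fi) //= addrC addr_eq0 => /eqP.
apply/matrixP => i j; rewrite XJ mxE; have [->|/J_supp ->] := eqVneq (J i j) 0.
  by rewrite mul0r.
by rewrite h subrr mulr0.
Qed.

(** A diagonal element of the algebra takes opposite values at [i] and [s i]: it vanishes at the
    fixed points and is free on one index of each pair, the smaller one in [H]. *)
Lemma dim_form_deg0 :
  (\dim (form_algebra J :&: mask_space K (deg 0 0)) * 2 + #|[set i | s i == i]| = N)%N.
Proof.
pose H := [set i : 'I_N | (i < s i)%N].
have two : (2 : K) != 0.
  by rewrite -[0](mulr0n 1) (inj_eq (natr_inj0 K_char0)).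
have -> : \dim (form_algebra J :&: mask_space K (deg 0 0)) = #|H|.
  pose t (l : 'I_#|H|) := enum_val l.
  apply: (dim_diag_entries (t := t)) => [X /memv_capP[Xg /(mask_deg0P gm) Xd] Xt|v].
    move/form_diagP: Xg => /(_ Xd) Xs.
    have XH i : i \in H -> X i i = 0.
      by move=> iH; have := Xt (enum_rank_in iH i); rewrite /t enum_rankK_in.
    apply/matrixP => i j; rewrite mxE; have [<-|/Xd //] := eqVneq i j.
    have [lt|lt|eq] := ltngtP i (s i).
    - by apply: XH; rewrite inE.
    - rewrite -[i](fi_inv fi) Xs XH ?oppr0 // inE (fi_inv fi) //.
    - have := Xs i; rewrite -(val_inj eq) => /eqP.
      by rewrite -addr_eq0 -mulr2n -mulr_natl mulf_eq0 (negbTE two) /= => /eqP.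
  pose u i := if [pick l | t l == i] is Some l then v l else 0.
  have ut l : u (t l) = v l.
    rewrite /u; case: pickP => [l' /eqP /enum_val_inj -> //|/(_ l)].
    by rewrite eqxx.
  have u0 i : i \notin H -> u i = 0.
    rewrite /u; case: pickP => // l /eqP <-.
    by rewrite enum_valP.
  pose X := diagw (fun i => u i - u (s i)).
  have Xd i j : i != j -> X i j = 0 by move=> ne; rewrite !mxE (negbTE ne).
  exists X => [|l]; last first.
    rewrite !mxE eqxx mulr1n ut u0 ?subr0 //.
    have := enum_valP l; rewrite !inE (fi_inv fi) => lt.
    by rewrite -leqNgt ltnW.
  apply/memv_capP; split; last exact/(mask_deg0P gm).
  by apply/form_diagP => // i; rewrite !mxE !eqxx !mulr1n (fi_inv fi) opprB.
exact: card_involution (fi_inv fi).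
Qed.

(** [invmx J *m X^T *m J] is the adjoint of [X] for the form, and the algebra consists of the
    matrices opposite to their adjoint: this is the projection onto it along the self-adjoint
    matrices. *)
Definition form_pi (X : 'M[K]_N) := 2^-1 *: (X - invmx J *m X^T *m J).

(** Minus the adjoint is a Lie algebra involution that fixes [e1] and [e2], hence the projection
    commutes with their brackets. It keeps degrees because [s] negates weights while transposition
    exchanges source and target. *)
Lemma form_projection eps : J^T = eps *: J -> eps * eps = 1 ->
    e1 \in form_algebra J -> e2 \in form_algebra J ->
  graded_projection e1 e2 w1 w2 c (form_algebra J) form_pi.
Proof.
move=> JT eps2 e1g e2g.
have two : (2 : K) != 0.
  by rewrite -[0](mulr0n 1) (inj_eq (natr_inj0 K_char0)).
have JTV : J^T *m invmx J = eps%:M.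
  by rewrite JT -scalemxAl mulmxV // scalemx1.
have pi_ad e X : e \in form_algebra J -> ad e (form_pi X) = form_pi (ad e X).
  rewrite form_algebraE addrC addr_eq0 => /eqP Je.
  have eJ : e *m invmx J = - (invmx J *m e^T).
    rewrite -[LHS]mul1mx -(mulVmx J_unit) -!mulmxA (mulmxA J) Je.
    by rewrite mulNmx mulmxN -!mulmxA mulmxV // mulmx1.
  rewrite /form_pi linearZ /=; congr (_ *: _).
  have tr : (e *m X - X *m e)^T = X^T *m e^T - e^T *m X^T.
    by rewrite [LHS]linearB /= !trmx_mul.
  rewrite !adE tr !mulmxBr !mulmxBl !opprB !mulmxA eJ !mulNmx.
  rewrite -!(mulmxA _ J) Je !mulmxN !mulmxA.
  by rewrite opprK [X in _ + X = _]addrC addrACA.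
split; try by move=> X; apply: pi_ad.
- move=> X; rewrite form_algebraE /form_pi linearZ /= -scalemxAl -scalemxAr -scalerDr.
  rewrite scaler_eq0; apply/orP; right; rewrite linearB /= !trmx_mul trmxK.
  rewrite mulmxBl mulmxBr !mulmxA mulmxV // mul1mx.
  have -> : J^T *m X *m (invmx J)^T *m J = J *m X.
    have -> : (invmx J)^T = eps *: invmx J.
      have J2 : J = eps *: J^T by rewrite JT scalerA eps2 scale1r.
      rewrite -[LHS]mulmx1 -(mulmxV J_unit) [X in _ *m (X *m _)]J2.
      by rewrite -scalemxAl -scalemxAr mulmxA -trmx_mul mulmxV // trmx1 mul1mx.
    by rewrite JT -!scalemxAl -scalemxAr -!scalemxAl scalerA eps2 scale1r mulmxKV.
  by apply/eqP; rewrite addrC addrA subrK subrr.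
- move=> X; rewrite form_algebraE addrC addr_eq0 => /eqP JX.
  have -> : form_pi X = 2^-1 *: (X + X).
    by rewrite /form_pi -mulmxA -[_^T *m J]opprK -JX mulmxN opprK mulmxA mulVmx // mul1mx.
  by rewrite -mulr2n -scaler_nat scalerA mulVf // scale1r.
split; first by rewrite /form_pi trmx0 mulmx0 mul0mx subr0 scaler0.
move=> p q X Xd i j; rewrite mxE mulf_eq0 negb_or => /andP[_].
rewrite mxE; have [->|/Xd //] := eqVneq (X i j) 0; rewrite add0r mxE oppr_eq0.
case/mulmx_neq0 => l /mulmx_neq0[k /invmx_supp -> +] /J_supp ->.
rewrite mxE => /Xd /degP[a b d]; apply/degP; rewrite !(fi_w1 fi) !(fi_w2 fi) !(fi_c fi) in a b d *.
split=> //; first by rewrite b opprD opprK subrK.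
by rewrite d opprD opprK subrK.
Qed.

End DiagonalPart.

(** * Semisimple elements of classical Lie algebras are diagonalizable *)

Section Diagonalizability.

Variables (K : closedFieldType) (N : nat).
Implicit Types (A B x : 'M[K]_N) (u v w : 'cV[K]_N).

(** The hypothesis excludes Jordan chains of length 2. If the minimal polynomial had a double root
    [r], one factor ['X - r%:P] could be dropped and the quotient would still kill [A]. *)
Lemma diagonalizable_ker2 A :
    (forall a v, (A - a%:M) *m ((A - a%:M) *m v) = 0 -> (A - a%:M) *m v = 0) ->
  diagonalizable A.
Proof.
case: N A => [|n] A ker2.
  by rewrite (_ : A = 0); [apply: diagonalizable0 | apply/matrixP => -[]].
have [rs defp] := closed_field_poly_normal (mxminpoly A).
rewrite (monicP (mxminpoly_monic A)) scale1r in defp.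
apply/diagonalizableP; exists rs; rewrite -?defp //.
apply: contraT => /uniqPn-/(_ 0)[i [j [lt_ij lt_j e]]].
have [q defq] : exists q, mxminpoly A = ('X - (rs`_i)%:P) * ('X - (rs`_i)%:P) * q.
  pose I := [pred k : 'I_(size rs) | true].
  exists (\prod_(k < size rs | (k != Ordinal lt_j) && (k != Ordinal (ltn_trans lt_ij lt_j))) ('X - (rs`_k)%:P)).
  rewrite defp (big_nth 0) big_mkord (bigD1 (Ordinal lt_j)) //= -e.
  rewrite (bigD1 (Ordinal (ltn_trans lt_ij lt_j))) /= ?mulrA //.
  by rewrite -val_eqE /= neq_ltn lt_ij.
set r := rs`_i in defq.
have hr : horner_mx A ('X - r%:P) = A - r%:M.
  by rewrite rmorphB /= horner_mx_X horner_mx_C.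
have : horner_mx A (('X - r%:P) * q) = 0.
  have h0 : (A - r%:M) *m ((A - r%:M) *m horner_mx A q) = 0.
    rewrite mulmxA -hr !mulmxE -!rmorphM -defq; exact: mx_root_minpoly.
  apply/matrixP => k l; rewrite rmorphM /= hr [RHS]mxE.
  set H := horner_mx A q in h0 *; have := ker2 r (H *m delta_mx l 0).
  rewrite (mulmxA _ H) (mulmxA _ (_ *m H)) h0 mul0mx -colE => /(_ erefl).
  by move/matrixP/(_ k 0); rewrite !mxE.
move/mxminpoly_min/dvdp_leq; rewrite defq -mulrA.
have nz : ('X - r%:P) * q != 0.
  apply: contraTneq (mxminpoly_monic A) => z.
  by rewrite defq -mulrA z mulr0 monicE lead_coef0 eq_sym oner_eq0.
by move/(_ nz); rewrite size_mul ?polyXsubC_eq0 // size_XsubC add2n /= ltnn.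
Qed.

Lemma singular_eigen A a : A - a%:M \notin unitmx ->
  exists2 w : 'cV[K]_N, w != 0 & A *m w = a *: w.
Proof.
rewrite -unitmx_tr -row_free_unit -kermx_eq0 => /rowV0Pn[v].
move/sub_kermxP => /(congr1 trmx); rewrite trmx_mul trmxK trmx0 mulmxBl.
rewrite mul_scalar_mx => /subr0_eq Av nz; exists v^T => //.
by apply: contra nz => /eqP /(congr1 trmx); rewrite trmxK trmx0 => ->.
Qed.

Lemma unique_eigenvalue_nilpotent A a :
    (forall b, A - b%:M \notin unitmx -> b = a) ->
  exists k, iter k (mulmx (A - a%:M)) 1%:M = 0.
Proof.
case: N A => [|n] A only; first by exists 0; apply/matrixP => -[].
have [rs defp] := closed_field_poly_normal (mxminpoly A).
rewrite (monicP (mxminpoly_monic A)) scale1r in defp.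
have rs_a r : r \in rs -> r = a.
  move=> r_rs; apply: only; rewrite -row_free_unit -kermx_eq0.
  have : eigenvalue A r.
    by rewrite eigenvalue_root_char -root_mxminpoly defp root_prod_XsubC.
  by [].
exists (size rs); have := mx_root_minpoly A; rewrite defp.
have -> : \prod_(z <- rs) ('X - z%:P) = ('X - a%:P) ^+ size rs.
  rewrite big_tnth -[in RHS](card_ord (size rs)) -prodr_const.
  by apply: eq_bigr => i _; rewrite (rs_a (tnth _ i)) // mem_tnth.
rewrite rmorphXn rmorphB /= horner_mx_X horner_mx_C => <-.
by elim: (size rs) => //= k ->; rewrite exprS.
Qed.

Lemma codiagonalizable_weights A B : diagonalizable A -> diagonalizable B ->
    A *m B = B *m A ->
  exists P, P \in unitmx /\
    exists w1 w2 : 'I_N -> K, cj P A = diagw w1 /\ cj P B = diagw w2.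
Proof.
move=> dA dB AB; have : codiagonalizable [:: A; B].
  apply/codiagonalizableP; split=> [X Y|X]; last by rewrite !inE => /orP[]/eqP->.
  by rewrite !inE => /orP[]/eqP-> /orP[]/eqP->; rewrite /comm_mx ?AB.
case=> P Pu /= /and3P[PA PB _].
have D X : similar_diag P X -> exists w : 'I_N -> K, cj (invmx P) X = diagw w.
  move/similar_diagPex => [D /(similarRL Pu) defD].
  exists (fun i => D 0 i); rewrite /cj invmxK -defD; congr diag_mx.
  by apply/rowP => i; rewrite mxE.
have [w1 ?] := D _ PA; have [w2 ?] := D _ PB.
by exists (invmx P); rewrite unitmx_inv; split=> //; exists w1, w2.
Qed.

Section Semisimple.

Variables (g : {vspace 'M[K]_N}) (x : 'M[K]_N).
Hypothesis x_ss : lie_semisimple_elt g x.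

Definition adl a y := ad x y - a *: y.

Lemma semisimple_ker2 a y : y \in g -> adl a (adl a y) = 0 -> adl a y = 0.
Proof.
case: x_ss => b gb b_eigen yg.
pose t := in_tuple b; have ft : free t := basis_free gb.
have [r rP] : exists r : 'I_(size b) -> K, forall i : 'I_(size b), ad x t`_i = r i *: t`_i.
  have ex (i : 'I_(size b)) : exists a, ad x t`_i = a *: t`_i.
    by apply: b_eigen; apply: mem_nth.
  by have [r rP] := fin_all_exists ex; exists r.
have yE : y = \sum_(i < size b) coord t i y *: t`_i.
  by apply: coord_span; rewrite (span_basis gb).
have adl_sum (k : 'I_(size b) -> K) : adl a (\sum_(i < size b) k i *: t`_i) = \sum_(i < size b) (k i * (r i - a)) *: t`_i.
  rewrite /adl linear_sum scaler_sumr -sumrB; apply: eq_bigr => i _.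
  by rewrite linearZ /= rP !scalerA -scalerBl mulrBr [a * _]mulrC.
rewrite yE !adl_sum => /(freeP ft _) z; apply: big1 => i _.
have /eqP := z i; rewrite !mulf_eq0 => /orP[/orP[]|]/eqP->;
  by rewrite ?mul0r ?mulr0 scale0r.
Qed.

End Semisimple.

End Diagonalizability.

(** If [f *m B = 0], then [ad x] acts on the rank one matrices [u *m f] as [B] acts on [u], so a
    Jordan chain of [x] becomes one of [ad x]. *)
Lemma semisimple_sl_diagonalizable (K : closedFieldType) (N : nat) (x : 'M[K]_N) :
    [pchar K] =i pred0 -> (0 < N)%N -> lie_semisimple_elt (special_linear K N) x ->
  diagonalizable x.
Proof.
move=> K0 N0 x_ss; apply: diagonalizable_ker2 => a v BBv.
set B := x - a%:M in BBv *; apply/eqP; apply: contraT => Bv.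
have nB : B \notin unitmx.
  apply: contra Bv => Bu.
  by rewrite -[X in X == _](mulKmx Bu) BBv mulmx0.
have [f f0 fB] : exists2 f : 'rV[K]_N, f != 0 & f *m B = 0.
  move: nB; rewrite -row_free_unit -kermx_eq0 => /rowV0Pn[f /sub_kermxP fB f0].
  by exists f.
have adE0 (u : 'cV[K]_N) : ad x (u *m f) = B *m u *m f.
  have -> : x = B + a%:M by rewrite subrK.
  rewrite adE mulmxDl mulmxDr -(mulmxA u f B) fB mulmx0 add0r mul_scalar_mx mul_mx_scalar.
  by rewrite addrK mulmxA.
have nz : N%:R != 0 :> K.
  by rewrite -[0](mulr0n 1) (inj_eq (natr_inj0 K0)) -lt0n.
(* Subtracting a scalar makes the trace 0 without changing brackets. *)
pose y0 := v *m f - (\tr (v *m f) / N%:R)%:M.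
have y0g : y0 \in special_linear K N.
  by rewrite special_linearE linearB /= mxtrace_scalar -(mulr_natr (_ / _)) divfK ?subrr.
have ady0 : ad x y0 = B *m v *m f.
  by rewrite /y0 linearB /= adE0 [X in _ - X]adE scalar_mxC subrr subr0.
have := semisimple_ker2 x_ss (a := 0) y0g; rewrite /adl !scale0r !subr0 ady0 adE0.
rewrite BBv mul0mx => /(_ erefl) Bvf.
have [i fi] : exists i, f 0 i != 0 by apply/rV0Pn.
case/eqP: Bv; apply/matrixP => k l; rewrite [RHS]mxE [l]ord1.
have := congr1 (fun Z : 'M_N => Z k i) Bvf; rewrite [LHS]mxE big_ord1 [RHS]mxE.
by move/eqP; rewrite mulf_eq0 (negbTE fi) orbF => /eqP.
Qed.

Section FormAlgebra.

Variables (K : closedFieldType) (N : nat) (J : 'M[K]_N) (eps : K).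
Hypothesis K_char0 : [pchar K] =i pred0.
Hypothesis J_unit : J \in unitmx.
Hypothesis J_sym : J^T = eps *: J.
Hypothesis eps2 : eps * eps = 1.
Implicit Types (x : 'M[K]_N) (u v w : 'cV[K]_N).

(** Through the form, the orthogonal ([eps = 1]) and symplectic ([eps = -1]) algebras are the
    exterior and symmetric squares of the natural module; this is the image of the product of [u]
    and [w]. *)
Definition wedge u w : 'M[K]_N := u *m w^T *m J - eps *: (w *m u^T *m J).

Lemma wedge_in u w : wedge u w \in form_algebra J.
Proof.
rewrite form_algebraE /wedge linearB linearZ /= !trmx_mul !trmxK J_sym.
rewrite mulmxBl mulmxBr -!scalemxAl -!scalemxAr !scalerA eps2 scale1r !mulmxA.
by apply/eqP; rewrite addrA subrK subrr.
Qed.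

Lemma ad_wedge x u w : x \in form_algebra J ->
  ad x (wedge u w) = wedge (x *m u) w + wedge u (x *m w).
Proof.
rewrite form_algebraE addrC addr_eq0 => /eqP Jx.
rewrite adE /wedge mulmxBr mulmxBl -!scalemxAr -!scalemxAl !trmx_mul !mulmxA.
rewrite -!(mulmxA _ J x) Jx !mulmxN !mulmxA scalerN !opprK.
by rewrite opprD opprK [X in _ + X = _]addrC addrACA [X in _ + X = _]addrC.
Qed.

Lemma wedgeDl u u' w : wedge (u + u') w = wedge u w + wedge u' w.
Proof. by rewrite /wedge [(_ + _)^T]linearD /= mulmxDr !mulmxDl scalerDr opprD addrACA. Qed.

Lemma wedgeDr u w w' : wedge u (w + w') = wedge u w + wedge u w'.
Proof. by rewrite /wedge [(_ + _)^T]linearD /= mulmxDr !mulmxDl scalerDr opprD addrACA. Qed.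

Lemma wedgeZl a u w : wedge (a *: u) w = a *: wedge u w.
Proof.
rewrite /wedge [(_ *: _)^T]linearZ /= -!scalemxAl -!scalemxAr -!scalemxAl scalerBr !scalerA.
by rewrite [eps * a]mulrC.
Qed.

Lemma wedgeZr a u w : wedge u (a *: w) = a *: wedge u w.
Proof.
rewrite /wedge [(_ *: _)^T]linearZ /= -!scalemxAl -!scalemxAr -!scalemxAl scalerBr !scalerA.
by rewrite [eps * a]mulrC.
Qed.

Lemma adl_wedge x a b u w : x \in form_algebra J ->
  adl x (a + b) (wedge u w)
    = wedge ((x - a%:M) *m u) w + wedge u ((x - b%:M) *m w).
Proof.
move=> xg; rewrite /adl ad_wedge // !mulmxBl !mul_scalar_mx.
rewrite wedgeDl wedgeDr -!scaleNr wedgeZl wedgeZr [RHS]addrACA -scalerDl.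
by rewrite -opprD.
Qed.

Lemma wedge_self u : wedge u u = (1 - eps) *: (u *m u^T *m J).
Proof. by rewrite /wedge scalerBl scale1r. Qed.

Lemma wedge0l w : wedge 0 w = 0.
Proof. by rewrite -(scale0r (0 : 'cV_N)) wedgeZl scale0r. Qed.

Lemma wedge0r u : wedge u 0 = 0.
Proof. by rewrite -(scale0r (0 : 'cV_N)) wedgeZr scale0r. Qed.

Lemma wedge_apply u w z :
  wedge u w *m z = (w^T *m J *m z) 0 0 *: u - (eps * (u^T *m J *m z) 0 0) *: w.
Proof.
rewrite /wedge mulmxBl -scalemxAl -!mulmxA.
rewrite {1}[w^T *m (J *m z)]mx11_scalar {1}[u^T *m (J *m z)]mx11_scalar.
by rewrite !mul_mx_scalar scalerA.
Qed.

Lemma outer_eq0 u w : u *m w^T *m J = 0 -> u = 0 \/ w = 0.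
Proof.
move/(congr1 (fun Z => Z *m invmx J)); rewrite mulmxK // mul0mx => uw.
have [->|u0] := eqVneq u 0; [by left | right].
have /cV0Pn[i ui] := u0; apply/colP => j; have := congr1 (fun Z : 'M_N => Z i j) uw.
rewrite !mxE big_ord1 !mxE => /eqP; by rewrite mulf_eq0 (negbTE ui) => /eqP.
Qed.

Lemma wedge_parallel u w : eps = 1 -> u != 0 -> wedge u w = 0 -> exists a, w = a *: u.
Proof.
move=> e1 /cV0Pn[i ui] /(congr1 (fun Z => Z *m invmx J)).
rewrite /wedge e1 scale1r mulmxBl !mulmxK // mul0mx => /subr0_eq uw.
exists (w i 0 / u i 0); apply/colP => j; have := congr1 (fun Z : 'M_N => Z j i) uw.
rewrite !mxE !big_ord1 !mxE => h; apply: (mulIf ui).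
by rewrite -h mulrAC divfK // mulrC.
Qed.

(** For a chain [v], [u = B v], [B u = 0], the shifted [ad x] sends [wedge u v] to [wedge u u] and
    then to 0. Semisimplicity kills [wedge u u], which is twice a rank one matrix unless [u = 0]. *)
Lemma semisimple_alt_diagonalizable x : eps = -1 ->
  x \in form_algebra J -> lie_semisimple_elt (form_algebra J) x -> diagonalizable x.
Proof.
move=> em xg x_ss; apply: diagonalizable_ker2 => a v BBv.
set u := _ *m v in BBv *.
have A2 : adl x (a + a) (wedge u v) = wedge u u.
  by rewrite adl_wedge // -/u BBv wedge0l add0r.
have A3 : adl x (a + a) (wedge u u) = 0.
  by rewrite adl_wedge // BBv wedge0l wedge0r addr0.
have := semisimple_ker2 x_ss (a := a + a) (wedge_in u v); rewrite A2 => /(_ A3).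
rewrite wedge_self em opprK => /eqP; rewrite scaler_eq0 => /orP[|].
  by rewrite -[1 + 1]/(2%:R) ((pcharf0P K).1 K_char0).
by move/eqP/outer_eq0; case.
Qed.

(** Here [wedge u u] vanishes and the symplectic argument gives nothing. Instead, for an eigenvector
    [w], the element [wedge v w] starts a chain of [ad x], which forces [w] to be proportional to
    [u]. So [B] is nilpotent with a one-dimensional kernel; once [B *m B = 0] is known, this leaves
    room for [N <= 2] only. *)
Lemma semisimple_sym_diagonalizable x : eps = 1 -> (2 < N)%N ->
  x \in form_algebra J -> lie_semisimple_elt (form_algebra J) x -> diagonalizable x.
Proof.
move=> e1 N2 xg x_ss; apply: diagonalizable_ker2 => a v BBv.
set B := x - a%:M in BBv *; set u := B *m v in BBv *.
have wself w : wedge w w = 0 by rewrite wedge_self e1 subrr scale0r.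
apply/eqP; apply: contraT => u0.
have eigen w b : x *m w = b *: w -> exists r, w = r *: u.
  move=> xw; have xw0 : (x - b%:M) *m w = 0.
    by rewrite mulmxBl xw mul_scalar_mx subrr.
  have A1 : adl x (a + b) (wedge v w) = wedge u w.
    by rewrite adl_wedge // xw0 wedge0r addr0.
  have A2 : adl x (a + b) (wedge u w) = 0.
    by rewrite adl_wedge // -/B BBv xw0 wedge0l wedge0r addr0.
  have := semisimple_ker2 x_ss (a := a + b) (wedge_in v w); rewrite A1 => /(_ A2).
  exact: wedge_parallel.
have kerB w : B *m w = 0 -> exists r, w = r *: u.
  by rewrite mulmxBl mul_scalar_mx => /subr0_eq /eigen.
(* A chain [w], [v'], [u'] makes [wedge v' u'] vanish, so [u'] is proportional to [v']; as [B] kills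
   [u'], this forces [u' = 0]. *)
have chain3 w : B *m (B *m (B *m w)) = 0 -> B *m (B *m w) = 0.
  move=> B3; set v' := B *m w; set u' := B *m v'.
  have Bu' : B *m u' = 0 by [].
  have A1 : adl x (a + a) (wedge w u') = wedge v' u'.
    by rewrite adl_wedge // -/B -/v' Bu' wedge0r addr0.
  have A2 : adl x (a + a) (wedge v' u') = 0.
    by rewrite adl_wedge // -/B -/u' Bu' wself wedge0r addr0.
  have := semisimple_ker2 x_ss (a := a + a) (wedge_in w u'); rewrite A1 => /(_ A2) z.
  have [v0|nv] := eqVneq v' 0; first by rewrite /u' v0 mulmx0.
  have [r ur] := wedge_parallel e1 nv z.
  have [r0|r0] := eqVneq r 0; first by rewrite ur r0 scale0r.
  have Bv' : v' = r^-1 *: u' by rewrite ur scalerA mulVf // scale1r.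
  by rewrite /u' Bv' -scalemxAr Bu' scaler0.
have only b : x - b%:M \notin unitmx -> b = a.
  case/singular_eigen => w w0 xw; have [r wr] := eigen w b xw.
  have [r0|r0] := eqVneq r 0; first by rewrite wr r0 scale0r eqxx in w0.
  have xu : x *m u = a *: u.
    by move: BBv; rewrite mulmxBl mul_scalar_mx => /subr0_eq.
  move: xw; rewrite wr -scalemxAr xu !scalerA => /eqP; rewrite -subr_eq0 -scalerBl.
  rewrite scaler_eq0 (negbTE u0) orbF subr_eq0 mulrC => /eqP /mulIf -> //.
have rank1 (M : 'M[K]_N) : B *m M = 0 -> (\rank M <= 1)%N.
  move=> BM; have /cV0Pn[i ui] := u0.
  have -> : M = u *m \row_j (M i j / u i 0).
    apply/matrixP => k j; rewrite [RHS]mxE big_ord1 [X in _ = _ * X]mxE.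
    have [|r] := kerB (M *m delta_mx j 0); first by rewrite mulmxA BM mul0mx.
    rewrite -colE => /colP Mr.
    have Mj l : M l j = r * u l 0 by have := Mr l; rewrite [LHS]mxE [RHS]mxE.
    by rewrite !Mj (mulfK ui) [RHS]mulrC.
  by apply: leq_trans (mxrankM_maxl _ _) (rank_leq_col _).
suff BB : B *m B = 0.
  (* [B] kills both itself and its cokernel matrix, so its rank and its corank are at most 1. *)
  have := rank1 _ (mulmx_coker B); rewrite mxrank_coker leq_subLR.
  move=> le; have := leq_trans le (leq_add (rank1 _ BB) (leqnn 1)).
  by rewrite leqNgt N2.
have chain (M : 'M[K]_N) : B *m (B *m (B *m M)) = 0 -> B *m (B *m M) = 0.
  move=> B3; apply/matrixP => k j; rewrite [RHS]mxE.
  have := chain3 (M *m delta_mx j 0).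
  rewrite !(mulmxA _ M) !(mulmxA _ (_ *m M)) !(mulmxA _ (_ *m (_ *m M))) B3 mul0mx.
  by move/(_ erefl); rewrite -colE => /colP/(_ k); rewrite !mxE.
have [k] := unique_eigenvalue_nilpotent only; rewrite -/B.
elim: k => [|k IH] /=; first by move=> e; rewrite -[B]mulmx1 e mulmx0 mulmx0.
case: k IH => [_|[|k] IH].
- by rewrite /= mulmx1 => ->; rewrite mulmx0.
- by rewrite /= mulmx1.
by move/chain/IH.
Qed.

End FormAlgebra.

(** * Distinguished pairs in diagonal coordinates *)

Lemma mem_lie_bracket (K : fieldType) (N : nat) (U W : {vspace 'M[K]_N}) s x :
  s \in U -> x \in W -> ad s x \in lie_bracket U W.
Proof.
move=> sU xW.
have -> : ad s x = \sum_i coord (vbasis U) i s *: ad (vbasis U)`_i x.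
  rewrite {1}(coord_vbasis sU) adE mulmx_suml mulmx_sumr -sumrB.
  by apply: eq_bigr => i _; rewrite adE -scalemxAl -scalemxAr scalerBr.
apply: memv_suml => i _; apply: memvZ.
rewrite (coord_vbasis xW) linear_sum; apply: memv_suml => j _.
rewrite linearZ; apply/memvZ/memv_span/allpairsP.
by exists ((vbasis U)`_i, (vbasis W)`_j); rewrite !mem_nth ?size_tuple.
Qed.

(** Being a multiple of its own bracket with [s], [x] stays in every term of the lower central
    series. *)
Lemma lie_nilpotent_ad (K : fieldType) (N : nat) (H : {vspace 'M[K]_N}) s x a :
  lie_nilpotent H -> s \in H -> x \in H -> ad s x = a *: x -> a != 0 -> x = 0.
Proof.
case=> m Hm sH xH sx a0; apply/eqP; rewrite -memv0 -{}Hm.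
elim: m => //= m IH; rewrite -(scalerK a0 x) -sx memvZ //.
exact: mem_lie_bracket.
Qed.

Lemma pair_centralizerP (K : fieldType) (N : nat) (g : {vspace 'M[K]_N}) e1 e2 X :
  reflect [/\ X \in g, ad e1 X = 0 & ad e2 X = 0]
          (X \in pair_centralizer g (e1, e2)).
Proof.
apply: (iffP memv_capP) => [[/memv_capP[Xg]]|[Xg X1 X2]].
  by rewrite !memv_ker => /eqP X1 /eqP X2.
by split; [apply/memv_capP; split|]; rewrite // memv_ker ?X1 ?X2.
Qed.

Section DiagonalSemisimple.

Variables (K : fieldType) (N : nat) (P : 'M[K]_N) (g : {vspace 'M[K]_N}).
Hypothesis P_unit : P \in unitmx.

Lemma diag_semisimple x d : cj P x = diagw d ->
  (forall y, y \in g -> ad x y \in g) -> lie_semisimple_elt g x.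
Proof.
(* The eigenvalues of [ad x] are differences of diagonal entries; masking, in the basis [P], the
   entries with a given difference yields the eigencomponents. *)
move=> xd xg; pose rs : seq K := undup [seq d ij.1 - d ij.2 | ij : 'I_N * 'I_N].
apply: (eigenbasis (undup_uniq _ : uniq rs) xg) => y yg.
pose b (r : K) (i j : 'I_N) := d i - d j == r.
exists (fun l => P *m mask (b rs`_l) (cj P y) *m invmx P); split=> [|l].
  apply: (cj_inj P_unit); rewrite linear_sum; apply/matrixP => i j.
  rewrite summxE; have in_rs : d i - d j \in rs.
    by rewrite mem_undup; apply/mapP; exists (i, j); rewrite ?mem_enum.
  have lt_l : (index (d i - d j)%R rs < size rs)%N by rewrite index_mem.
  rewrite (bigD1 (Ordinal lt_l)) //= big1 ?addr0 => [|l ne_l].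
    by rewrite cjV // [RHS]mxE /b nth_index // eqxx.
  rewrite cjV // [LHS]mxE /b; case: eqP => // e; case/eqP: ne_l; apply/val_inj => /=.
  by rewrite e index_uniq // undup_uniq.
apply: (cj_inj P_unit); rewrite cj_ad // linearZ /= xd cjV //; apply/ad_diagwP => i j.
by rewrite mxE /b; case: (d i - d j =P rs`_l) => [<- _|_]; rewrite ?eqxx // addrC subrK.
Qed.

End DiagonalSemisimple.

(* What is used of a distinguished pair, in a basis of common eigenvectors of
   its semisimple pair. *)
Record diag_distinguished (K : fieldType) (N : nat) (g : {vspace 'M[K]_N})
    (e1 e2 : 'M[K]_N) (w1 w2 : 'I_N -> K) : Prop := {
  dd_e : e1 \in g /\ e2 \in g;
  dd_comm : e1 *m e2 = e2 *m e1;
  dd_h : diagw w1 \in g /\ diagw w2 \in g;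
  dd_e1 : forall i j, e1 i j != 0 -> w1 i = w1 j + 1 /\ w2 i = w2 j;
  dd_e2 : forall i j, e2 i j != 0 -> w1 i = w1 j /\ w2 i = w2 j + 1;
  dd_cartan : forall s x a,
    s \in pair_centralizer g (diagw w1, diagw w2) ->
    x \in pair_centralizer g (diagw w1, diagw w2) ->
    ad s x = a *: x -> a != 0 -> x = 0;
  dd_reductive : forall d, diagw d \in pair_centralizer g (e1, e2) -> diagw d = 0 }.

Lemma classical_ad (K : fieldType) T (N : nat) (J x y : 'M[K]_N) :
  x \in classical T J -> y \in classical T J -> ad x y \in classical T J.
Proof.
have form : x \in form_algebra J -> y \in form_algebra J -> ad x y \in form_algebra J.
  rewrite !form_algebraE ![_ + J *m _]addrC !addr_eq0 => /eqP xJ /eqP yJ.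
  have tr : (ad x y)^T = y^T *m x^T - x^T *m y^T.
    by rewrite adE [LHS]linearB /= !trmx_mul.
  rewrite tr adE mulmxBr mulmxBl !mulmxA xJ yJ !mulNmx -!mulmxA yJ xJ !mulmxN !opprK.
  by rewrite opprB.
case: T => //= _ _; rewrite special_linearE adE linearB /=.
by rewrite mxtrace_mulC subrr.
Qed.

(** Semisimplicity speaks of [ad], but weight vectors of the natural module are needed: [h1] and
    [h2] are first shown to be diagonalizable as matrices, and they commute. *)
Lemma distinguished_coordinates (K : closedFieldType) T (N : nat) (J : 'M[K]_N) e h :
    [pchar K] =i pred0 -> (0 < N)%N -> (T = TypeB \/ T = TypeD -> 2 < N)%N ->
    classical_form T J -> distinguished (classical T J) e h ->
  exists P, P \in unitmx /\ exists w1 w2,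
    [/\ cj P h.1 = diagw w1, cj P h.2 = diagw w2 &
     diag_distinguished (classical T (cj_form J P)) (cj P e.1) (cj P e.2) w1 w2].
Proof.
case: h => h1 h2; case: e => e1 e2.
move=> K0 N0 N2 TJ [[[e1g e2g] e12 _ [[h1g h2g] h12 [ss1 ss2] _ he]] noss [_ nil _]].
cbn [fst snd] in *.
have diag x : x \in classical T J -> lie_semisimple_elt (classical T J) x -> diagonalizable x.
  case: T N2 TJ {e1g e2g h1g h2g ss1 ss2 noss nil} => /= N2 TJ xg xss.
  - exact: semisimple_sl_diagonalizable xss.
  - case: TJ => Ju JT; apply: (semisimple_sym_diagonalizable (eps := 1)) xss => //.
    + by rewrite scale1r.
    + by rewrite mulr1.
    + by apply: N2; left.
  - case: TJ => Ju JT; apply: (semisimple_alt_diagonalizable (eps := -1)) xss => //.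
    + by rewrite scaleN1r.
    + by rewrite mulrNN mulr1.
  - case: TJ => Ju JT; apply: (semisimple_sym_diagonalizable (eps := 1)) xss => //.
    + by rewrite scale1r.
    + by rewrite mulr1.
    + by apply: N2; right.
have hcomm : h1 *m h2 = h2 *m h1 by move: h12; rewrite adE => /subr0_eq.
have [P [Pu [w1 [w2 [hw1 hw2]]]]] := codiagonalizable_weights (diag _ h1g ss1) (diag _ h2g ss2) hcomm.
exists P; split=> //; exists w1, w2; split=> //.
have memg X : (P *m X *m invmx P \in classical T J) = (X \in classical T (cj_form J P)).
  by rewrite -(cj_classical T J Pu) cjV.
have back X Y : ad (cj P Y) X = 0 -> ad Y (P *m X *m invmx P) = 0.
  by move=> XY; apply: (cj_inj Pu); rewrite cj_ad // cjV // XY linear0.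
have backE X Y Z a : ad X Y = a *: Y -> X = cj P Z ->  ad Z (P *m Y *m invmx P) = a *: (P *m Y *m invmx P).
  by move=> XY eX; apply: (cj_inj Pu); rewrite cj_ad // linearZ /= cjV // -eX XY.
case: he => h1e1 h1e2 h2e1 h2e2; split.
- by rewrite !cj_classical.
- by rewrite -!cjM //; congr (cj P _); move: e12; rewrite adE => /subr0_eq.
- by rewrite -hw1 -hw2 !cj_classical.
- have := ad_diagwP w1 (cj P e1) 1; rewrite -hw1 -cj_ad // h1e1 scale1r => -[/(_ erefl) a _].
  have := ad_diagwP w2 (cj P e1) 0; rewrite -hw2 -cj_ad // h2e1 linear0 scale0r => -[/(_ erefl) b _].
  by move=> i j nz; split; [apply: a | rewrite (b _ _ nz) addr0].
- have := ad_diagwP w1 (cj P e2) 0; rewrite -hw1 -cj_ad // h1e2 linear0 scale0r => -[/(_ erefl) a _].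
  have := ad_diagwP w2 (cj P e2) 1; rewrite -hw2 -cj_ad // h2e2 scale1r => -[/(_ erefl) b _].
  by move=> i j nz; split; [rewrite (a _ _ nz) addr0 | apply: b].
- move=> s x a /pair_centralizerP[sg s1 s2] /pair_centralizerP[xg x1 x2] sx a0.
  rewrite -hw1 -hw2 in s1 s2 x1 x2.
  have H X : X \in classical T (cj_form J P) -> ad (cj P h1) X = 0 -> ad (cj P h2) X = 0 ->
      P *m X *m invmx P \in pair_centralizer (classical T J) (h1, h2).
    by move=> Xg X1 X2; apply/pair_centralizerP; split; rewrite ?memg //; apply: back.
  have := lie_nilpotent_ad nil (H _ sg s1 s2) (H _ xg x1 x2) (backE _ _ _ _ sx _) a0.
  rewrite cjV // => /(_ erefl) /(congr1 (cj P)); by rewrite cjV // linear0.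
- move=> d /pair_centralizerP[dg d1 d2].
  have z : P *m diagw d *m invmx P = 0; last by rewrite -(cjV Pu (diagw d)) z linear0.
  apply: noss.
    by apply/pair_centralizerP; split; rewrite ?memg //; apply: back.
  apply: (diag_semisimple Pu (d := d)); first by rewrite cjV.
  by move=> y; apply: classical_ad; rewrite memg.
Qed.

Definition distinct_weights (K : fieldType) (N : nat) (w1 w2 : 'I_N -> K) :=
  forall i j, w1 i = w1 j -> w2 i = w2 j -> i = j.

Section Components.

Variables (K : closedFieldType) (N : nat) (g : {vspace 'M[K]_N}).
Hypothesis K_char0 : [pchar K] =i pred0.
Variables (e1 e2 : 'M[K]_N) (w1 w2 : 'I_N -> K).
Hypothesis dd : diag_distinguished g e1 e2 w1 w2.

Lemma edge_sym : connect_sym (edge e1 e2).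
Proof.
apply: sym_connect_sym => i j; rewrite /edge.
by rewrite orbCA !orbA [_ || (e2 j i != 0)]orbAC.
Qed.

Definition comp i := fingraph.root (edge e1 e2) i.

Lemma compE i j : (comp i == comp j) = connect (edge e1 e2) i j.
Proof. by rewrite /comp root_connect //; apply: edge_sym. Qed.

Lemma edge_comp i j : edge e1 e2 i j -> comp i = comp j.
Proof. by move=> ij; apply/eqP; rewrite compE connect1. Qed.

Lemma comp_graded : distinct_weights w1 w2 -> graded_module e1 e2 w1 w2 comp.
Proof.
move=> dw; split; last 1 first.
- by move=> i j /eqP; rewrite compE.
- move=> i j nz; have [w1i w2i] := dd_e1 dd nz; rewrite /shift_by w1i w2i !addr0.
  by apply/and3P; split=> //; apply/eqP/edge_comp; rewrite /edge nz.
- move=> i j nz; have [w1i w2i] := dd_e2 dd nz; rewrite /shift_by w1i w2i !addr0.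
  by apply/and3P; split=> //; apply/eqP/edge_comp; rewrite /edge nz !orbT.
- exact: dd_comm dd.
- by move=> i j /degP[_]; rewrite !addr0; apply: dw.
Qed.

(** A diagonal matrix constant on components commutes with [e1] and [e2] and is semisimple, so
    distinguishedness annihilates it. *)
Lemma comp_const_diag d : diagw d \in g ->
    (forall i j, edge e1 e2 i j -> d i = d j) -> forall i, d i = 0.
Proof.
move=> dg de i; have ad0 (e : 'M[K]_N) : (forall i j, e i j != 0 -> d i = d j) -> ad e (diagw d) = 0.
  move=> ed; apply/matrixP => k l; rewrite adE [LHS]mxE [X in _ + X]mxE /diagw.
  rewrite mul_mx_diag mul_diag_mx !mxE; have [->|/ed ->] := eqVneq (e k l) 0.
    by rewrite mulr0 mul0r subrr.
  by rewrite mulrC subrr.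
have : diagw d = 0.
  apply: (dd_reductive dd); apply/pair_centralizerP; split=> //; apply: ad0 => k l nz.
    by apply: de; rewrite /edge nz.
  by apply: de; rewrite /edge nz !orbT.
by move/matrixP/(_ i i); rewrite !mxE eqxx.
Qed.

Lemma in_cartan X : X \in g ->
    (forall i j, X i j != 0 -> w1 i = w1 j /\ w2 i = w2 j) ->
  X \in pair_centralizer g (diagw w1, diagw w2).
Proof.
move=> Xg Xw; apply/pair_centralizerP; split=> //.
  by rewrite -(scale0r X); apply/ad_diagwP => i j /Xw[-> _]; rewrite addr0.
by rewrite -(scale0r X); apply/ad_diagwP => i j /Xw[_ ->]; rewrite addr0.
Qed.

End Components.

Section TypeACoordinates.

Variables (K : closedFieldType) (N : nat).
Hypothesis K_char0 : [pchar K] =i pred0.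
Hypothesis N_gt0 : (0 < N)%N.
Variables (e1 e2 : 'M[K]_N) (w1 w2 : 'I_N -> K).
Hypothesis dd : diag_distinguished (special_linear K N) e1 e2 w1 w2.

(** Two basis vectors of equal weight put [E_ii - E_jj] and [E_ij] into [Z(h)]; their bracket is
    twice [E_ij], against nilpotency. *)
Lemma sl_distinct_weights : distinct_weights w1 w2.
Proof.
move=> i j w1ij w2ij; apply/eqP; apply: contraT => ne.
pose s : 'M[K]_N := delta_mx i i - delta_mx j j; pose x : 'M[K]_N := delta_mx i j.
have tr k : \tr (delta_mx k k : 'M[K]_N) = 1.
  by rewrite /mxtrace (bigD1 k) //= big1 ?addr0 => [|l /negbTE nl]; rewrite mxE ?eqxx ?nl.
have trx : \tr x = 0.
  rewrite /mxtrace big1 // => k _; rewrite mxE; case: eqP => //= ->.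
  by rewrite (negbTE ne).
have : x = 0.
  apply: (dd_cartan dd (s := s) (a := 2%:R)).
  - apply: in_cartan; first by rewrite special_linearE linearB /= !tr subrr.
    move=> k l; rewrite !mxE; have [->//|nkl] := eqVneq k l.
    have F m : (k == m) && (l == m) = false.
      by apply: contraNF nkl => /andP[/eqP-> /eqP->].
    by rewrite !F subrr eqxx.
  - apply: in_cartan; first by rewrite special_linearE trx.
    move=> k l; rewrite mxE; case: (boolP ((k == i) && (l == j))); last by rewrite eqxx.
    by move=> /andP[/eqP-> /eqP->].
  - rewrite adE /s /x mulmxBl mulmxBr !mul_delta_mx !mul_delta_mx_0 // 1?eq_sym //.
    by rewrite subr0 sub0r opprK scaler_nat.
  - by rewrite ((pcharf0P K).1 K_char0).
by move/matrixP/(_ i j)/eqP; rewrite !mxE !eqxx oner_eq0.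
Qed.

Lemma sl_connected i j : comp e1 e2 i = comp e1 e2 j.
Proof.
(* The indicator of a component, shifted by its average to have trace 0, must vanish; so the
   indicator is constant, with value 1 as at [j]. *)
pose avg := (\sum_k (comp e1 e2 k == comp e1 e2 j)%:R) / N%:R : K.
have nz : N%:R != 0 :> K by rewrite ((pcharf0P K).1 K_char0) -lt0n.
have d0 := comp_const_diag dd (d := fun k => (comp e1 e2 k == comp e1 e2 j)%:R - avg).
have {}d0 : forall k, (comp e1 e2 k == comp e1 e2 j)%:R - avg = 0 :> K.
  apply: d0 => [|k l /edge_comp ->//].
  rewrite special_linearE /diagw mxtrace_diag; under eq_bigr do rewrite mxE.
  by rewrite sumrB sumr_const card_ord -(mulr_natr avg) divfK ?subrr.
apply/eqP; have /subr0_eq := d0 i; have /subr0_eq := d0 j; rewrite eqxx => <-.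
by case: eqP => // _ /eqP; rewrite eq_sym oner_eq0.
Qed.

End TypeACoordinates.

Section FormCoordinates.

Variables (K : closedFieldType) (N : nat) (J : 'M[K]_N) (eps : K).
Hypothesis K_char0 : [pchar K] =i pred0.
Hypothesis J_unit : J \in unitmx.
Hypothesis J_sym : J^T = eps *: J.
Hypothesis eps2 : eps * eps = 1.
Variables (e1 e2 : 'M[K]_N) (w1 w2 : 'I_N -> K).
Hypothesis dd : diag_distinguished (form_algebra J) e1 e2 w1 w2.

Implicit Types (u v x y z : 'cV[K]_N).

Local Notation wdg := (wedge J eps).

Definition pairing u v : K := (u^T *m J *m v) 0 0.

Let nat0 n : (n%:R == 0 :> K) = (n == 0)%N := (pcharf0P K).1 K_char0 n.

Lemma eps_neq0 : eps != 0.
Proof. by apply/eqP => e; move: eps2; rewrite e mul0r => /eqP; rewrite eq_sym oner_eq0. Qed.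

Lemma pairingC u v : pairing u v = eps * pairing v u.
Proof.
rewrite /pairing; have -> : (u^T *m J *m v) 0 0 = ((u^T *m J *m v)^T) 0 0.
  by rewrite [RHS]mxE.
by rewrite !trmx_mul trmxK J_sym -scalemxAl -scalemxAr mxE mulmxA.
Qed.

Lemma wedge_pairing u v z :
  wdg u v *m z = pairing v z *: u - (eps * pairing u z) *: v.
Proof. exact: wedge_apply. Qed.

Lemma double_eq0 (a : K) : (a + a == 0) = (a == 0).
Proof. by rewrite -mulr2n -mulr_natl mulf_eq0 nat0. Qed.

Lemma form_weight (w : 'I_N -> K) : diagw w \in form_algebra J ->
  forall i j, J i j != 0 -> w j = - w i.
Proof.
rewrite form_algebraE => /eqP/matrixP h i j nz; have := h i j.
rewrite /diagw tr_diag_mx mul_diag_mx mul_mx_diag !mxE [J i j * _]mulrC -mulrDl.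
by move/eqP; rewrite mulf_eq0 (negbTE nz) orbF addrC addr_eq0 => /eqP.
Qed.

Lemma invform_weight (w : 'I_N -> K) : diagw w \in form_algebra J ->
  forall i j, invmx J i j != 0 -> w j = - w i.
Proof.
rewrite form_algebraE /diagw tr_diag_mx addrC addr_eq0 => /eqP h i j nz.
have /matrixP/(_ i j) : diagw w *m invmx J = - (invmx J *m diagw w).
  rewrite -[LHS]mul1mx -(mulVmx J_unit) -!mulmxA (mulmxA J) h.
  by rewrite mulNmx mulmxN -!mulmxA mulmxV // mulmx1.
rewrite /diagw mul_diag_mx [RHS]mxE mul_mx_diag !mxE [invmx J i j * _]mulrC -mulNr.
by move/(mulIf nz) => ->; rewrite opprK.
Qed.

Definition has_weight (a b : K) v := diagw w1 *m v = a *: v /\ diagw w2 *m v = b *: v.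

Lemma has_weightP a b v :
  (forall i, v i 0 != 0 -> w1 i = a /\ w2 i = b) -> has_weight a b v.
Proof.
move=> va; split; apply/matrixP => i j; rewrite [j]ord1 /diagw mul_diag_mx !mxE.
  by have [->|/va[-> _]] := eqVneq (v i 0) 0; rewrite ?mulr0.
by have [->|/va[_ ->]] := eqVneq (v i 0) 0; rewrite ?mulr0.
Qed.

Lemma wedge_cartan a b u v : has_weight a b u -> has_weight (- a) (- b) v ->
  wdg u v \in pair_centralizer (form_algebra J) (diagw w1, diagw w2).
Proof.
case=> u1 u2 [v1 v2]; have [h1 h2] := dd_h dd; apply/pair_centralizerP; split.
- exact: wedge_in.
- by rewrite ad_wedge // u1 v1 wedgeZl wedgeZr scaleNr subrr.
- by rewrite ad_wedge // u2 v2 wedgeZl wedgeZr scaleNr subrr.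
Qed.

(* [u, v, y] as below would span, through [wedge u v] and [wedge u y], a
   non-nilpotent subalgebra of the Cartan subalgebra. *)
Lemma no_hyperbolic a b u v y : has_weight a b u -> has_weight (- a) (- b) v ->
    has_weight (- a) (- b) y -> pairing u u = 0 -> pairing u v = 1 ->
    pairing u y = 0 -> pairing v y = 0 ->
  y = 0.
Proof.
move=> hu hv hy uu uv uy vy.
have vu : pairing v u = eps by rewrite pairingC uv mulr1.
have : wdg u y = 0.
  apply: (dd_cartan dd (s := wdg u v) (a := eps)); [exact: wedge_cartan hu hv|exact: wedge_cartan hu hy| |exact: eps_neq0].
  rewrite ad_wedge //; last exact: wedge_in.
  rewrite !wedge_pairing uu vu uy vy !mulr0 !scale0r !subr0 wedge0r addr0.
  by rewrite wedgeZl.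
move/(congr1 (fun Z => Z *m v)); rewrite mul0mx wedge_pairing uv pairingC vy mulr0 scale0r.
move/eqP; rewrite sub0r oppr_eq0 scaler_eq0 mulr1 (negbTE eps_neq0).
by move/eqP.
Qed.

Lemma pairing_delta v i : pairing v (invmx J *m delta_mx i 0) = v i 0.
Proof.
rewrite /pairing mulmxA mulmxK // -colE !mxE //.
Qed.

Lemma weight_delta i : has_weight (w1 i) (w2 i) (delta_mx i 0).
Proof.
by apply: has_weightP => j; rewrite mxE; have [->|_] := eqVneq j i; rewrite ?eqxx.
Qed.

Lemma weight_dual i : has_weight (- w1 i) (- w2 i) (invmx J *m delta_mx i 0).
Proof.
apply: has_weightP => j; rewrite -colE mxE => nz; have [h1 h2] := dd_h dd.
by rewrite (invform_weight h1 nz) (invform_weight h2 nz) !opprK.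
Qed.

(** Vectors of a non-zero weight are isotropic, and so are those of the opposite weight. If [i] and
    [j] share the weight, the [i]-th basis vector, its dual vector and that of [j] form the
    configuration excluded by [no_hyperbolic]. *)
Lemma distinct_nonzero i j : w1 i = w1 j -> w2 i = w2 j ->
  (w1 i != 0) || (w2 i != 0) -> i = j.
Proof.
move=> w1ij w2ij nz; apply/eqP; apply: contraT => ne.
have [h1 h2] := dd_h dd.
have Jii : J i i = 0.
  apply/eqP; apply: contraT => Jnz; move: nz.
  have /eqP := form_weight h1 Jnz; have /eqP := form_weight h2 Jnz.
  by rewrite -!addr_eq0 !double_eq0 => /eqP-> /eqP->; rewrite eqxx.
have Jji : invmx J i j = 0.
  apply/eqP; apply: contraT => Jnz; move: nz.
  have /eqP := invform_weight h1 Jnz; have /eqP := invform_weight h2 Jnz.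
  by rewrite -w1ij -w2ij -!addr_eq0 !double_eq0 => /eqP-> /eqP->; rewrite eqxx.
have : invmx J *m delta_mx j 0 = 0 :> 'cV_N.
  apply: (no_hyperbolic (weight_delta i) (weight_dual i)).
  - by have := weight_dual j; rewrite -w1ij -w2ij.
  - by rewrite /pairing trmx_delta -mulmxA -colE -rowE !mxE.
  - by rewrite pairing_delta mxE !eqxx.
  - by rewrite pairing_delta mxE eq_sym (negbTE ne).
  - by rewrite pairing_delta -colE mxE (_ : invmx J j i = 0) //; apply/eqP; apply: contraT => Jnz; move: nz;
    have /eqP := invform_weight h1 Jnz; have /eqP := invform_weight h2 Jnz;
    rewrite -w1ij -w2ij -!addr_eq0 !double_eq0 => /eqP-> /eqP->; rewrite eqxx.
move/(congr1 (mulmx J)); rewrite mulmxA mulmxV // mul1mx mulmx0 => /matrixP/(_ j 0)/eqP.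
by rewrite !mxE !eqxx oner_eq0.
Qed.

(** In the alternating case [u] is isotropic; with a zero-weight [v] pairing to 1 with it,
    [wedge u v] and [wedge u u] in [Z(h)] behave like [h] and [e] of an [sl_2]. *)
Lemma alt_weight_neq0 i : eps = -1 -> (w1 i != 0) || (w2 i != 0).
Proof.
move=> em; apply: contraT; rewrite negb_or !negbK => /andP[/eqP z1 /eqP z2].
pose u : 'cV[K]_N := delta_mx i 0; pose v := invmx J *m u.
have hu : has_weight 0 0 u by rewrite -{1}z1 -z2; apply: weight_delta.
have hv : has_weight (- 0) (- 0) v by rewrite -{1}z1 -z2; apply: weight_dual.
have hu' : has_weight (- 0) (- 0) u by rewrite oppr0.
have uu : pairing u u = 0.
  by apply/eqP; rewrite -double_eq0 {1}pairingC em mulN1r addNr.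
have uv : pairing u v = 1 by rewrite pairing_delta mxE !eqxx.
have : wdg u u = 0.
  apply: (dd_cartan dd (s := wdg u v) (a := eps + eps)).
  - exact: wedge_cartan hu hv.
  - exact: wedge_cartan hu hu'.
  - rewrite ad_wedge //; last exact: wedge_in.
    rewrite !wedge_pairing uu (pairingC v) uv mulr0 mulr1 !scale0r !subr0.
    by rewrite wedgeZl wedgeZr scalerDl.
  - by rewrite double_eq0 eps_neq0.
rewrite wedge_self em opprK => /eqP; rewrite scaler_eq0 => /orP[|].
  by rewrite -[1 + 1]/(2%:R) nat0.
move/eqP/(outer_eq0 J_unit) => u0; have {}u0 : u = 0 by case: u0.
by move/matrixP: u0 => /(_ i 0)/eqP; rewrite !mxE !eqxx oner_eq0.
Qed.

Lemma form_partner i : exists j, J i j != 0.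
Proof.
have [/existsP//|] := boolP [exists j, J i j != 0].
rewrite negb_exists => /forallP no.
have /matrixP/(_ i i) : J *m invmx J = 1%:M by rewrite mulmxV.
rewrite !mxE eqxx big1 => [/eqP|k _]; first by rewrite eq_sym oner_eq0.
by have := no k; rewrite negbK => /eqP ->; rewrite mul0r.
Qed.

Let zero_weight i := (w1 i == 0) && (w2 i == 0).

Lemma odd_zero_weights : odd N -> odd #|[set i | zero_weight i]|.
Proof.
move=> oddN; have [h1 h2] := dd_h dd.
have [t tP] := fin_all_exists form_partner.
pose s i := if zero_weight i then i else t i.
have nz i : ~~ zero_weight i -> (w1 i != 0) || (w2 i != 0) by rewrite negb_and.
have wt i : w1 (t i) = - w1 i /\ w2 (t i) = - w2 i.
  by split; apply: form_weight (tP i).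
have zt i : zero_weight (t i) = zero_weight i.
  by have [a b] := wt i; rewrite /zero_weight a b !oppr_eq0.
have sK : involutive s.
  move=> i; rewrite /s; case zi: (zero_weight i); rewrite ?zi // zt zi.
  have [a b] := wt i; have [a' b'] := wt (t i).
  apply: distinct_nonzero; rewrite ?a' ?b' ?a ?b ?opprK //.
  by rewrite nz // zi.
have := card_involution sK; rewrite (_ : [set i | s i == i] = [set i | zero_weight i]).
  by move/(congr1 odd); rewrite oddD muln2 odd_double oddN.
apply/setP => i; rewrite !inE /s; case zi: (zero_weight i); first exact: eqxx.
apply/negP => /eqP ti; have := wt i; rewrite ti => -[/eqP + /eqP].
by rewrite -!addr_eq0 !double_eq0 => a b; rewrite /zero_weight a b in zi.
Qed.

Lemma sym_isotropic i j : eps = 1 -> i != j ->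
  exists2 u : 'cV[K]_N, u != 0 &
    pairing u u = 0 /\ forall k, u k 0 != 0 -> k = i \/ k = j.
Proof.
move=> ep ne; pose v t : 'cV[K]_N := delta_mx i 0 + t *: delta_mx j 0.
have dl k l : pairing (delta_mx k 0) (delta_mx l 0) = J k l.
  by rewrite /pairing trmx_delta -rowE -colE !mxE.
have Jji : J j i = J i j.
  by move/matrixP: J_sym => /(_ i j); rewrite ep scale1r mxE.
have [jj|jj] := eqVneq (J j j) 0.
  exists (delta_mx j 0); first by apply/cV0Pn; exists j; rewrite mxE !eqxx oner_eq0.
  rewrite dl; split=> // k; rewrite mxE; have [->|_] := eqVneq k j; first by right.
  by rewrite /= eqxx.
(* The polynomial is the value of the form on [v t]; it has degree 2 here, so it has a root over an
   algebraically closed field. *)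
have [t rt] : exists t, root (Poly [:: J i i; J i j + J i j; J j j]) t.
  apply/closed_rootP; rewrite (@PolyK _ 0) //.
exists (v t).
  apply/cV0Pn; exists i; rewrite !mxE !eqxx (negbTE ne) mulr0 addr0 oner_eq0 //.
split=> [|k]; last first.
  rewrite !mxE; have [->|_] := eqVneq k i; first by left.
  have [->|_] := eqVneq k j; first by right.
  by rewrite /= mulr0 addr0 eqxx.
move: rt; rewrite rootE horner_Poly /= => /eqP <-.
have pD a b c : pairing (a + b) c = pairing a c + pairing b c.
  by rewrite /pairing [(a + b)^T]linearD /= !mulmxDl mxE.
have pZ a b c : pairing (a *: b) c = a * pairing b c.
  by rewrite /pairing [(a *: b)^T]linearZ /= -!scalemxAl mxE.
have pDr a b c : pairing c (a + b) = pairing c a + pairing c b.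
  by rewrite /pairing mulmxDr mxE.
have pZr a b c : pairing c (a *: b) = a * pairing c b.
  by rewrite /pairing -scalemxAr mxE.
rewrite /v pD pZ !pDr !pZr !dl Jji; ring.
Qed.

(** Only the zero weight is at issue. Its multiplicity is odd because other weights pair off, so a
    repetition gives three zero-weight basis vectors, and their span contains a non-zero vector
    orthogonal to an isotropic [u] and its dual [v]. Multiplicity 2 would leave no such vector. *)
Lemma sym_distinct_weights : eps = 1 -> odd N -> distinct_weights w1 w2.
Proof.
move=> ep oddN i j w1ij w2ij.
have [|nz] := boolP ((w1 i != 0) || (w2 i != 0)); first exact: distinct_nonzero.
apply/eqP; apply: contraT => ne; move: nz; rewrite negb_or !negbK => zi.
have zj : zero_weight j by rewrite /zero_weight -w1ij -w2ij.
pose Z := [set k | zero_weight k].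
have [k /and3P[zk ki kj]] : exists k, [&& zero_weight k, k != i & k != j].
  apply/existsP; apply: contraT; rewrite negb_exists => /forallP no.
  have : odd #|Z| by apply: odd_zero_weights.
  rewrite (_ : Z = [set i; j]) ?cards2 ?ne //; apply/setP => k; rewrite !inE.
  have := no k; case zk: (zero_weight k) => /=.
    by rewrite negb_and !negbK => ->.
  move=> _; apply/esym/negP => /orP[]/eqP e; rewrite e in zk; last by rewrite zk in zj.
  by rewrite /zero_weight zi in zk.
have [u u0 [uu usupp]] := sym_isotropic ep ne.
have hu : has_weight 0 0 u.
  by apply: has_weightP => l /usupp[]->; [case/andP: zi | case/andP: zj] => /eqP-> /eqP->.
have [m um] : exists m, u m 0 != 0 by apply/cV0Pn.
have zm : zero_weight m by case: (usupp m um) => ->.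
pose v : 'cV[K]_N := (u m 0)^-1 *: (invmx J *m delta_mx m 0).
have hv : has_weight (- 0) (- 0) v.
  case/andP: zm => /eqP z1 /eqP z2; have [v1 v2] := weight_dual m; rewrite z1 z2 in v1 v2.
  by rewrite /has_weight /v -!scalemxAr v1 v2 !scalerA ![_^-1 * _]mulrC.
have uv : pairing u v = 1.
  by rewrite /v /pairing -scalemxAr mxE -/(pairing _ _) pairing_delta mulVf.
pose t := tnth [tuple i; j; k]; have t_inj : injective t.
  by apply/tuple_uniqP; rewrite /= !inE negb_or ne eq_sym ki eq_sym kj.
have zt l : zero_weight (t l).
  by case: l => -[|[|[|//]]] /= ?; rewrite /t /= (tnth_nth i).
pose D : 'M[K]_(N, 3) := \matrix_(a, l) (a == t l)%:R.
pose R := col_mx (u^T *m J *m D) (v^T *m J *m D).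
(* Orthogonality to [u] and [v] is two equations in three unknowns. *)
have : kermx R^T != 0.
  rewrite -mxrank_eq0 mxrank_ker subn_eq0 -ltnNge.
  exact: leq_ltn_trans (rank_leq_col _) _.
case/rowV0Pn => c /sub_kermxP /(congr1 trmx); rewrite trmx_mul trmxK trmx0.
rewrite mul_col_mx -[X in _ = X]vsubmxK => /eq_col_mx[]; rewrite !linear0 => Ru Rv c0.
pose y := D *m c^T.
have yt l : y (t l) 0 = c 0 l.
  rewrite mxE (bigD1 l) //= big1 ?addr0 => [|l' ne']; first by rewrite !mxE eqxx mul1r.
  by rewrite !mxE (inj_eq t_inj) eq_sym (negbTE ne') mul0r.
have hy : has_weight (- 0) (- 0) y.
  apply: has_weightP => a /mulmx_neq0[l]; rewrite mxE; have [->|_] := eqVneq a (t l).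
    by move=> _ _; case/andP: (zt l) => /eqP-> /eqP->; rewrite oppr0.
  by rewrite eqxx.
have y0 : y = 0.
  apply: no_hyperbolic hu hv hy uu uv _ _; rewrite /pairing /y mulmxA.
    by rewrite Ru mxE.
  by rewrite Rv mxE.
case/eqP: c0; apply/rowP => l; by rewrite -yt y0 !mxE.
Qed.

End FormCoordinates.

(** * Types A, B and C *)

Lemma intr_eq0_char0 (K : fieldType) (z : int) : [pchar K] =i pred0 ->
  (z%:~R == 0 :> K) = (z == 0).
Proof.
move=> K0; case: z => n; first by rewrite -pmulrn ((pcharf0P K).1 K0).
by rewrite NegzE mulrNz oppr_eq0 -pmulrn ((pcharf0P K).1 K0).
Qed.

(** * Centrally symmetric blocks and their central cells *)

Section Centers.

Variables (K : fieldType) (N : nat) (C : eqType).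
Hypothesis K_char0 : [pchar K] =i pred0.
Variables (e1 e2 : 'M[K]_N) (w1 w2 : 'I_N -> K) (c : 'I_N -> C).
Hypothesis gm : graded_module e1 e2 w1 w2 c.
Variable s : 'I_N -> 'I_N.
Hypothesis s_w1 : forall i, w1 (s i) = - w1 i.
Hypothesis s_w2 : forall i, w2 (s i) = - w2 i.
Hypothesis s_c : forall i, c (s i) = c i.

(** Doubling gives the difference between [k] and its opposite, an integral vector even when the
    coordinates are half-integers; being a natural number replaces a sign in [K]. *)
Definition in_quadrant k := exists m n : nat,
  w1 k + w1 k = m%:R /\ w2 k + w2 k = n%:R.

Lemma opposite_quadrant k m n : w1 k + w1 k = - m%:R -> w2 k + w2 k = - n%:R ->
  exists2 k', c k' = c k & in_quadrant k'.
Proof.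
move=> k1 k2; exists (s k); first exact: s_c.
by exists m, n; rewrite s_w1 s_w2 -!opprD k1 k2 !opprK.
Qed.

(* A walk from the second to the fourth quadrant that only goes right and down
   meets the first or the third one. *)
Lemma crossing x p q a b z : mono (arrow e1) (arrow e2) true false a b x z ->
    w1 x + w1 x = - p%:R -> w2 x + w2 x = q%:R ->
  (exists2 k, c k = c x & in_quadrant k) \/ (a * 2 < p /\ b * 2 < q)%N.
Proof.
have wt a' b' y x' : mono (arrow e1) (arrow e2) true false a' b' x' y ->
    w1 x' + w1 x' = - p%:R -> w2 x' + w2 x' = q%:R ->
    [/\ c y = c x', w1 y + w1 y = (a' * 2)%:R - p%:R & w2 y + w2 y = q%:R - (b' * 2)%:R].
  move=> my x1 x2; have [-> -> ->] := mono_weight gm my; split=> //.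
    by rewrite /signed addrACA x1 muln2 -addnn natrD addrC.
  by rewrite /signed addrACA x2 muln2 -addnn natrD opprD.
elim=> {a b x z} [x|a b x y z m IH st|a b x y z m IH st] x1 x2.
- have [q0|q_gt0] := posnP q.
    by left; apply: (opposite_quadrant x1 (n := 0)); rewrite x2 q0 oppr0.
  have [p0|p_gt0] := posnP p; last by right; split.
  by left; exists x => //; exists 0, q; rewrite x1 x2 p0 oppr0.
- have [|[lta ltb]] := IH x1 x2; first by left.
  have [lt|ge] := ltnP (a.+1 * 2) p; first by right.
  left; have [cz z1 z2] := wt _ _ _ _ (MonoE m st) x1 x2.
  exists z => //; exists (a.+1 * 2 - p)%N, (q - b * 2)%N.
  by rewrite !natrB ?(ltnW ltb).
- have [|[lta ltb]] := IH x1 x2; first by left.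
  have [lt|ge] := ltnP (b.+1 * 2) q; first by right.
  left; have [cz z1 z2] := wt _ _ _ _ (MonoF m st) x1 x2.
  rewrite -cz; apply: (opposite_quadrant (m := p - a * 2) (n := b.+1 * 2 - q)).
    by rewrite natrB ?(ltnW lta) // opprB.
  by rewrite natrB // opprB.
Qed.

Lemma crossing_ex x p q : w1 x + w1 x = - p%:R -> w2 x + w2 x = q%:R ->
  exists2 k, c k = c x & in_quadrant k.
Proof.
move=> x1 x2; have [b [t [p' [q' m]]]] := connect_mono gm (esym (s_c x)).
have [_] := mono_weight gm m; rewrite s_w1 s_w2 => /eqP m1 /eqP m2.
have {m1} : signed K b p' = p%:R.
  by move: m1; rewrite -subr_eq0 opprD addrA -opprD x1 opprK subr_eq0 => /eqP.
have {m2} : signed K (~~ t) q' = q%:R.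
  have -> : signed K (~~ t) q' = - signed K t q'.
    by rewrite /signed; case: (t); rewrite /= ?opprK.
  by move: m2; rewrite -subr_eq0 opprD addrA -opprD x2 subr_eq0 => /eqP <-; rewrite opprK.
move=> /(signed_nat K_char0)[eq tq] /(signed_nat K_char0)[ep bp]; subst p' q'.
case: bp => [bt|p0]; last first.
  by exists x => //; exists 0, q; rewrite x1 x2 p0 oppr0.
case: tq => [tf|q0]; last first.
  by apply: (opposite_quadrant x1 (n := 0)); rewrite x2 q0 oppr0.
rewrite bt (negbTE tf) in m; have [//|[]] := crossing m x1 x2.
by move=> lt_p _; exfalso; lia.
Qed.

Lemma quadrant_ex i : exists2 k, c k = c i & in_quadrant k.
Proof.
have [b [t [p [q m]]]] := connect_mono gm (s_c i).
have [_] := mono_weight gm m; rewrite s_w1 s_w2 => /eqP m1 /eqP m2.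
have {m1} i1 : w1 i + w1 i = signed K b p by move: m1; rewrite addrC -subr_eq opprK => /eqP.
have {m2} i2 : w2 i + w2 i = signed K t q by move: m2; rewrite addrC -subr_eq opprK => /eqP.
case: b t i1 i2 {m} => [] [] /= i1 i2.
- by exists i => //; exists p, q.
- rewrite -(s_c i); apply: (crossing_ex (p := p) (q := q)).
    by rewrite s_w1 -opprD i1.
  by rewrite s_w2 -opprD i2 opprK.
- exact: crossing_ex i1 i2.
- exact: opposite_quadrant i1 i2.
Qed.

(** In the first quadrant a forward walk of [(m, n)] steps leads from the opposite of [k] to [k].
    Stopping half way, rounded up, leaves the doubled coordinates [odd m] and [odd n]. *)
Lemma center_ex i : exists k (a b : bool),
  [/\ c k = c i, w1 k + w1 k = a%:R & w2 k + w2 k = b%:R].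
Proof.
have [k ck [m [n [k1 k2]]]] := quadrant_ex i.
have [f1 f2] := fills_arrows gm.
have mk : mono (arrow e1) (arrow e2) true true m n (s k) k.
  apply: (deg_mono K_char0 gm); apply/degP; rewrite s_c s_w1 s_w2 -k1 -k2.
  by rewrite !addKr.
have le r : (uphalf r <= r)%N by rewrite leq_uphalf_double -addnn leq_addr.
have [y my] := mono_prefix f1 f2 mk (le m) (le n).
have [cy y1 y2] := mono_weight gm my; rewrite s_c s_w1 s_w2 /= in cy y1 y2.
have dbl r : (uphalf r + uphalf r)%:R - r%:R = (odd r)%:R :> K.
  have -> : (uphalf r + uphalf r)%N = (odd r + r)%N by lia.
  by rewrite natrD addrK.
exists y, (odd m), (odd n); split; first by rewrite cy.
  by rewrite y1 addrACA -opprD k1 addrC -natrD dbl.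
by rewrite y2 addrACA -opprD k2 addrC -natrD dbl.
Qed.

Lemma comp_integral i j : c i = c j -> exists z1 z2 : int,
  w1 i = w1 j + z1%:~R /\ w2 i = w2 j + z2%:~R.
Proof.
move/esym/(connect_mono gm) => [b [t [p [q m]]]]; have [_ -> ->] := mono_weight gm m.
have sg d r : signed K d r = (if d then r%:Z else - r%:Z)%:~R.
  by case: d; rewrite /= ?mulrNz -pmulrn.
by exists (if b then p%:Z else - p%:Z), (if t then q%:Z else - q%:Z); rewrite !sg.
Qed.

(* Two centrally symmetric blocks in the same coset of [Z^2] would both contain
   the cell nearest to the centre. *)
Lemma same_block i j p q : distinct_weights w1 w2 ->
  w1 i = w1 j + p%:R -> w2 i = w2 j + q%:R -> c i = c j.
Proof.
move=> dw wi1 wi2.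
have [k [a [b [ck k1 k2]]]] := center_ex i.
have [l [a' [b' [cl l1 l2]]]] := center_ex j.
have [x1 [x2 [kx1 kx2]]] := comp_integral ck.
have [y1 [y2 [ly1 ly2]]] := comp_integral cl.
have two (u v : K) : u + u = v + v -> u = v.
  move/eqP; rewrite -subr_eq0 opprD addrACA -mulr2n -mulr_natl mulf_eq0.
  by rewrite ((pcharf0P K).1 K_char0) /= subr_eq0 => /eqP.
(* Doubled coordinates of the two centres are 0 or 1 and differ by an even integer, so they
   agree. *)
have par (u v : K) (f f' : bool) (z : int) :
    u + u = f%:R -> v + v = f'%:R -> u = v + z%:~R -> u = v.
  move=> uf vf uv; apply: two; rewrite uf vf.
  have : (f%:Z - f'%:Z - z - z)%:~R = 0 :> K.
    by rewrite !rmorphB /= -!pmulrn -uf -vf uv; ring.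
  move/eqP; rewrite intr_eq0_char0 // => /eqP ez.
  by have -> : f = f' by case: f f' ez {uf vf} => [] [] /=; lia.
rewrite -ck -cl; congr c; apply: dw.
  apply: (par _ _ a a' (x1 + p%:Z - y1)) => //.
  by rewrite kx1 ly1 wi1 !rmorphB rmorphD /= -pmulrn; ring.
apply: (par _ _ b b' (x2 + q%:Z - y2)) => //.
by rewrite kx2 ly2 wi2 !rmorphB rmorphD /= -pmulrn; ring.
Qed.

End Centers.

Section FormComponents.

Variables (K : closedFieldType) (N : nat) (J : 'M[K]_N) (eps : K).
Hypothesis K_char0 : [pchar K] =i pred0.
Hypothesis J_unit : J \in unitmx.
Hypothesis J_sym : J^T = eps *: J.
Hypothesis eps2 : eps * eps = 1.
Variables (e1 e2 : 'M[K]_N) (w1 w2 : 'I_N -> K).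
Hypothesis dd : diag_distinguished (form_algebra J) e1 e2 w1 w2.
Hypothesis dw : distinct_weights w1 w2.

Lemma form_involution_ex : exists s, form_involution w1 w2 (comp e1 e2) J s.
Proof.
have [h1 h2] := dd_h dd; have [e1g e2g] := dd_e dd.
have [s sP] := fin_all_exists (form_partner J_unit).
have ws i : w1 (s i) = - w1 i /\ w2 (s i) = - w2 i.
  by split; apply: form_weight (sP i).
have sK : involutive s.
  by move=> i; apply: dw; rewrite !(proj1 (ws _), proj2 (ws _)) opprK.
have Js i j : (J i j != 0) = (j == s i).
  apply/idP/eqP => [nz|->]; last exact: sP.
  by apply: dw; rewrite (proj1 (ws _), proj2 (ws _));
     [apply: form_weight h1 _ _ nz | apply: form_weight h2 _ _ nz].
have fi0 : form_involution w1 w2 (fun=> tt) J s.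
  by split=> // i; case: (ws i).
have es e i j : e \in form_algebra J -> e i j != 0 -> e (s j) (s i) != 0.
  rewrite form_algebraE addrC addr_eq0 => /eqP/matrixP/(_ (s i) j) + nz.
  rewrite [RHS]mxE (mulmx_single (k := i)) => [|k]; last first.
    by rewrite Js => /eqP ->; rewrite sK.
  rewrite (mulmx_single (k := s j)) => [|k _]; last first.
    by rewrite Js => /eqP ->; rewrite sK.
  rewrite mxE => eJ; have : J (s i) i * e i j != 0.
    by rewrite mulf_neq0 // Js sK.
  by rewrite eJ oppr_eq0 mulf_eq0 negb_or => /andP[].
have cs i j : comp e1 e2 i = comp e1 e2 j -> comp e1 e2 (s i) = comp e1 e2 (s j).
  move/eqP; rewrite compE => /connectP[r + ->].
  elim: r i => //= k r IH i /andP[ik /IH <-]; apply: edge_comp.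
  case/or4P: ik => [h|h|h|h]; rewrite /edge ?(es _ _ _ e1g h) ?(es _ _ _ e2g h) ?orbT //.
exists s; split=> //; try by move=> i; case: (ws i).
(* Were the component of [i] not stable under [s], its indicator minus that of its image would be a
   non-zero diagonal element of the algebra centralizing the pair. *)
move=> i; pose d k : K := (comp e1 e2 k == comp e1 e2 i)%:R - (comp e1 e2 (s k) == comp e1 e2 i)%:R.
have := comp_const_diag dd (d := d).
have -> : (diagw d \in form_algebra J).
  apply/(form_diagP fi0) => [k l ne|k]; first by rewrite !mxE (negbTE ne).
  by rewrite !mxE !eqxx !mulr1n /d sK opprB.
move=> /(_ isT) d0; have {}d0 := d0 _ i.
have : d i = 0 by apply: d0 => k l /edge_comp kl; rewrite /d (cs _ _ kl) kl.
rewrite /d eqxx; case: eqP => // _ /eqP; by rewrite subr0 oner_eq0.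
Qed.

Lemma form_blocks_count m : weight_bound w1 w2 m ->
  exists2 s, form_involution w1 w2 (comp e1 e2) J s &
  ((\sum_(p < m) \sum_(q < m)
      \dim (weight_centralizer (form_algebra J) (e1, e2) (diagw w1, diagw w2) p%:R q%:R)) * 2
    + #|[set i | s i == i]| = N)%N.
Proof.
move=> mP; have [s fi] := form_involution_ex; exists s => //.
have gm := comp_graded dd dw; have [e1g e2g] := dd_e dd.
have pr := form_projection K_char0 fi J_unit J_sym eps2 e1g e2g.
rewrite (blocks_total K_char0 gm pr _ mP) ?(dim_form_deg0 K_char0 gm fi) //.
move=> p q X i j _ _; apply: (same_block K_char0 gm (s := s)) => //.
- exact: fi_w1 fi.
- exact: fi_w2 fi.
- exact: fi_c fi.
Qed.

Lemma fixed_zero_weight s i : form_involution w1 w2 (comp e1 e2) J s ->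
  s i = i -> w1 i = 0 /\ w2 i = 0.
Proof.
move=> fi si; have := fi_w1 fi i; have := fi_w2 fi i; rewrite si => /eqP + /eqP.
by rewrite -!addr_eq0 !(double_eq0 K_char0) => /eqP -> /eqP ->.
Qed.

End FormComponents.

Lemma sl_blocks_count (K : closedFieldType) (N : nat) (e1 e2 : 'M[K]_N) w1 w2 m :
    [pchar K] =i pred0 -> (0 < N)%N ->
    diag_distinguished (special_linear K N) e1 e2 w1 w2 -> weight_bound w1 w2 m ->
  ((\sum_(p < m) \sum_(q < m)
      \dim (weight_centralizer (special_linear K N) (e1, e2) (diagw w1, diagw w2) p%:R q%:R)).+1
    = N)%N.
Proof.
move=> K0 N0 dd mP; have dw := sl_distinct_weights K0 dd; have gm := comp_graded dd dw.
have pr := special_linear_projection K0 e1 e2 w1 w2 (comp e1 e2) N0.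
rewrite (blocks_total K0 gm pr _ mP) ?(dim_special_linear_deg0 gm N0) //.
by move=> p q X i j _ _ _ _; apply: (sl_connected K0 N0 dd i j).
Qed.

(** An index fixed by [s] has weight 0. There is none in type C; in type B there is at most one, and
    the parity of [N] demands one. Solving [2 S + F = N] then gives the rank; in type A the trace
    condition removes one from [N]. *)
Theorem wonderful_ABC (K : closedFieldType) T r (J : 'M[K]_(natural_dim T r)) e h :
    [pchar K] =i pred0 -> simple_rank T r -> classical_form T J ->
    distinguished (classical T J) e h -> T <> TypeD ->
  wonderful (classical T J) r e h.
Proof.
move=> K0 Tr TJ De TD.
have N0 : (0 < natural_dim T r)%N by case: T Tr {J e h TJ De TD} => /=; lia.
have N2 : (T = TypeB \/ T = TypeD -> 2 < natural_dim T r)%N.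
  by case: T Tr {J e h TJ De TD N0} => /= ? [] // _; lia.
have [P [Pu [w1 [w2 [hw1 hw2 dd]]]]] := distinguished_coordinates K0 N0 N2 TJ De.
have [m mP] := weight_bound_ex K0 w1 w2.
have dimE p q : \dim (weight_centralizer (classical T J) e h p q) =
  \dim (weight_centralizer (classical T (cj_form J P)) (cj P e.1, cj P e.2) (diagw w1, diagw w2) p q).
  by rewrite -(cj_weight_centralizer T J Pu) /cj_pair hw1 hw2.
apply/(wonderfulE K0 r (m0 := m)) => [p q le|].
  by apply/eqP; rewrite -dimv_eq0 dimE (weight_centralizer_bound _ _ _ mP) ?dimv0.
under eq_bigr do under eq_bigr do rewrite dimE.
have Ju' : J \in unitmx -> cj_form J P \in unitmx.
  by move=> Ju; rewrite /cj_form !unitmx_mul unitmx_tr Pu Ju.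
have Jt' (eps : K) : J^T = eps *: J -> (cj_form J P)^T = eps *: cj_form J P.
  by move=> Jt; rewrite /cj_form !trmx_mul trmxK Jt -scalemxAl -scalemxAr mulmxA.
case: T J e h Tr TJ De TD N0 N2 P Pu w1 w2 hw1 hw2 dd mP dimE Ju' Jt' => //= J e h Tr TJ De _ N0 _ P Pu w1 w2 hw1 hw2 dd mP _ Ju' Jt'.
- by have [] := sl_blocks_count K0 N0 dd mP.
- have [Ju Jt] := TJ; have Jt1 := Jt' 1 (etrans Jt (esym (scale1r J))).
  have dw := sym_distinct_weights K0 (Ju' Ju) Jt1 (mulr1 1) dd (erefl _) _.
  have {}dw : distinct_weights w1 w2 by apply: dw; rewrite /= oddM.
  have [s fi cnt] := form_blocks_count K0 (Ju' Ju) Jt1 (mulr1 1) dd dw mP.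
  have : (#|[set i | s i == i]| <= 1)%N.
    apply/card_le1_eqP => i j; rewrite !inE => /eqP si /eqP sj.
    have [a b] := fixed_zero_weight K0 fi si; have [a' b'] := fixed_zero_weight K0 fi sj.
    by apply: dw; rewrite ?a ?a' ?b ?b'.
  have E S F k : (S * 2 + F = (2 * k).+1 -> F <= 1 -> S = k)%N by lia.
  exact: E cnt.
- have [Ju Jt] := TJ; have Jt1 := Jt' (-1) (etrans Jt (esym (scaleN1r J))).
  have eps2 : (-1) * (-1) = 1 :> K by rewrite mulrNN mulr1.
  have nz := alt_weight_neq0 K0 (Ju' Ju) Jt1 eps2 dd _ (erefl _).
  have dw : distinct_weights w1 w2.
    by move=> i j w1ij w2ij; apply: (distinct_nonzero K0 (Ju' Ju) Jt1 eps2 dd) (nz i).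
  have [s fi cnt] := form_blocks_count K0 (Ju' Ju) Jt1 eps2 dd dw mP.
  rewrite (_ : [set i | s i == i] = set0) ?cards0 in cnt.
    have E S k : (S * 2 + 0 = 2 * k -> S = k)%N by lia.
    exact: E cnt.
  apply/setP => i; rewrite !inE; apply/negP => /eqP si.
  by have [a b] := fixed_zero_weight K0 fi si; have := nz i; rewrite a b eqxx.
Qed.

(** * Skew diagrams *)

Section RatrChar0.

Variable K : fieldType.
Hypothesis K_char0 : [pchar K] =i pred0.

Lemma ratr_frac (x : rat) (n d : int) :
  d != 0 -> x * d%:~R = n%:~R -> ratr x * d%:~R = n%:~R :> K.
Proof.
move=> d0 xd; have den0 : (denq x)%:~R != 0 :> K by rewrite intr_eq0_char0 ?denq_neq0.
have e : numq x * d = n * denq x.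
  apply: (@intr_inj rat); rewrite !intrM -xd.
  by rewrite -[X in _ = X * _ * _]divq_num_den mulrAC divfK ?intr_eq0 ?denq_neq0.
apply: (mulIf den0); rewrite /ratr mulrAC divfK // -!intrM.
by rewrite e.
Qed.

Lemma ratrD0 (x y : rat) : ratr (x + y) = ratr x + ratr y :> K.
Proof.
have num z : z * (denq z)%:~R = (numq z)%:~R by rewrite -{1}(divq_num_den z) divfK ?intr_eq0 ?denq_neq0.
have nz z : (denq z)%:~R != 0 :> K by rewrite intr_eq0_char0 ?denq_neq0.
have hx := ratr_frac (denq_neq0 x) (num x); have hy := ratr_frac (denq_neq0 y) (num y).
apply: (mulIf (mulf_neq0 (nz x) (nz y))); rewrite -intrM.
rewrite (@ratr_frac _ (numq x * denq y + numq y * denq x)).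
- by rewrite intrD !intrM -hx -hy; ring.
- by rewrite mulf_neq0 ?denq_neq0.
- by rewrite intrD !intrM -!num; ring.
Qed.

Lemma ratr_int0 (z : int) : ratr z%:~R = z%:~R :> K.
Proof. by have := @ratr_frac z%:~R z 1 isT; rewrite !mulr1 => ->. Qed.

Lemma ratr_inj0 : injective (@ratr K).
Proof.
move=> x y xy; have : ratr (x - y) = 0 :> K.
  by apply: (addIr (ratr y)); rewrite -ratrD0 subrK xy add0r.
rewrite /ratr => /eqP; rewrite mulf_eq0 invr_eq0 !intr_eq0_char0 //.
rewrite (negbTE (denq_neq0 _)) orbF numq_eq0 subr_eq0 => /eqP //.
Qed.

Lemma ratrN0 (x : rat) : ratr (- x) = - ratr x :> K.
Proof. by apply: (addIr (ratr x)); rewrite -ratrD0 !addNr (ratr_int0 0). Qed.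

End RatrChar0.

Section SkewDiagrams.

Variable G : diagram.
Hypothesis G_skew : skew_diagram G.

Lemma adjacent_step a b : a \in G -> b \in G -> adjacent a b ->
  [\/ b = (a.1 + 1, a.2), a = (b.1 + 1, b.2), b = (a.1, a.2 + 1) | a = (b.1, b.2 + 1)].
Proof.
case: G_skew => -[x [y lat]] _ _; case: a b => [a1 a2] [b1 b2] aG bG.
have [/= a1x a2y] := lat _ aG; have [/= b1x b2y] := lat _ bG.
have [m am] : exists m : int, a1 = b1 + m%:~R.
  have /intrP[m em] : a1 - b1 \is a Num.int.
    have -> : a1 - b1 = (a1 - x) - (b1 - x) by rewrite opprB addrA subrK.
    exact: rpredB.
  by exists m; rewrite -em addrC subrK.
have [n an] : exists n : int, a2 = b2 + n%:~R.
  have /intrP[n en] : a2 - b2 \is a Num.int.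
    have -> : a2 - b2 = (a2 - y) - (b2 - y) by rewrite opprB addrA subrK.
    exact: rpredB.
  by exists n; rewrite -en addrC subrK.
rewrite /adjacent /= am an [_ + _ - _]addrC addKr [b2 + _ - _]addrC addKr.
rewrite -!rmorphXn -rmorphD /= -[1]/(1%:~R) eqr_int => /eqP mn.
have [[m0 n0]|[[m0 n0]|[[m0 n0]|[m0 n0]]]] :
   (m = 1 /\ n = 0) \/ (m = -1 /\ n = 0) \/ (m = 0 /\ n = 1) \/ (m = 0 /\ n = -1).
  by nia.
- by constructor 2; rewrite m0 n0 addr0.
- by constructor 1; rewrite m0 n0 addr0 subrK.
- by constructor 4; rewrite m0 n0 addr0.
- by constructor 3; rewrite m0 n0 addr0 subrK.
Qed.

Definition right_step a b := [/\ a \in G, b \in G & b = (a.1 + 1, a.2)].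
Definition up_step a b := [/\ a \in G, b \in G & b = (a.1, a.2 + 1)].

Lemma skew_mono a b : a \in G -> b \in G ->
  exists s t p q, mono right_step up_step s t p q a b.
Proof.
case: (G_skew) => _ conn skew aG bG; have [s [ps sG <-]] := conn a b aG bG.
apply: (walk_mono (r := fun a b => [&& a \in G, b \in G & adjacent a b])).
- split=> x y z [_ _ h] [_ _ h']; first by rewrite h h'.
  by move: h'; rewrite h => -[/addIr e1 e2]; rewrite [x]surjective_pairing e1 e2 -surjective_pairing.
- split=> x y z [_ _ h] [_ _ h']; first by rewrite h h'.
  by move: h'; rewrite h => -[e1 /addIr e2]; rewrite [x]surjective_pairing e1 e2 -surjective_pairing.
- move=> [x1 x2] y z [xG yG ->] [_ zG ez]; rewrite ez /= in zG.
  have [g1 g2] := skew _ _ xG zG; exists (x1, x2 + 1); split=> //=.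
  by rewrite ez.
- move=> [x1 x2] y z [xG yG ->] [_ zG ez]; rewrite ez /= in zG.
  have [g1 g2] := skew _ _ xG zG; exists (x1 + 1, x2); split=> //=.
  by rewrite ez.
- move=> y z /and3P[yG zG /(adjacent_step yG zG)[e|e|e|e]].
  + by exists true; left.
  + by exists false; left.
  + by exists true; right.
  + by exists false; right.
elim: s a aG ps sG {bG} => //= b' s IH a aG /andP[ab pb] sG.
have b'G : b' \in G by apply: sG; rewrite mem_head.
rewrite aG b'G ab; apply: IH => // z zs; apply: sG; by rewrite inE zs orbT.
Qed.

Lemma skew_mono_pos s t p q a b : mono right_step up_step s t p q a b ->
  [/\ a \in G -> b \in G, b.1 = a.1 + signed rat s p & b.2 = a.2 + signed rat t q].
Proof.
have sgS d k : signed rat d k.+1 = signed rat d k + signed rat d 1.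
  by rewrite /signed; case: d; rewrite -?opprD -natrD addn1.
elim=> {p q a b} [a|p q a b z _ [bG b1 b2] st|p q a b z _ [bG b1 b2] st].
- by rewrite /signed; case: s t => [] []; rewrite ?oppr0 !addr0.
- have [zG z1 z2] : [/\ z \in G, z.1 = b.1 + signed rat s 1 & z.2 = b.2].
    by case: s st {b1} => /= -[g1 g2 e]; split=> //; rewrite e /= ?addrK.
  by rewrite z1 z2 b1 b2 -addrA -sgS.
- have [zG z1 z2] : [/\ z \in G, z.1 = b.1 & z.2 = b.2 + signed rat t 1].
    by case: t st {b2} => /= -[g1 g2 e]; split=> //; rewrite e /= ?addrK.
  by rewrite z1 z2 b1 b2 -addrA -sgS.
Qed.

Lemma skew_fills : fills right_step up_step /\ fills up_step right_step.
Proof.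
case: (G_skew) => _ _ skew; split=> -[x1 x2] y z [xG yG ->] [_ zG ez]; rewrite ez /= in zG.
  have [g1 g2] := skew _ _ xG zG; exists (x1, x2 + 1); split=> //=.
  by rewrite ez.
have [g1 g2] := skew _ _ xG zG; exists (x1 + 1, x2); split=> //=.
by rewrite ez.
Qed.

(** A forward walk can be shortened to any smaller pair of step numbers, so the whole rectangle
    spanned by two comparable cells lies in [G]. *)
Lemma skew_convex a p q p' q' : a \in G -> (a.1 + p%:R, a.2 + q%:R) \in G ->
  (p' <= p)%N -> (q' <= q)%N -> (a.1 + p'%:R, a.2 + q'%:R) \in G.
Proof.
have rat0 : [pchar rat] =i pred0 by apply: pchar_num.
move=> aG bG le_p le_q; have [s [t [k [l m]]]] := skew_mono aG bG.
have [_ /= /addrI/esym sk /addrI/esym tl] := skew_mono_pos m.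
have [ek sp] := signed_nat rat0 sk; have [el tq] := signed_nat rat0 tl; subst k l.
have {}m := mono_forward m sp tq.
have [f1 f2] := skew_fills; have [y my] := mono_prefix f1 f2 m le_p le_q.
have [yG y1 y2] := skew_mono_pos my.
by rewrite [y]surjective_pairing y1 y2 /= in yG; apply: yG.
Qed.

Definition cell (i j : int) : bool := ((i%:~R, j%:~R) : rat * rat) \in G.

Lemma cell_convex i j i' j' i0 j0 : cell i j -> cell i' j' ->
  i <= i0 <= i' -> j <= j0 <= j' -> cell i0 j0.
Proof.
move=> c1 c2 /andP[i1 i2] /andP[j1 j2].
have [p ep] : exists p : nat, i' = i + p%:Z.
  by exists `|i' - i|%N; lia.
have [q eq] : exists q : nat, j' = j + q%:Z.
  by exists `|j' - j|%N; lia.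
have [p' ep'] : exists p' : nat, i0 = i + p'%:Z.
  by exists `|i0 - i|%N; lia.
have [q' eq'] : exists q' : nat, j0 = j + q'%:Z.
  by exists `|j0 - j|%N; lia.
subst; move: c1 c2; rewrite /cell !rmorphD /= -!pmulrn => c1 c2.
by apply: (@skew_convex (i%:~R, j%:~R) p q p' q') => //; lia.
Qed.

Lemma cell_bound : exists M : nat, forall i j, cell i j -> `|i| <= M%:Z /\ `|j| <= M%:Z.
Proof.
exists (\max_(a <- enum_fset G) (`|numq a.1| + `|numq a.2|))%N => i j ij.
have := @leq_bigmax_seq _ (enum_fset G) xpredT (fun a => `|numq a.1| + `|numq a.2|)%N _ ij isT.
by rewrite /= !numq_int; lia.
Qed.

Hypothesis G_int : integral G.

Lemma integral_cell a : a \in G -> exists i j : int, a = (i%:~R, j%:~R) /\ cell i j.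
Proof.
move=> aG; have := G_int aG; rewrite !subr0 => -[/intrP[i ei] /intrP[j ej]].
by exists i, j; rewrite /cell -ei -ej -surjective_pairing.
Qed.

Lemma path_crossing (f : rat * rat -> rat) a b : a \in G -> b \in G ->
  f a <= 0 -> 0 < f b ->
  exists u v, [/\ u \in G, v \in G, adjacent u v & f u <= 0 < f v].
Proof.
move=> aG bG fa fb; case: G_skew => _ conn _; have [s [ps sG ls]] := conn a b aG bG.
elim: s a aG ps sG ls fa => [|v s IH] u uG /=.
  by move=> _ _ ->; rewrite leNgt fb.
case/andP=> uv ps sG ls fu; have vG : v \in G by apply: sG; rewrite mem_head.
have [fv|fv] := leP (f v) 0; last by exists u, v; rewrite fu fv.
apply: IH vG ps _ ls fv => x xs; apply: sG; by rewrite inE xs orbT.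
Qed.

Lemma cell_crossing2 i j i' j' : cell i j -> cell i' j' -> j <= 0 -> 1 <= j' ->
  exists2 x, cell x 0 & cell x 1.
Proof.
move=> c1 c2 j0 j1; have [|/=|u [v [uG vG uv]]] := @path_crossing snd _ _ c1 c2.
- by rewrite /= -[0]/(0%:~R) ler_int.
- by rewrite -[0]/(0%:~R) ltr_int; apply: lt_le_trans j1.
have [i1 [k1 [eu cu]]] := integral_cell uG; have [i2 [k2 [ev cv]]] := integral_cell vG.
have := adjacent_step uG vG uv; rewrite eu ev /= -[0]/(0%:~R) -[1]/(1%:~R) !ler_int !ltr_int.
rewrite -!rmorphD /= => st k12; have [ei ek] : i2 = i1 /\ k2 = k1 + 1.
  by case: st => -[/eqP + /eqP]; rewrite !eqr_int => /eqP + /eqP; lia.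
have [z0 z1] : k1 = 0 /\ k2 = 1 by lia.
by exists i1; [rewrite -z0 | rewrite -z1 -ei].
Qed.

Lemma cell_crossing1 i j i' j' : cell i j -> cell i' j' -> i <= 0 -> 1 <= i' ->
  exists2 y, cell 0 y & cell 1 y.
Proof.
move=> c1 c2 j0 j1; have [|/=|u [v [uG vG uv]]] := @path_crossing fst _ _ c1 c2.
- by rewrite /= -[0]/(0%:~R) ler_int.
- by rewrite -[0]/(0%:~R) ltr_int; apply: lt_le_trans j1.
have [i1 [k1 [eu cu]]] := integral_cell uG; have [i2 [k2 [ev cv]]] := integral_cell vG.
have := adjacent_step uG vG uv; rewrite eu ev /= -[0]/(0%:~R) -[1]/(1%:~R) !ler_int !ltr_int.
rewrite -!rmorphD /= => st k12; have [ek ei] : k2 = k1 /\ i2 = i1 + 1.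
  by case: st => -[/eqP + /eqP]; rewrite !eqr_int => /eqP + /eqP; lia.
have [z0 z1] : i1 = 0 /\ i2 = 1 by lia.
by exists k1; [rewrite -z0 | rewrite -z1 -ek].
Qed.

End SkewDiagrams.

(** What the corner arguments need of an integral centrally symmetric skew diagram through the
    origin. The list is invariant under exchanging the axes, so only regions crossing the centre
    horizontally have to be studied. *)
Record symmetric_region (A : int -> int -> bool) : Prop := {
  sr_origin : A 0 0;
  sr_sym : forall i j, A i j -> A (- i) (- j);
  sr_bound : exists M : nat, forall i j, A i j -> `|i| <= M%:Z /\ `|j| <= M%:Z;
  sr_convex : forall i j i' j' i0 j0, A i j -> A i' j' ->
    i <= i0 <= i' -> j <= j0 <= j' -> A i0 j0;
  sr_cross1 : forall i j, A i j -> 1 <= i -> exists2 y, A 0 y & A 1 y;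
  sr_cross2 : forall i j, A i j -> 1 <= j -> exists2 x, A x 0 & A x 1 }.

Definition swc (A : int -> int -> bool) i j := [&& A i j, ~~ A (i - 1) j & ~~ A i (j - 1)].
Definition nec (A : int -> int -> bool) i j := [&& A i j, ~~ A (i + 1) j & ~~ A i (j + 1)].

Lemma run_end (P : nat -> bool) M : P 0 -> (forall n, P n -> n <= M)%N ->
  exists2 n, P n & ~~ P n.+1.
Proof.
move=> P0 PM; have ex : exists n, P n by exists 0.
case: (ex_maxnP ex PM) => n Pn max; exists n => //.
by apply/negP => /max; rewrite ltnn.
Qed.

Lemma symmetric_transpose A : symmetric_region A -> symmetric_region (fun i j => A j i).
Proof.
case=> o s [M b] c c1 c2; split=> //.
- by move=> i j; apply: s.
- by exists M => i j /b[].
- by move=> i j i' j' i0 j0 a a' h h'; apply: c a a' h' h.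
- by move=> i j; apply: c2.
- by move=> i j; apply: c1.
Qed.

Section Region.

Variable A : int -> int -> bool.
Hypothesis rA : symmetric_region A.

Lemma swc_nec i j : swc A i j = nec A (- i) (- j).
Proof.
have S k l : A (- k) (- l) = A k l.
  by apply/idP/idP => /(sr_sym rA); rewrite ?opprK.
by rewrite /swc /nec -(S i j) -(S (i - 1)) -(S i (j - 1)) !opprB ![1 - _]addrC.
Qed.

Lemma sw_below i j : A i j -> exists i' j', [/\ swc A i' j', i' <= i & j' <= j].
Proof.
have [M bA] := sr_bound rA.
(* The sum of the coordinates drops at each move west or south, and is at least [- 2 M] on [A]. *)
have [n] := ubnP (absz (i + j + M%:Z + M%:Z)); elim: n i j => // n IH i j lt Aij.
have [bi bj] := bA _ _ Aij.
have [Al|nl] := boolP (A (i - 1) j).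
  have [bi' _] := bA _ _ Al.
  have [|//|i' [j' [c le1 le2]]] := IH (i - 1) j; first by lia.
  by exists i', j'; split=> //; lia.
have [Ab|nb] := boolP (A i (j - 1)).
  have [_ bj'] := bA _ _ Ab.
  have [|//|i' [j' [c le1 le2]]] := IH i (j - 1); first by lia.
  by exists i', j'; split=> //; lia.
by exists i, j; rewrite /swc Aij nl nb.
Qed.

Lemma region_neighbour i j : A i j -> (i, j) != (0, 0) -> A 1 0 || A 0 1.
Proof.
have cv := sr_convex rA; have A0 := sr_origin rA.
wlog pos : i j / 0 <= j.
  move=> wl Aij ne; have [le|lt] := lerP 0 j; first exact: wl le Aij ne.
  apply: (wl (- i) (- j)); [by lia | exact: (sr_sym rA Aij) | ].
  by apply: contra ne => /eqP[/eqP + /eqP]; rewrite !oppr_eq0 => /eqP-> /eqP->.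
move=> Aij ne; have [j0|j1] := lerP j 0.
  have ej : j = 0 by lia.
  rewrite ej in Aij ne; apply/orP; left; have [i0|i1] := lerP i 0.
    have ni : i != 0 by apply: contraNneq ne => ->.
    by apply: cv A0 (sr_sym rA Aij) _ _; lia.
  by apply: cv A0 Aij _ _; lia.
have [x x0 x1] := sr_cross2 rA Aij (ltac:(lia) : 1 <= j).
have [e|[lt|lt]] : x = 0 \/ x <= -1 \/ 1 <= x by lia.
- by rewrite e in x1; rewrite x1 orbT.
- by apply/orP; left; apply: cv A0 (sr_sym rA x0) _ _; lia.
- by apply/orP; left; apply: cv A0 x0 _ _; lia.
Qed.

Definition is_row := forall i j, A i j -> j = 0.

Section RowLike.

Hypothesis A01 : ~~ A 0 1.

Let cv := sr_convex rA.
Let A0 := sr_origin rA.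

Lemma row_like_down i j : A i j -> 0 <= i -> j <= 0.
Proof.
move=> Aij i0; rewrite leNgt; apply: contra A01 => lt.
by apply: cv A0 Aij _ _; lia.
Qed.

Lemma row_like_up i j : A i j -> i <= 0 -> 0 <= j.
Proof. by move=> /(sr_sym rA) /row_like_down h ?; have := h; lia. Qed.

Lemma row_like_ex : A 1 0 -> exists m : nat,
  [/\ (0 < m)%N, A (- m%:Z) 0, ~~ A (- m%:Z - 1) 0 & swc A (- m%:Z) 0].
Proof.
move=> A10; have [M bA] := sr_bound rA.
have [|n /bA[] |m Am Am1] := @run_end (fun n => A (1 + n%:Z) 0) M; first by rewrite addr0.
  by lia.
have e : A (- m.+1%:Z) 0 by have := sr_sym rA Am; rewrite oppr0.
have ne : ~~ A (- m.+1%:Z - 1) 0.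
  apply: contra Am1 => /(sr_sym rA); rewrite oppr0.
  by rewrite (_ : - (- _ - 1) = 1 + m.+1%:Z) //; lia.
exists m.+1; split=> //; rewrite /swc e ne /=.
by apply/negP => /row_like_up; lia.
Qed.

Variable m : nat.
Hypotheses (m_gt0 : (0 < m)%N) (Am : A (- m%:Z) 0) (nAm : ~~ A (- m%:Z - 1) 0).

Lemma row_range i : A i 0 -> - m%:Z <= i <= m%:Z.
Proof.
have le k : A k 0 -> - m%:Z <= k.
  move=> Ak; rewrite leNgt; apply: contra nAm => lt.
  by apply: cv Ak A0 _ _; clear - lt; lia.
move=> Ai; have /le := sr_sym rA Ai; have := le _ Ai.
by clear; lia.
Qed.

Lemma row_unique_sw i j : is_row -> swc A i j -> i = - m%:Z /\ j = 0.
Proof.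
move=> row /and3P[Aij nl _]; have ej := row _ _ Aij; rewrite ej in Aij nl *.
have /andP[le1 le2] := row_range Aij; split=> //; apply/eqP; rewrite eq_le le1 andbT.
by rewrite leNgt; apply: contra nl => lt; apply: cv Am Aij _ _; clear - lt; lia.
Qed.

Lemma not_row_sw : ~ is_row -> exists i j, swc A i j /\ j < 0.
Proof.
move=> nrow; have [i [j [Aij jn]]] : exists i j, A i j /\ j < 0.
  have [//|no] := classic (exists i j, A i j /\ j < 0); case: nrow => i j Aij.
  have [lt|gt|//] := ltgtP j 0; case: no; first by exists i, j.
  by exists (- i), (- j); split; [apply: sr_sym | clear - gt; lia].
have [i' [j' [c _ le]]] := sw_below Aij; exists i', j'; split=> //; clear - le jn; lia.
Qed.

(** A region larger than its central row has a cell above the west end of that row. Row 1 then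
    either goes further west and ends in a second southwest corner, or stops there and leaves a
    vertical pair of cells on the west edge; each case will yield a second homomorphism. *)
Lemma not_row_top : ~ is_row ->
  (exists t : nat, swc A (- m%:Z - 1 - t%:Z) 1) \/
  (A (- m%:Z) 1 /\ ~~ A (- m%:Z - 1) 1).
Proof.
case/not_row_sw => i [j [/and3P[Aij _ _] j0]].
have [x x0 x1] := sr_cross2 rA (sr_sym rA Aij) (ltac:(lia) : 1 <= - j).
have xneg : x < 0 by rewrite ltNge; apply/negP => /(row_like_down x1); lia.
have /andP[mx _] := row_range x0.
have Am1 : A (- m%:Z) 1 by apply: cv Am x1 _ _; clear - mx xneg; lia.
have [Al|nl] := boolP (A (- m%:Z - 1) 1); [left | by right].
have [M bA] := sr_bound rA.
have [|n /bA[] |t At At1] := @run_end (fun n => A (- m%:Z - 1 - n%:Z) 1) M; first by rewrite subr0.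
  by clear; lia.
exists t; have -> : swc A (- m%:Z - 1 - t%:Z) 1 = ~~ A (- m%:Z - 1 - t%:Z) 0.
  rewrite /swc At (_ : - m%:Z - 1 - t%:Z - 1 = - m%:Z - 1 - t.+1%:Z) ?At1 //.
  by clear; lia.
by apply: contra nAm => h; apply: cv h A0 _ _; clear; lia.
Qed.

End RowLike.

End Region.

(** The west end of the central row is a southwest corner, and a cell below the axis has another
    such corner weakly below it. *)
Lemma row_rectangular A m : symmetric_region A -> A 1 0 -> ~~ A 0 1 -> (0 < m)%N ->
    A (- m%:Z) 0 -> ~~ A (- m%:Z - 1) 0 ->
  is_row A <-> (forall i j i' j', swc A i j -> swc A i' j' -> i = i' /\ j = j').
Proof.
move=> rA A10 A01 m0 Am nAm; split=> [row i j i' j' c c'|uniq].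
  have [-> ->] := row_unique_sw rA Am nAm row c.
  by have [-> ->] := row_unique_sw rA Am nAm row c'.
apply: NNPP => nrow; have [i [j [c j0]]] := not_row_sw rA nrow.
have c' : swc A (- m%:Z) 0.
  by rewrite /swc Am nAm /=; apply/negP => /(row_like_up rA A01); lia.
by have [_ e] := uniq _ _ _ _ c c'; rewrite e in j0.
Qed.

(** * Type D in coordinates *)

(* The model pair of type D, in the coordinates given by its basis: [lab i] is
   the block and the cell of the [i]-th basis vector. *)
Record typeD_coordinates (K : fieldType) (N : nat) (G : 'I_3 -> diagram)
    (lab : 'I_N -> 'I_3 * (rat * rat)) (J e1 e2 : 'M[K]_N) : Prop := {
  td_in : forall i, (lab i).2 \in G (lab i).1;
  td_inj : injective lab;
  td_surj : forall k a, a \in G k -> exists i, lab i = (k, a);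
  td_form : forall i j, (J i j != 0) =
    (lab j == ((lab i).1, (- (lab i).2.1, - (lab i).2.2)));
  td_symm : J^T = J;
  td_unit : J \in unitmx;
  td_e1 : forall i j, (e1 i j != 0) =
    (lab i == ((lab j).1, ((lab j).2.1 + 1, (lab j).2.2)));
  td_e2 : forall i j, (e2 i j != 0) =
    (lab i == ((lab j).1, ((lab j).2.1, (lab j).2.2 + 1)));
  td_comm : e1 *m e2 = e2 *m e1;
  td_e1g : e1 \in form_algebra J;
  td_e2g : e2 \in form_algebra J }.

Lemma ratsign_neq0 (K : fieldType) x : ratsign K x != 0.
Proof.
rewrite /ratsign; case: (Num.floor x) => n; rewrite ?invr_eq0 expf_neq0 //.
  by rewrite oppr_eq0 oner_eq0.
by rewrite oppr_eq0 oner_eq0.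
Qed.

Section ModelCoordinates.

Variables (K : fieldType) (N : nat) (J : 'M[K]_N) (e h : 'M[K]_N * 'M[K]_N).
Variables (G : 'I_3 -> diagram) (v : 'I_3 -> rat * rat -> 'cV[K]_N).
Hypothesis mb : typeD_model_basis J e h G v.
Hypotheses (J_unit : J \in unitmx) (J_sym : J^T = J).
Hypotheses (eg : e.1 \in form_algebra J /\ e.2 \in form_algebra J)
  (e12 : ad e.1 e.2 = 0).

Lemma model_coordinates : exists (P : 'M[K]_N) (lab : 'I_N -> 'I_3 * (rat * rat)),
  [/\ P \in unitmx, cj P h.1 = diagw (fun i => ratr (lab i).2.1),
      cj P h.2 = diagw (fun i => ratr (lab i).2.2) &
      typeD_coordinates G lab (cj_form J P) (cj P e.1) (cj P e.2)].
Proof.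
case: mb => v0 vbasis vform vh ve.
pose S := [seq (k, a) | k <- enum 'I_3, a <- enum_fset (G k)].
pose f (ka : 'I_3 * (rat * rat)) := v ka.1 ka.2.
have bE : [seq v k a | k <- enum 'I_3, a <- enum_fset (G k)] = map f S.
  by rewrite map_allpairs.
rewrite bE in vbasis; have /andP[/eqP sp fr] := vbasis.
have szS : size S = N.
  by move: fr; rewrite /free sp dimvf /dim /= size_map muln1 => /eqP.
have uS : uniq S by apply: (map_uniq (f := f)); apply: free_uniq fr.
pose lab (i : 'I_N) := nth (ord0, (0, 0)) S i.
have lt i : (i < N)%N -> (i < size S)%N by rewrite szS.
have labS (i : 'I_N) : lab i \in S by rewrite mem_nth ?lt.
have lab_in i : (lab i).2 \in G (lab i).1.
  by case/allpairsPdep: (labS i) => k [a [_ aG ->]].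
have lab_inj : injective lab.
  by move=> i j /eqP; rewrite nth_uniq ?lt // => /eqP /val_inj.
have lab_surj k a : a \in G k -> exists i, lab i = (k, a).
  move=> aG; have kaS : (k, a) \in S.
    by apply/allpairsPdep; exists k, a; rewrite mem_enum.
  have lti : (index (k, a) S < N)%N by rewrite -szS index_mem.
  by exists (Ordinal lti); rewrite /lab nth_index.
pose P : 'M[K]_N := \matrix_(a, i) f (lab i) a 0.
have colPf i : col i P = f (lab i) by apply/colP => a; rewrite !mxE.
have fr' : free [seq f (lab i) | i <- enum 'I_N].
  rewrite (_ : [seq f (lab i) | i <- enum 'I_N] = map f S) //.
  rewrite -[in RHS](mkseq_nth (ord0, (0, 0)) S) szS /mkseq -val_enum_ord -!map_comp.
  by apply: eq_map => i.
have Pu : P \in unitmx.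
  rewrite -unitmx_tr -row_free_unit -kermx_eq0; apply/rowV0P => u /sub_kermxP uP.
  have szt : size [seq f (lab i) | i <- enum 'I_N] == N by rewrite size_map size_enum_ord.
  pose t := Tuple szt.
  have h0 := freeP (fr' : free t); apply/rowP => i; rewrite mxE; apply: (h0 (fun i => u 0 i)) => {i}.
  apply/matrixP => a b; rewrite [b]ord1 summxE [RHS]mxE.
  transitivity ((u *m P^T) 0 a); last by rewrite uP mxE.
  rewrite [RHS]mxE; apply: eq_bigr => i _; rewrite !mxE; congr (_ * _).
  by rewrite (nth_map i) ?size_enum_ord // nth_ord_enum.
have mulP (E F : 'M[K]_N) : E *m P = P *m F -> cj P E = F.
  by move=> EF; rewrite /cj -mulmxA EF mulKmx.
have eqcols (E F : 'M[K]_N) : (forall j, col j E = col j F) -> E = F.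
  by move=> EF; apply/matrixP => i j; have /colP/(_ i) := EF j; rewrite !mxE.
have hP (E : 'M[K]_N) w : (forall i, E *m f (lab i) = w i *: f (lab i)) -> cj P E = diagw w.
  move=> Ew; apply: mulP; apply: eqcols => j; rewrite colE -mulmxA -colE colPf Ew.
  by apply/colP => a; rewrite [RHS]mxE mulmx_diag [P a j]mxE mulrC [LHS]mxE.
(* [E t g] moves labels by [t] with coefficient [g]; a label leaving the diagram gives a zero
   column, in accordance with [v] vanishing outside it. *)
pose E (t : rat * rat -> rat * rat) (g : rat * rat -> K) : 'M[K]_N :=
  \matrix_(i, j) ((lab i == ((lab j).1, t (lab j).2))%:R * g (lab j).2).
have eP (F : 'M[K]_N) t g : (forall i, F *m f (lab i) = g (lab i).2 *: v (lab i).1 (t (lab i).2)) ->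
    cj P F = E t g.
  move=> Fg; apply: mulP; apply: eqcols => j; rewrite colE -mulmxA -colE colPf Fg.
  apply/colP => a; rewrite [RHS]mxE [RHS]mxE [LHS]mxE.
  have [tG|ntG] := boolP (t (lab j).2 \in G (lab j).1).
    have [i0 li0] := lab_surj _ _ tG; rewrite (bigD1 i0) //= big1 ?addr0 => [|i ne].
      by rewrite !mxE li0 eqxx mul1r /f /= mulrC.
    rewrite !mxE -li0 (inj_eq lab_inj) (negbTE ne) mul0r mulr0 //.
  rewrite v0 // mxE mulr0 big1 // => i _; rewrite !mxE.
  case: eqP => [li|_]; last by rewrite mul0r mulr0.
  by have := lab_in i; rewrite li /= (negbTE ntG).
have lab3 i : lab i = ((lab i).1, ((lab i).2.1, (lab i).2.2)).
  by rewrite -!surjective_pairing.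
have inG i : ((lab i).2.1, (lab i).2.2) \in G (lab i).1.
  by rewrite -surjective_pairing.
have E1 : cj P e.1 = E (fun a => (a.1 + 1, a.2)) (fun a => ratsign K (a.1 + a.2)).
  by apply: eP => i; have [h1 _] := ve _ _ _ (inG i); rewrite -h1 -surjective_pairing.
have E2 : cj P e.2 = E (fun a => (a.1, a.2 + 1)) (fun a => ratsign K (a.1 + a.2 + 1)).
  by apply: eP => i; have [_ h1] := ve _ _ _ (inG i); rewrite -h1 -surjective_pairing.
exists P, lab; split=> //.
- by apply: hP => i; have [+ _] := vh _ _ _ (inG i); rewrite -surjective_pairing.
- by apply: hP => i; have [_] := vh _ _ _ (inG i); rewrite -surjective_pairing.
have nz (b : bool) : (b%:R != 0 :> K) = b by case: b; rewrite ?oner_eq0 ?eqxx.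
have memg X : (cj P X \in form_algebra (cj_form J P)) = (X \in form_algebra J).
  exact: (cj_classical TypeD J Pu X).
split=> //.
- move=> i j; have -> : cj_form J P i j = ((f (lab i))^T *m J *m f (lab j)) 0 0.
    by rewrite -!colPf tr_col -row_mul colE mulmxA -row_mul -colE [RHS]mxE [RHS]mxE.
  have -> : ((f (lab i))^T *m J *m f (lab j)) 0 0
     = [&& (lab i).2.1 == - (lab j).2.1, (lab i).2.2 == - (lab j).2.2 & (lab i).1 == (lab j).1]%:R.
    by rewrite -vform // /f -!surjective_pairing.
  rewrite nz [X in _ = (X == _)](lab3 j) !xpair_eqE [(lab j).1 == _]eq_sym.
  rewrite -(eqr_oppLR (lab i).2.1) -(eqr_oppLR (lab i).2.2) ![- _ == _]eq_sym.
  by rewrite andbA andbC.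
- by rewrite /cj_form !trmx_mul trmxK J_sym mulmxA.
- by rewrite /cj_form !unitmx_mul unitmx_tr Pu J_unit.
- by move=> i j; rewrite E1 mxE mulf_eq0 (negbTE (ratsign_neq0 _ _)) orbF nz.
- by move=> i j; rewrite E2 mxE mulf_eq0 (negbTE (ratsign_neq0 _ _)) orbF nz.
- by rewrite -!cjM //; congr (cj P _); move: e12; rewrite adE => /subr0_eq.
- by rewrite memg; case: eg.
- by rewrite memg; case: eg.
Qed.

End ModelCoordinates.

(** * Splitting the algebra into block-diagonal and off-diagonal parts *)

Section BlockSplitting.

Variables (K : fieldType) (N : nat) (C : eqType).
Hypothesis K_char0 : [pchar K] =i pred0.
Variables (e1 e2 : 'M[K]_N) (w1 w2 : 'I_N -> K) (c : 'I_N -> C).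
Hypothesis gm : graded_module e1 e2 w1 w2 c.
Variables (J : 'M[K]_N) (s : 'I_N -> 'I_N).
Hypothesis fi : form_involution w1 w2 c J s.
Hypotheses (J_unit : J \in unitmx) (J_sym : J^T = J).
Hypotheses (e1g : e1 \in form_algebra J) (e2g : e2 \in form_algebra J).

Let same i j := c i == c j.

Local Notation wc g := (weight_centralizer g (e1, e2) (diagw w1, diagw w2)).

Definition diag_blocks := (form_algebra J :&: mask_space K same)%VS.
Definition off_blocks := (form_algebra J :&: mask_space K (fun i j => ~~ same i j))%VS.

Lemma mask_same_form X : X \in form_algebra J -> mask same X \in form_algebra J.
Proof.
rewrite !form_algebraE => /eqP XJ.
have -> : (mask same X)^T *m J + J *m mask same X = mask same (X^T *m J + J *m X).
  apply/matrixP => i j; rewrite [LHS]mxE [RHS]mxE [X in if _ then X else _]mxE.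
  have sj l : J l j != 0 -> l = s j by rewrite (fi_form fi) => /eqP ->; rewrite (fi_inv fi).
  have si l : J i l != 0 -> l = s i by rewrite (fi_form fi) => /eqP.
  rewrite !(mulmx_single (k := s j) (A := _^T)) => [|l _ /sj|l _ /sj] //.
  rewrite !(mulmx_single (k := s i) (A := J)) => [|l /si|l /si] //.
  rewrite !mxE /same (fi_c fi) (fi_c fi) [c j == c i]eq_sym.
  by case: ifP => _ //; rewrite mul0r mulr0 addr0.
by rewrite XJ linear0.
Qed.

Lemma same_e (e : 'M[K]_N) : e = e1 \/ e = e2 -> forall i j, e i j != 0 -> c i = c j.
Proof.
by case=> -> i j nz; [have /degP[] := gm_e1 gm nz | have /degP[] := gm_e2 gm nz].
Qed.

Lemma mask_same_ad (e X : 'M[K]_N) : e = e1 \/ e = e2 -> ad e (mask same X) = mask same (ad e X).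
Proof.
move=> /same_e ee; rewrite !adE linearB /=; congr (_ - _); apply/matrixP => i j; rewrite !mxE /same.
  case: ifP; rewrite /same => h; last first.
    apply: big1 => k _; rewrite mxE; have [->|/ee ik] := eqVneq (e i k) 0; first by rewrite mul0r.
    by rewrite -ik h mulr0.
  apply: eq_bigr => k _; rewrite mxE; have [->|/ee ik] := eqVneq (e i k) 0; first by rewrite !mul0r.
  by rewrite -ik h.
case: ifP; rewrite /same => h; last first.
  apply: big1 => k _; rewrite mxE; have [->|/ee kj] := eqVneq (e k j) 0; first by rewrite mulr0.
  by rewrite kj h mul0r.
apply: eq_bigr => k _; rewrite mxE; have [->|/ee kj] := eqVneq (e k j) 0; first by rewrite !mulr0.
by rewrite kj h.
Qed.

Lemma diag_blocks_projection :
  graded_projection e1 e2 w1 w2 c diag_blocks (fun X => mask same (form_pi J X)).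
Proof.
have Jt : J^T = 1 *: J by rewrite scale1r.
have [pig gpi pi1 pi2 [pi0 pid]] := form_projection K_char0 fi J_unit Jt (mulr1 1) e1g e2g.
split.
- move=> X; apply/memv_capP; split; first exact/mask_same_form/pig.
  by apply/mask_spaceP => i j; rewrite mxE; case: ifP; rewrite ?eqxx.
- move=> X /memv_capP[Xg /mask_spaceP Xs]; rewrite gpi //; apply/matrixP => i j.
  by rewrite mxE; case: ifP => // /negbT h; apply/esym/eqP; apply: contraNT h => /Xs.
- by move=> X; rewrite mask_same_ad ?pi1 //; left.
- by move=> X; rewrite mask_same_ad ?pi2 //; right.
split=> [|p q X Xd i j]; first by rewrite pi0 linear0.
by rewrite mxE; case: ifP => [_|]; [apply: pid | rewrite eqxx].
Qed.

Lemma weight_centralizer_split p q :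
  (\dim (wc (form_algebra J) p q) = \dim (wc diag_blocks p q) + \dim (wc off_blocks p q))%N.
Proof.
rewrite -[LHS](limg_ker_dim (linfun (mask same))) addnC.
congr addn; congr (\dim _); apply/vspaceP => X.
  apply/memv_imgP/(weight_centralizer_diag _ _ _ _ _ _ _ _) => [[Y /weight_centralizer_diag[Yg Y1 Y2 Yw] ->]|].
    rewrite lfunE /=; split.
    - apply/memv_capP; split; first exact: mask_same_form.
      by apply/mask_spaceP => i j; rewrite mxE; case: ifP; rewrite ?eqxx.
    - by rewrite mask_same_ad ?Y1 ?linear0 //; left.
    - by rewrite mask_same_ad ?Y2 ?linear0 //; right.
    - by move=> i j; rewrite mxE; case: ifP => [_|]; [apply: Yw | rewrite eqxx].
  case=> /memv_capP[Xg /mask_spaceP Xs] X1 X2 Xw; exists X; first exact/weight_centralizer_diag.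
  rewrite lfunE /=; apply/matrixP => i j; rewrite mxE.
  by case: ifP => // /negbT h; apply/eqP; apply: contraNT h => /Xs.
apply/memv_capP/(weight_centralizer_diag _ _ _ _ _ _ _ _).
  case=> /weight_centralizer_diag[Xg X1 X2 Xw]; rewrite memv_ker lfunE /= => /eqP/matrixP Xm.
  split=> //; apply/memv_capP; split=> //; apply/mask_spaceP => i j nz.
  by have := Xm i j; rewrite !mxE; case: ifP => // _ e; rewrite e eqxx in nz.
case=> /memv_capP[Xg /mask_spaceP Xs] X1 X2 Xw; split; first exact/weight_centralizer_diag.
rewrite memv_ker lfunE /=; apply/eqP/matrixP => i j; rewrite !mxE.
by case: ifP => // h; apply/eqP; apply: contraT => /Xs; rewrite h.
Qed.

(** [blocks_total] applies to the block-diagonal part even when different blocks share weights, so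
    the off-diagonal dimensions alone remain to be found. The inequality makes the truncated
    subtraction faithful. *)
Lemma split_count m : weight_bound w1 w2 m ->
  ((\sum_(p < m) \sum_(q < m) \dim (wc (form_algebra J) p%:R q%:R)
     - \sum_(p < m) \sum_(q < m) \dim (wc off_blocks p%:R q%:R)) * 2
   + #|[set i | s i == i]| = N)%N /\
  (\sum_(p < m) \sum_(q < m) \dim (wc off_blocks p%:R q%:R)
    <= \sum_(p < m) \sum_(q < m) \dim (wc (form_algebra J) p%:R q%:R))%N.
Proof.
move=> mP; under [X in (X - _)%N]eq_bigr do under eq_bigr do rewrite weight_centralizer_split.
under [X in (_ <= X)%N]eq_bigr do under eq_bigr do rewrite weight_centralizer_split.
under [X in (X - _)%N]eq_bigr do rewrite big_split /=.
under [X in (_ <= X)%N]eq_bigr do rewrite big_split /=.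
rewrite !big_split /= addnK leq_addl; split=> //.
rewrite (blocks_total K_char0 gm diag_blocks_projection _ mP).
  rewrite -[RHS](dim_form_deg0 K_char0 gm fi); congr (_ * 2 + _)%N; congr (\dim _).
  apply/vspaceP => X; rewrite !memv_cap; apply/andP/andP; last first.
    case=> Xg /[dup] Xd ->; rewrite Xg; split=> //=; apply/mask_spaceP => i j.
    by move/(mask_deg0P gm) in Xd; rewrite /same; have [->|/Xd->] := eqVneq i j; rewrite eqxx.
  by case=> /andP[-> _] ->.
by move=> p q X i j /memv_capP[_ /mask_spaceP Xs] /Xs /eqP.
Qed.

End BlockSplitting.

(** * Homomorphisms between two blocks *)

Section TypeD.

Variables (K : fieldType) (N : nat) (G : 'I_3 -> diagram).
Hypothesis K_char0 : [pchar K] =i pred0.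
Variables (lab : 'I_N -> 'I_3 * (rat * rat)) (J e1 e2 : 'M[K]_N).
Hypothesis td : typeD_coordinates G lab J e1 e2.
Hypothesis sk : forall k, skew_diagram (G k).
Hypothesis cs : forall k, centrally_symmetric (G k).

Definition blk i := (lab i).1.
Definition wt1 i : K := ratr (lab i).2.1.
Definition wt2 i : K := ratr (lab i).2.2.

Lemma labE i : lab i = (blk i, ((lab i).2.1, (lab i).2.2)).
Proof. by rewrite /blk -!surjective_pairing. Qed.

Lemma wtP (x y : rat) (p : int) : (ratr x == ratr y + p%:~R :> K) = (x == y + p%:~R).
Proof. by rewrite -(ratr_int0 K_char0) -ratrD0 // (inj_eq (ratr_inj0 K_char0)). Qed.

Lemma degE p q i j : shift_by wt1 wt2 blk p q i j =
  (lab i == (blk j, ((lab j).2.1 + p%:R, (lab j).2.2 + q%:R))).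
Proof.
rewrite /shift_by /wt1 /wt2 !pmulrn !wtP (labE i) !xpair_eqE.
by [].
Qed.

Lemma typeD_graded : graded_module e1 e2 wt1 wt2 blk.
Proof.
split.
- by move=> i j; rewrite (td_e1 td) degE addr0.
- by move=> i j; rewrite (td_e2 td) degE addr0.
- exact: td_comm td.
- by move=> i j; rewrite degE !addr0 -labE => /eqP /(td_inj td).
move=> i j cij; have iG := td_in td i; have jG := td_in td j.
rewrite -/(blk i) in iG; rewrite -/(blk j) -cij in jG.
case: (sk (blk i)) => _ conn _; have [r [pr rG rl]] := conn _ _ iG jG.
elim: r i cij pr rG rl {conn iG jG} => [|b r IH] i cij /=.
  move=> _ _ ij; suff -> : i = j by [].
  by apply: (td_inj td); rewrite [lab i]surjective_pairing [lab j]surjective_pairing ij -/(blk i) -/(blk j) cij.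
case/andP=> ib pr rG rl; have bG : b \in G (blk i) by apply: rG; rewrite mem_head.
have [i' li'] := td_surj td bG.
have ci' : blk i' = blk i by rewrite /blk li'.
apply: (@connect_trans _ _ i'); last first.
  apply: IH; rewrite ?ci' ?li' //.
  by move=> x xr; apply: rG; rewrite inE xr orbT.
apply: connect1; rewrite /edge.
have iG : (lab i).2 \in G (blk i) := td_in td i.
case: (adjacent_step (sk _) iG bG ib) => e.
- have h : e1 i' i != 0 by rewrite (td_e1 td) li' e.
  by rewrite h orbT.
- have h : e1 i i' != 0 by rewrite (td_e1 td) li' /= -e -surjective_pairing.
  by rewrite h.
- have h : e2 i' i != 0 by rewrite (td_e2 td) li' e.
  by rewrite h !orbT.
- have h : e2 i i' != 0 by rewrite (td_e2 td) li' /= -e -surjective_pairing.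
  by rewrite h !orbT.
Qed.

Lemma typeD_involution : exists2 s, form_involution wt1 wt2 blk J s &
  forall i, lab (s i) = (blk i, (- (lab i).2.1, - (lab i).2.2)).
Proof.
have ex i : exists j, lab j = (blk i, (- (lab i).2.1, - (lab i).2.2)).
  apply: (td_surj td); rewrite -cs -surjective_pairing; exact: td_in td i.
have [s sP] := fin_all_exists ex; exists s => //; split.
- move=> i; apply: (td_inj td); rewrite !sP /blk !sP /= !opprK.
  by rewrite -!surjective_pairing.
- by move=> i j; rewrite (td_form td) -sP (inj_eq (td_inj td)).
- by move=> i; rewrite /wt1 sP /= ratrN0.
- by move=> i; rewrite /wt2 sP /= ratrN0.
- by move=> i; rewrite /blk sP.
Qed.

Local Notation wco p q :=
  (weight_centralizer (off_blocks blk J) (e1, e2) (diagw wt1, diagw wt2) p%:R q%:R).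

(** Homomorphisms of [K[e1, e2]]-modules from block [k] to block [l], extended by zero; the form is
    ignored here. *)
Definition hom k l p q (A : 'M[K]_N) :=
  [/\ forall i j, A i j != 0 ->
         [/\ blk i = l, blk j = k, wt1 i = wt1 j + p%:R & wt2 i = wt2 j + q%:R],
      e1 *m A = A *m e1 & e2 *m A = A *m e2].

(** Projecting [A] onto the algebra adds a multiple of its adjoint, which has the same degree but
    goes from [l] to [k], so it cannot cancel [A]. *)
Lemma hom_off k l p q A : k != l -> hom k l p q A -> A != 0 -> wco p q != 0%VS.
Proof.
move=> kl [Ad A1 A2] A0; have [s fi _] := typeD_involution; have gm := typeD_graded.
have Jt : J^T = 1 *: J by rewrite scale1r (td_symm td).
have [pig _ pi1 pi2 [pi0 _]] :=
  form_projection K_char0 fi (td_unit td) Jt (mulr1 1) (td_e1g td) (td_e2g td).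
have adj i j : (invmx J *m A^T *m J) i j != 0 -> A (s j) (s i) != 0.
  case/mulmx_neq0 => b /mulmx_neq0[a /(invmx_supp fi (td_unit td)) -> +] /(J_supp fi) ->.
  by rewrite mxE (fi_inv fi).
have piE i j : form_pi J A i j != 0 -> A i j != 0 \/ A (s j) (s i) != 0.
  rewrite mxE mulf_eq0 negb_or => /andP[_]; rewrite mxE.
  have [->|nz] := eqVneq (A i j) 0; last by left.
  by rewrite add0r mxE oppr_eq0 => /adj; right.
have : form_pi J A \in wco p q.
  apply/weight_centralizer_diag; split.
  - apply/memv_capP; split=> //; apply/mask_spaceP => i j /piE[/Ad[-> -> _ _]|/Ad[]].
      by rewrite eq_sym.
    by rewrite !(fi_c fi) => -> -> _ _.
  - by rewrite pi1 adE A1 subrr pi0.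
  - by rewrite pi2 adE A2 subrr pi0.
  - move=> i j /piE[/Ad[_ _ -> ->] //|/Ad[_ _]].
    rewrite !(fi_w1 fi) !(fi_w2 fi) => h1 h2; split.
      by apply: oppr_inj; rewrite opprD h1 addrK.
    by apply: oppr_inj; rewrite opprD h2 addrK.
apply: contraTneq => ->; rewrite memv0; apply: contra A0 => /eqP z.
apply/eqP/matrixP => i j; rewrite mxE; apply/eqP; apply: contraT => nz.
have [bi bj _ _] := Ad _ _ nz; have := congr1 (fun Z : 'M_N => Z i j) z.
rewrite mxE [X in _ * X]mxE [X in A i j + X]mxE.
have [->|/adj/Ad[]] := eqVneq ((invmx J *m A^T *m J) i j) 0; last first.
  by rewrite !(fi_c fi) bi bj => e; rewrite e eqxx in kl.
rewrite subr0 mxE => /eqP; rewrite mulf_eq0 (negbTE nz) orbF invr_eq0.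
by rewrite ((pcharf0P K).1 K_char0).
Qed.

Lemma mul_delta_col (f : 'M[K]_N) a b : (forall i, f i b = 0) -> f *m delta_mx b a = 0 :> 'M_N.
Proof.
move=> fb; apply/matrixP => i j; rewrite !mxE big1 // => k _; rewrite mxE.
by case: eqP => [->|_]; rewrite ?fb ?mul0r ?mulr0.
Qed.

Lemma mul_delta_row (f : 'M[K]_N) a b : (forall j, f a j = 0) -> delta_mx b a *m f = 0 :> 'M_N.
Proof.
move=> fa; apply/matrixP => i j; rewrite !mxE big1 // => k _; rewrite mxE.
by case: (k =P a) => [->|_]; rewrite ?fa ?mulr0 ?andbF ?mul0r.
Qed.

Lemma mul_delta_only (f : 'M[K]_N) a b b' : (forall i, f i b != 0 -> i = b') ->
  f *m delta_mx b a = f b' b *: delta_mx b' a :> 'M_N.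
Proof.
move=> fb; apply/matrixP => i j; rewrite (mulmx_single (k := b)) => [|l _]; last first.
  by rewrite mxE; case: (l =P b) => //= _; rewrite eqxx.
rewrite !mxE eqxx /=; have [->|ne] := eqVneq i b'; first by [].
have [->|/fb e] := eqVneq (f i b) 0; first by rewrite mul0r mulr0.
by rewrite e eqxx in ne.
Qed.

Lemma mul_only_delta (f : 'M[K]_N) a a' b : (forall j, f a j != 0 -> j = a') ->
  delta_mx b a *m f = f a a' *: delta_mx b a' :> 'M_N.
Proof.
move=> fa; apply/matrixP => i j; rewrite (mulmx_single (k := a)) => [|l]; last first.
  by rewrite mxE; case: (l =P a) => //= _; rewrite andbF eqxx.
rewrite !mxE eqxx andbT; have [->|ne] := eqVneq j a'; first by rewrite andbT mulrC.
have [->|/fa e] := eqVneq (f a j) 0; first by rewrite mulr0 andbF mulr0.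
by rewrite e eqxx in ne.
Qed.

(** [a] is in the image of neither [e1] nor [e2], and [b] is killed by both, so all products
    vanish. *)
Lemma hom_one k l p q a b : blk a = k -> blk b = l ->
    wt1 b = wt1 a + p%:R -> wt2 b = wt2 a + q%:R ->
    (forall i, e1 i b = 0) -> (forall i, e2 i b = 0) ->
    (forall j, e1 a j = 0) -> (forall j, e2 a j = 0) ->
  hom k l p q (delta_mx b a).
Proof.
move=> ak bl w1b w2b o1 o2 i1 i2; split; last 2 first.
- by rewrite mul_delta_col // mul_delta_row.
- by rewrite mul_delta_col // mul_delta_row.
move=> i j; rewrite mxE; case: (boolP ((i == b) && (j == a))); last by rewrite eqxx.
by case/andP=> /eqP-> /eqP-> _.
Qed.

(** The arrow [a] to [a'] is mapped onto the arrow [b] to [b']. The coefficient is the one for which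
    the square formed by [f] commutes; all products with [g] vanish. *)
Lemma hom_two k l p q f g a a' b b' :
    (f = e1 /\ g = e2) \/ (f = e2 /\ g = e1) ->
    blk a = k -> blk b = l -> wt1 b = wt1 a + p%:R -> wt2 b = wt2 a + q%:R ->
    blk a' = k -> blk b' = l -> wt1 b' = wt1 a' + p%:R -> wt2 b' = wt2 a' + q%:R ->
    f a' a != 0 -> f b' b != 0 ->
    (forall i, f i b' = 0) -> (forall j, f a j = 0) ->
    (forall i, g i b = 0) -> (forall i, g i b' = 0) ->
    (forall j, g a j = 0) -> (forall j, g a' j = 0) ->
  hom k l p q (delta_mx b a + (f b' b / f a' a) *: delta_mx b' a').
Proof.
move=> fg ak bl w1b w2b ak' bl' w1b' w2b' fa fb fb' fa0 gb gb' ga ga'.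
have gm := typeD_graded; have [[F1 I1] [F2 I2]] := arrow_partial_injection gm.
have [F I] : partial_injection (arrow f) by case: fg => -[-> _]; split.
set y := f b' b / f a' a.
have cf : f *m (delta_mx b a + y *: delta_mx b' a') = (delta_mx b a + y *: delta_mx b' a') *m f :> 'M_N.
  rewrite mulmxDr mulmxDl -scalemxAr -scalemxAl.
  rewrite (mul_delta_col _ fb') (mul_delta_row _ fa0) scaler0 addr0 add0r.
  rewrite (mul_delta_only _ (b' := b')) => [|i ib]; last exact: F ib fb.
  rewrite (mul_only_delta _ (a' := a)) => [|j ja]; last exact: I ja fa.
  by rewrite scalerA /y divfK.
have cg : g *m (delta_mx b a + y *: delta_mx b' a') = (delta_mx b a + y *: delta_mx b' a') *m g :> 'M_N.
  by rewrite mulmxDr mulmxDl -scalemxAr -scalemxAl !mul_delta_col // !mul_delta_row.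
split; last 2 first; [by case: fg cf cg => -[-> ->] | by case: fg cf cg => -[-> ->] |].
move=> i j; rewrite !mxE; case: (boolP ((i == b) && (j == a))).
  by case/andP=> /eqP-> /eqP-> _.
case: (boolP ((i == b') && (j == a'))); last by rewrite mulr0 addr0 eqxx.
by case/andP=> /eqP-> /eqP-> _ _.
Qed.

End TypeD.

Section TypeDCells.

Variables (K : fieldType) (N : nat) (G : 'I_3 -> diagram).
Hypothesis K_char0 : [pchar K] =i pred0.
Variables (lab : 'I_N -> 'I_3 * (rat * rat)) (J e1 e2 : 'M[K]_N).
Hypothesis td : typeD_coordinates G lab J e1 e2.
Hypothesis sk : forall k, skew_diagram (G k).
Hypothesis cs : forall k, centrally_symmetric (G k).

Local Notation wt1 := (wt1 K lab).
Local Notation wt2 := (wt2 K lab).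
Local Notation wco p q :=
  (weight_centralizer (off_blocks (blk lab) J) (e1, e2) (diagw wt1, diagw wt2) p%:R q%:R).

Definition at_cell k (i j : int) t := lab t = (k, (i%:~R, j%:~R)).

Lemma at_cell_ex k i j : cell (G k) i j -> exists t, at_cell k i j t.
Proof. by move=> c; apply: (td_surj td c). Qed.

Lemma e1_out k i j t : at_cell k i j t -> ~~ cell (G k) (i + 1) j -> forall u, e1 u t = 0.
Proof.
move=> lt; rewrite /cell rmorphD /= => nc u; apply/eqP; apply: contraNT nc.
by rewrite (td_e1 td) lt /= => /eqP lu; have := td_in td u; rewrite lu.
Qed.

Lemma e2_out k i j t : at_cell k i j t -> ~~ cell (G k) i (j + 1) -> forall u, e2 u t = 0.
Proof.
move=> lt; rewrite /cell rmorphD /= => nc u; apply/eqP; apply: contraNT nc.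
by rewrite (td_e2 td) lt /= => /eqP lu; have := td_in td u; rewrite lu.
Qed.

Lemma e1_in k i j t : at_cell k i j t -> ~~ cell (G k) (i - 1) j -> forall u, e1 t u = 0.
Proof.
move=> lt; rewrite /cell rmorphB /= => nc u; apply/eqP; apply: contraNT nc.
rewrite (td_e1 td) lt => /eqP[-> -> ->]; rewrite addrK -surjective_pairing.
exact: td_in td u.
Qed.

Lemma e2_in k i j t : at_cell k i j t -> ~~ cell (G k) i (j - 1) -> forall u, e2 t u = 0.
Proof.
move=> lt; rewrite /cell rmorphB /= => nc u; apply/eqP; apply: contraNT nc.
rewrite (td_e2 td) lt => /eqP[-> -> ->]; rewrite addrK -surjective_pairing.
exact: td_in td u.
Qed.

Lemma at_blk k i j t : at_cell k i j t -> blk lab t = k.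
Proof. by rewrite /blk => ->. Qed.

Lemma at_wt k i j t : at_cell k i j t -> wt1 t = i%:~R /\ wt2 t = j%:~R.
Proof.
move=> lt; split; [change (ratr (lab t).2.1 = i%:~R :> K) | change (ratr (lab t).2.2 = j%:~R :> K)].
  by rewrite lt ratr_int0.
by rewrite lt ratr_int0.
Qed.

Lemma at_shift k l i j p q t u : at_cell k i j t -> at_cell l (i + p%:Z) (j + q%:Z) u ->
  wt1 u = wt1 t + p%:R /\ wt2 u = wt2 t + q%:R.
Proof.
move=> /at_wt[-> ->] /at_wt[-> ->]; by rewrite !rmorphD /= -!pmulrn.
Qed.

Lemma delta_neq0 (a b : 'I_N) : delta_mx b a != 0 :> 'M[K]_N.
Proof.
by apply/eqP => /matrixP/(_ b a)/eqP; rewrite !mxE !eqxx oner_eq0.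
Qed.

Lemma hom_corner k l i j (p q : nat) : k != l ->
  swc (cell (G k)) i j -> nec (cell (G l)) (i + p%:Z) (j + q%:Z) -> wco p q != 0%VS.
Proof.
move=> kl /and3P[c1 nl nb] /and3P[c2 nr nt].
have [a la] := at_cell_ex c1; have [b lb] := at_cell_ex c2.
have [w1b w2b] := at_shift la lb.
apply: (hom_off K_char0 td sk cs kl _ (delta_neq0 a b)).
apply: hom_one w1b w2b _ _ _ _; first exact: at_blk la; first exact: at_blk lb.
- exact: e1_out lb nr.
- exact: e2_out lb nt.
- exact: e1_in la nl.
- exact: e2_in la nb.
Qed.

Lemma delta2_neq0 (a b a' b' : 'I_N) y : a != a' -> delta_mx b a + y *: delta_mx b' a' != 0 :> 'M[K]_N.
Proof.
move=> ne; apply/eqP => /matrixP/(_ b a)/eqP.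
by rewrite !mxE !eqxx (negbTE ne) andbF mulr0 addr0 oner_eq0.
Qed.

Lemma hom_vertical k l i j (p q : nat) : k != l ->
    cell (G k) i j -> cell (G k) i (j + 1) ->
    ~~ cell (G k) (i - 1) j -> ~~ cell (G k) (i - 1) (j + 1) -> ~~ cell (G k) i (j - 1) ->
    cell (G l) (i + p%:Z) (j + q%:Z) -> cell (G l) (i + p%:Z) (j + 1 + q%:Z) ->
    ~~ cell (G l) (i + p%:Z + 1) (j + q%:Z) -> ~~ cell (G l) (i + p%:Z + 1) (j + 1 + q%:Z) ->
    ~~ cell (G l) (i + p%:Z) (j + 1 + q%:Z + 1) ->
  wco p q != 0%VS.
Proof.
move=> kl ca ca' nl nl' nb cb cb' nr nr' nt.
have [a la] := at_cell_ex ca; have [b lb] := at_cell_ex cb.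
have [a' la'] := at_cell_ex ca'; have [b' lb'] := at_cell_ex cb'.
have [w1b w2b] := at_shift la lb; have [w1b' w2b'] := at_shift la' lb'.
have fa : e2 a' a != 0 by rewrite (td_e2 td) la la' rmorphD.
have fb : e2 b' b != 0 by rewrite (td_e2 td) lb lb' [j + 1 + _]addrAC [(j + _ + 1)%:~R]rmorphD.
have ne : a != a'.
  by apply: contraTneq fa => <-; rewrite (e2_in la nb a) eqxx.
apply: (hom_off K_char0 td sk cs kl _ (delta2_neq0 b b' (e2 b' b / e2 a' a) ne)).
apply: (hom_two K_char0 td sk (g := e1) _ (at_blk la) (at_blk lb) w1b w2b
  (at_blk la') (at_blk lb') w1b' w2b' fa fb).
- by right.
- exact: e2_out lb' nt.
- exact: e2_in la nb.
- exact: e1_out lb nr.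
- exact: e1_out lb' nr'.
- exact: e1_in la nl.
- exact: e1_in la' nl'.
Qed.

Lemma hom_horizontal k l i j (p q : nat) : k != l ->
    cell (G k) i j -> cell (G k) (i + 1) j ->
    ~~ cell (G k) i (j - 1) -> ~~ cell (G k) (i + 1) (j - 1) -> ~~ cell (G k) (i - 1) j ->
    cell (G l) (i + p%:Z) (j + q%:Z) -> cell (G l) (i + 1 + p%:Z) (j + q%:Z) ->
    ~~ cell (G l) (i + p%:Z) (j + q%:Z + 1) -> ~~ cell (G l) (i + 1 + p%:Z) (j + q%:Z + 1) ->
    ~~ cell (G l) (i + 1 + p%:Z + 1) (j + q%:Z) ->
  wco p q != 0%VS.
Proof.
move=> kl ca ca' nb nb' nl cb cb' nt nt' nr.
have [a la] := at_cell_ex ca; have [b lb] := at_cell_ex cb.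
have [a' la'] := at_cell_ex ca'; have [b' lb'] := at_cell_ex cb'.
have [w1b w2b] := at_shift la lb; have [w1b' w2b'] := at_shift la' lb'.
have fa : e1 a' a != 0 by rewrite (td_e1 td) la la' rmorphD.
have fb : e1 b' b != 0 by rewrite (td_e1 td) lb lb' [i + 1 + _]addrAC [(i + _ + 1)%:~R]rmorphD.
have ne : a != a'.
  by apply: contraTneq fa => <-; rewrite (e1_in la nl a) eqxx.
apply: (hom_off K_char0 td sk cs kl _ (delta2_neq0 b b' (e1 b' b / e1 a' a) ne)).
apply: (hom_two K_char0 td sk (g := e2) _ (at_blk la) (at_blk lb) w1b w2b
  (at_blk la') (at_blk lb') w1b' w2b' fa fb).
- by left.
- exact: e1_out lb' nr.
- exact: e1_in la nl.
- exact: e2_out lb nt.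
- exact: e2_out lb' nt'.
- exact: e2_in la nb.
- exact: e2_in la' nb'.
Qed.

Variables k l : 'I_3.
Hypothesis kl : k != l.
Hypothesis only_kl : forall p q i j, shift_by wt1 wt2 (fun=> tt) p q i j ->
  blk lab i != blk lab j -> blk lab i = k /\ blk lab j = l \/ blk lab i = l /\ blk lab j = k.

(* When the block [k] is generated by a single vector [j0], an element of the
   off-diagonal part is determined by the image of [j0] in the block [l]. *)
Lemma generated_bound j0 p q :
    blk lab j0 = k ->
    (forall j, blk lab j = k -> exists a, shift_by wt1 wt2 (blk lab) a 0 j j0) ->
    (forall i, e2 i j0 = 0) ->
  (\dim (wco p q) <= 1)%N /\
  (wco p q != 0%VS -> exists i0,
    [/\ blk lab i0 = l, wt1 i0 = wt1 j0 + p%:R, wt2 i0 = wt2 j0 + q%:R,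
        forall i, e2 i i0 = 0 & (forall i, e1 i j0 = 0) -> forall i, e1 i i0 = 0]).
Proof.
move=> j0k gen out2; have gm := typeD_graded K_char0 td sk.
have [s fi _] := typeD_involution K_char0 td cs.
have offP X i j : X \in wco p q -> X i j != 0 ->
    [/\ blk lab i = k /\ blk lab j = l \/ blk lab i = l /\ blk lab j = k,
        wt1 i = wt1 j + p%:R & wt2 i = wt2 j + q%:R].
  case/weight_centralizer_diag => /memv_capP[_ /mask_spaceP Xo] _ _ Xw nz.
  have [h1 h2] := Xw i j nz; split=> //; apply: (only_kl (p := p) (q := q)).
    by rewrite /shift_by eqxx h1 h2 !eqxx.
  exact: Xo nz.
have colP X i : X \in wco p q -> X i j0 != 0 -> blk lab i = l.
  move=> XZ /(offP _ _ _ XZ)[[[_ e]|[-> //]] _ _].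
  by move: kl; rewrite -j0k e eqxx.
have inj X : X \in wco p q -> (forall i, X i j0 = 0) -> X = 0.
  move=> XZ X0; have := XZ.
  case/weight_centralizer_diag => /memv_capP[Xg _] X1 _ _.
  have X1' : e1 *m X = X *m e1 by move: X1; rewrite adE => /subr0_eq.
  (* Vector [j] is, up to a scalar, a power of [e1] applied to [j0], and [X] commutes with [e1]. *)
  have Xk i j : blk lab j = k -> X i j = 0.
    move=> jk; have [a da] := gen j jk.
    have := congr1 (fun Z : 'M_N => Z i j0) (mon0_comm e2 a X1').
    rewrite (mulmx_single (k := j)) => [|t _ /(mon_deg gm) tj]; last first.
      exact: (deg_inj gm tj da).
    rewrite [RHS]mxE big1 => [/eqP|t _]; last by rewrite X0 mulr0.
    by rewrite mulf_eq0 (negbTE (mon_neq0 K_char0 gm da)) orbF => /eqP.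
  apply/matrixP => i j; rewrite [RHS]mxE; apply/eqP; apply: contraT => nz.
  have [[[ik jl]|[_ jk]] _ _] := offP _ _ _ XZ nz; last by rewrite Xk ?eqxx in nz.
  (* The form ties the entries from [l] to [k] to those from [k] to [l], which have just been shown
     to vanish. *)
  have := form_algebraE J X; rewrite Xg => /esym/eqP/matrixP/(_ (s i) j).
  rewrite !mxE (bigD1 (s j)) //= [X in _ + X + _]big1 => [|t ne]; last first.
    have [->|/(J_supp fi) e] := eqVneq (J t j) 0; first by rewrite mulr0.
    by rewrite e (fi_inv fi) eqxx in ne.
  rewrite (bigD1 i) //= [X in _ + (_ + X)]big1 => [|t ne]; last first.
    have [->|/(J_supp fi) e] := eqVneq (J (s i) t) 0; first by rewrite mul0r.
    by rewrite e (fi_inv fi) eqxx in ne.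
  rewrite !addr0 mxE (Xk (s j) (s i)) ?(fi_c fi) // mul0r add0r => /eqP.
  rewrite mulf_eq0 (negbTE nz) orbF => Jz.
  have : J (s i) i != 0 by rewrite (fi_form fi) (fi_inv fi).
  by rewrite Jz.
have nz0 X : X \in wco p q -> X != 0 -> exists i, X i j0 != 0.
  move=> XZ; have [/existsP[i ?]|] := boolP [exists i, X i j0 != 0]; first by exists i.
  rewrite negb_exists => /forallP no; rewrite (inj X) ?eqxx // => i.
  by apply/eqP; have := no i; rewrite negbK.
have [Z0|] := eqVneq (wco p q) 0%VS; first by rewrite Z0 dimv0; split=> //; rewrite eqxx.
rewrite -vpick0; set X0 := vpick _ => X0n; have X0Z : X0 \in wco p q := memv_pick _.
have [i0 i0n] := nz0 X0 X0Z X0n; have i0l := colP _ _ X0Z i0n.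
have [_ i1 i2] := offP _ _ _ X0Z i0n.
have uniq X i : X \in wco p q -> X i j0 != 0 -> i = i0.
  move=> XZ nz; have [_ a1 a2] := offP _ _ _ XZ nz.
  by apply: (gm_inj gm); apply/degP; rewrite (colP _ _ XZ nz) i0l a1 a2 i1 i2 !addr0.
split.
  apply: leq_trans (dimvS (_ : wco p q <= <[X0]>)%VS) _; last by rewrite dim_vline; case: eqP.
  apply/subvP => X XZ; apply/vlineP; exists (X i0 j0 / X0 i0 j0); apply/eqP.
  rewrite -subr_eq0; apply/eqP/inj => [|i].
    by rewrite memvB ?memvZ.
  rewrite !mxE; have [->|ne] := eqVneq i i0; first by rewrite divfK ?subrr.
  have z Y : Y \in wco p q -> Y i j0 = 0.
    by move=> YZ; apply/eqP; apply: contraT => /(uniq _ _ YZ) e; rewrite e eqxx in ne.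
  by rewrite !z // mulr0 subrr.
move=> _; exists i0; have := X0Z => /weight_centralizer_diag[_].
rewrite !adE => /subr0_eq c1 /subr0_eq c2 _.
have out (f : 'M[K]_N) : f *m X0 = X0 *m f -> (forall i, f i j0 = 0) -> forall i, f i i0 = 0.
  move=> fX f0 i; have := congr1 (fun Z : 'M_N => Z i j0) fX.
  rewrite (mulmx_single (k := i0)) => [|t _ /(uniq _ _ X0Z)] //.
  rewrite [RHS]mxE big1 => [/eqP|t _]; last by rewrite f0 mulr0.
  by rewrite mulf_eq0 (negbTE i0n) orbF => /eqP.
by split=> //; apply: out.
Qed.

End TypeDCells.

Lemma sum_grid_ge2 (D : nat -> nat -> nat) m p q p' q' :
    (forall p q, (m <= p)%N \/ (m <= q)%N -> D p q = 0)%N ->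
    (D p q != 0)%N -> (D p' q' != 0)%N -> (p, q) != (p', q') ->
  (1 < \sum_(p < m) \sum_(q < m) D p q)%N.
Proof.
move=> D0 nz nz' ne; rewrite pair_big /=.
have lt a b : (D a b != 0)%N -> (a < m)%N && (b < m)%N.
  by move=> h; rewrite !ltnNge -negb_or; apply: contra h => /orP h; rewrite D0.
have /andP[l1 l2] := lt _ _ nz; have /andP[l1' l2'] := lt _ _ nz'.
rewrite (bigD1 (Ordinal l1, Ordinal l2)) //= (bigD1 (Ordinal l1', Ordinal l2')) /=.
  by rewrite addnA (leq_trans _ (leq_addr _ _)) // -addn1 leq_add // lt0n.
by rewrite eq_sym.
Qed.

Lemma sum_grid_eq1 (D : nat -> nat -> nat) m p q :
    (forall p q, (m <= p)%N \/ (m <= q)%N -> D p q = 0)%N ->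
    (D p q = 1)%N -> (forall p' q', D p' q' != 0 -> p' = p /\ q' = q)%N ->
  (\sum_(p < m) \sum_(q < m) D p q = 1)%N.
Proof.
move=> D0 one uniq; rewrite pair_big /=.
have /andP[l1 l2] : (p < m)%N && (q < m)%N.
  by rewrite !ltnNge -negb_or; apply/negP => /orP /D0; rewrite one.
rewrite (bigD1 (Ordinal l1, Ordinal l2)) //= one big1 // => -[a b] /= ne.
apply/eqP; apply: contraNT ne => /uniq[ea eb].
by apply/eqP; congr (_, _); apply: val_inj.
Qed.

Lemma diagram_region G : skew_diagram G -> centrally_symmetric G -> integral G ->
  (0, 0) \in G -> symmetric_region (cell G).
Proof.
move=> sk cs int G0; split.
- exact: G0.
- by move=> i j; rewrite /cell cs -!rmorphN.
- exact: cell_bound.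
- by move=> i j i' j' i0 j0; apply: cell_convex.
- by move=> i j c1 le; apply: (cell_crossing1 sk int (G0 : cell G 0 0) c1).
- by move=> i j c1 le; apply: (cell_crossing2 sk int (G0 : cell G 0 0) c1).
Qed.

Lemma swcP G i j : reflect (sw_corner G (i%:~R, j%:~R)) (swc (cell G) i j).
Proof. by rewrite /swc /cell !rmorphB; apply: (iffP and3P) => -[]. Qed.

Lemma necP G i j : reflect (ne_corner G (i%:~R, j%:~R)) (nec (cell G) i j).
Proof. by rewrite /nec /cell !rmorphD; apply: (iffP and3P) => -[]. Qed.

Definition unique_swc A := forall i j i' j', swc A i j -> swc A i' j' -> i = i' /\ j = j'.

(** A southwest corner exists by descent from the origin, and the central symmetry exchanges the two
    kinds of corners, so one uniqueness statement suffices. *)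
Lemma rectangularE G : integral G -> symmetric_region (cell G) ->
  rectangular G <-> unique_swc (cell G).
Proof.
move=> int rG; split=> [[[a [_ ua]] _] i j i' j' /swcP/ua e /swcP/ua e'|uniq].
  by move: e'; rewrite e => -[/intr_inj -> /intr_inj ->].
have [i [j [c _ _]]] := sw_below rG (sr_origin rG).
split; [exists (i%:~R, j%:~R) | exists ((- i)%:~R, (- j)%:~R)]; split.
- exact/swcP.
- move=> a ca; have [aG _ _] := ca; have [i' [j' [ea _]]] := integral_cell int aG.
  by rewrite ea in ca *; move/swcP/(uniq _ _ _ _ c): ca => [-> ->].
- by apply/necP; rewrite -swc_nec.
- move=> a ca; have [aG _ _] := ca; have [i' [j' [ea _]]] := integral_cell int aG.
  rewrite ea in ca *; move/necP: ca; rewrite -[i']opprK -[j']opprK -swc_nec //.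
  by move=> /(uniq _ _ _ _ c)[-> ->].
Qed.

(** * Counting homomorphisms between two integral blocks *)

Section OffBlockCount.

Variables (K : fieldType) (N : nat) (G : 'I_3 -> diagram).
Hypothesis K_char0 : [pchar K] =i pred0.
Variables (lab : 'I_N -> 'I_3 * (rat * rat)) (J e1 e2 : 'M[K]_N).
Hypothesis td : typeD_coordinates G lab J e1 e2.
Hypothesis sk : forall k, skew_diagram (G k).
Hypothesis cs : forall k, centrally_symmetric (G k).

Local Notation wt1 := (wt1 K lab).
Local Notation wt2 := (wt2 K lab).
Local Notation wco p q :=
  (weight_centralizer (off_blocks (blk lab) J) (e1, e2) (diagw wt1, diagw wt2) p%:R q%:R).

Variables k l : 'I_3.
Hypothesis kl : k != l.
Hypothesis only_kl : forall p q i j, shift_by wt1 wt2 (fun=> tt) p q i j ->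
  blk lab i != blk lab j -> blk lab i = k /\ blk lab j = l \/ blk lab i = l /\ blk lab j = k.
Variable m : nat.
Hypothesis mP : weight_bound wt1 wt2 m.
Hypotheses (k_int : integral (G k)) (l_int : integral (G l)).
Hypotheses (rA : symmetric_region (cell (G k))) (rB : symmetric_region (cell (G l))).

Local Notation A := (cell (G k)).
Local Notation B := (cell (G l)).

Let D p q := \dim (wco p q).

Let D0 p q : (m <= p)%N \/ (m <= q)%N -> D p q = 0%N.
Proof. by move=> le; rewrite /D (weight_centralizer_bound _ _ _ mP) ?dimv0. Qed.

Let Dnz p q : wco p q != 0%VS -> D p q != 0%N.
Proof. by rewrite /D dimv_eq0. Qed.

Lemma at_cell_blk k' i : integral (G k') -> blk lab i = k' -> exists x y, at_cell lab k' x y i /\ cell (G k') x y.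
Proof.
move=> int bi; have iG := td_in td i; rewrite -/(blk lab i) bi in iG.
have [x [y [e c]]] := integral_cell int iG; exists x, y; split=> //.
by rewrite /at_cell [lab i]surjective_pairing e -bi.
Qed.

Lemma off_count_point : (forall i j, A i j = (i == 0) && (j == 0)) ->
  (\sum_(p < m) \sum_(q < m) D p q = 1)%N <->
  exists2 pq : nat * nat, nec B pq.1%:Z pq.2%:Z &
    forall p q : nat, nec B p%:Z q%:Z -> (p, q) = pq.
Proof.
move=> Apt; have [j0 lj0] := at_cell_ex td (sr_origin rA).
have gen j : blk lab j = k -> exists a, shift_by wt1 wt2 (blk lab) a 0 j j0.
  move=> /(at_cell_blk k_int)[x [y [lj]]]; rewrite Apt => /andP[/eqP x0 /eqP y0].
  exists 0%N; have -> : j = j0 by apply: (td_inj td); rewrite lj x0 y0 lj0.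
  by rewrite /shift_by eqxx !addr0 !eqxx.
have out2 : forall i, e2 i j0 = 0 by apply: (e2_out td lj0); rewrite Apt.
have out1 : forall i, e1 i j0 = 0 by apply: (e1_out td lj0); rewrite Apt.
have bound (p q : nat) := generated_bound K_char0 td sk cs kl only_kl p q (at_blk lj0) gen out2.
(* The only vector of block [k] sits at the origin and is killed by [e1] and [e2], so its image must
   be killed too: it lies at a northeast corner of [B], at position [(p, q)]. *)
have nzE p q : (D p q != 0)%N = nec B p%:Z q%:Z.
  apply/idP/idP => [|c]; last first.
    apply: Dnz; apply: (hom_corner K_char0 td sk cs kl (i := 0) (j := 0)); last by rewrite !add0r.
    by rewrite /swc !Apt.
  rewrite /D dimv_eq0 => /(bound p q).2[i0 [bi h1 h2 o2 /(_ out1) o1]].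
  have [x [y [li c]]] := at_cell_blk l_int bi.
  have [a1 a2] := at_wt K_char0 li; have [b1 b2] := at_wt K_char0 lj0.
  have ex : x = p%:Z.
    apply/eqP; rewrite -subr_eq0 -(intr_eq0_char0 _ K_char0) rmorphB /= -a1 h1 b1.
    by rewrite add0r -pmulrn subrr.
  have ey : y = q%:Z.
    apply/eqP; rewrite -subr_eq0 -(intr_eq0_char0 _ K_char0) rmorphB /= -a2 h2 b2.
    by rewrite add0r -pmulrn subrr.
  rewrite -ex -ey /nec c /=; apply/andP; split; apply/negP => c'.
    have [u lu] := at_cell_ex td c'; have := td_e1 td u i0.
    by rewrite o1 li lu /= rmorphD !eqxx.
  have [u lu] := at_cell_ex td c'; have := td_e2 td u i0.
  by rewrite o2 li lu /= rmorphD !eqxx.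
have D1 p q : (D p q <= 1)%N by case: (bound p q).
split=> [S1|[[p q] c uniq]].
  have [[[p q] pq]|no] := classic (exists pq : nat * nat, D pq.1 pq.2 != 0%N); last first.
    move: S1; rewrite big1 // => p _; rewrite big1 // => q _.
    by apply/eqP; apply: contraT => nz; case: no; exists (val p, val q).
  exists (p, q) => [|p' q']; rewrite -nzE // => nz.
  apply/eqP; apply: contraT => ne.
  by have := sum_grid_ge2 D0 nz pq ne; rewrite S1.
apply: (sum_grid_eq1 (p := p) (q := q) D0).
  by apply/eqP; rewrite eqn_leq D1 lt0n nzE c.
by move=> p' q'; rewrite nzE => /uniq[-> ->].
Qed.

Lemma off_count_cross : (forall i j, A i j -> B i j -> i = 0 /\ j = 0) -> A 1 0 -> B 0 1 ->
  (\sum_(p < m) \sum_(q < m) D p q = 1)%N <-> unique_swc A /\ unique_swc B.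
Proof.
move=> AB A10 B01.
have A01 : ~~ A 0 1 by apply/negP => a; have [] := AB _ _ a B01.
have B10 : ~~ B 1 0 by apply/negP => b; have [] := AB _ _ A10 b.
pose B' i j := B j i; have rB' : symmetric_region B' := symmetric_transpose rB.
have [a [a_gt0 Aa nAa sa]] := row_like_ex rA A01 A10.
have [b [b_gt0 Bb nBb sb]] := row_like_ex rB' (B10 : ~~ B' 0 1) (B01 : B' 1 0).
have swT i j : swc B' i j = swc B j i by rewrite /swc andbA andbAC -andbA.
have nb : nec B 0 b%:Z by have := sb; rewrite swT swc_nec // opprK oppr0.
have rowA := row_rectangular rA A10 A01 a_gt0 Aa nAa.
have rowB := row_rectangular rB' B01 B10 b_gt0 Bb nBb.
have uB : unique_swc B <-> is_row B'.
  split=> [u|/rowB u i j i' j']; last by rewrite -!swT => c c'; have [] := u _ _ _ _ c c'.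
  by apply/rowB => i j i' j'; rewrite !swT => c c'; have [] := u _ _ _ _ c c'.
have Aup i j : A i j -> i <= 0 -> 0 <= j := @row_like_up _ rA A01 i j.
have Bdn i j : B i j -> j <= 0 -> 0 <= i := fun c => @row_like_up _ rB' B10 j i c.
have Bdn' i j : B i j -> 0 <= j -> i <= 0 := fun c => @row_like_down _ rB' B10 j i c.
(* From the west end [(-a, 0)] of the row in [A] to the north end [(0, b)] of the column in [B]. Any
   further degree refutes the count of 1. *)
have hom0 : (D a b != 0)%N.
  apply: Dnz; apply: (hom_corner K_char0 td sk cs kl sa).
  by rewrite addNr add0r.
have two p q : wco p q != 0%VS -> (p, q) != (a, b) -> ~ (\sum_(p < m) \sum_(q < m) D p q = 1)%N.
  by move=> /Dnz nz ne S1; have := sum_grid_ge2 D0 nz hom0 ne; rewrite S1.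
have cvA := sr_convex rA; have cvB := sr_convex rB; have A0 := sr_origin rA; have B0 := sr_origin rB.
have Bsym i j : B i j -> B (- i) (- j) := @sr_sym _ rB i j.
split=> [S1|[uA /uB rowB']].
  split; first (apply/rowA; apply: NNPP => nrow).
    case: (not_row_top rA A01 a_gt0 Aa nAa nrow) => [[t st]|[At nAt]].
      (* From the second southwest corner [(-a - 1 - t, 1)] of [A] to [(0, b)]. *)
      apply: (two (a + 1 + t)%N (b - 1)%N) S1; last by apply/eqP => -[]; clear; lia.
      apply: (hom_corner K_char0 td sk cs kl st).
      rewrite (_ : - a%:Z - 1 - t%:Z + _ = 0); last by clear; lia.
      by rewrite (_ : 1 + _ = b%:Z) //; clear - b_gt0; lia.
    (* From the pair [(-a, 0)], [(-a, 1)] to the pair [(0, b - 1)], [(0, b)]. *)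
    apply: (two a (b - 1)%N) S1; last by apply/eqP => -[]; clear - b_gt0; lia.
    have ea : - a%:Z + a%:Z = 0 by rewrite addNr.
    have eb : 0 + (b - 1)%N%:Z = b%:Z - 1 by clear - b_gt0; lia.
    have eb' : 0 + 1 + (b - 1)%N%:Z = b%:Z by clear - b_gt0; lia.
    apply: (hom_vertical K_char0 td sk cs kl (i := - a%:Z) (j := 0)); rewrite ?ea ?eb ?eb' ?add0r //.
    - by case/and3P: sa.
    - case/and3P: nb => Bb0 _ _; apply: cvB B0 Bb0 _ _; clear - b_gt0; lia.
    - by case/and3P: nb.
    - by apply/negP => /Bdn'; clear - b_gt0; lia.
    - by case/and3P: nb.
    - by case/and3P: nb.
  apply/uB; apply: NNPP => nrow.
  case: (not_row_top rB' B10 b_gt0 Bb nBb nrow) => [[t st]|[Bt nBt]].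
    (* From [(-a, 0)] to the northeast corner [(-1, b + 1 + t)] of [B], opposite to the corner found
       in the transpose. *)
    apply: (two (a - 1)%N (b + 1 + t)%N) S1; last by apply/eqP => -[_]; clear; lia.
    apply: (hom_corner K_char0 td sk cs kl sa).
    rewrite (_ : - a%:Z + _ = - 1); last by clear - a_gt0; lia.
    move: st; rewrite swT swc_nec // (_ : - (- b%:Z - 1 - t%:Z) = 0 + (b + 1 + t)%N%:Z) //.
    by clear; lia.
  have Bt' : B (- 1) b%:Z by have := Bsym _ _ (Bt : B 1 (- b%:Z)); rewrite opprK.
  have nBt' : ~~ B (- 1) (b%:Z + 1).
    by apply: contra nBt => /Bsym; rewrite opprK opprD.
  (* From the pair [(-a, 0)], [(-a + 1, 0)] to the pair [(-1, b)], [(0, b)]. *)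
  apply: (two (a - 1)%N b) S1; last by apply/eqP => -[]; clear - a_gt0; lia.
  have ea : - a%:Z + (a - 1)%N%:Z = - 1 by clear - a_gt0; lia.
  have ea' : - a%:Z + 1 + (a - 1)%N%:Z = 0 by clear - a_gt0; lia.
  apply: (hom_horizontal K_char0 td sk cs kl (i := - a%:Z) (j := 0)); rewrite ?ea ?ea' ?add0r //.
  - by apply: cvA Aa A0 _ _; clear - a_gt0; lia.
  - by case/and3P: sa.
  - by apply/negP => /Aup; clear - a_gt0; lia.
  - by case/and3P: nb.
  - by case/and3P: nb.
  - by case/and3P: nb.
(* Conversely [A] is a row generated by its west end, which [e2] kills, so [e2] kills its image; in
   the column [B] only the north end qualifies, and [(a, b)] is the only degree. *)
move/rowA in uA.
have [j0 lj0] := at_cell_ex td Aa.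
have gen j : blk lab j = k -> exists a, shift_by wt1 wt2 (blk lab) a 0 j j0.
  move=> bj; have [x [y [lj c]]] := at_cell_blk k_int bj.
  have y0 := uA _ _ c; rewrite y0 in lj c; have /andP[lx _] := row_range rA nAa c.
  have [d ed] : exists d : nat, x = - a%:Z + d%:Z by exists (absz (x + a%:Z)); clear - lx; lia.
  exists d; apply/degP; rewrite bj (at_blk lj0).
  rewrite ed in lj; have := at_shift K_char0 (q := 0) lj0; rewrite addr0 => sh.
  by have [-> ->] := sh _ _ _ lj.
have out2 : forall i, e2 i j0 = 0.
  by apply: (e2_out td lj0); apply/negP => /uA.
have bound (p q : nat) := generated_bound K_char0 td sk cs kl only_kl p q (at_blk lj0) gen out2.
apply: (sum_grid_eq1 (p := a) (q := b) D0).
  by apply/eqP; rewrite eqn_leq lt0n hom0 (bound a b).1.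
move=> p q; rewrite /D dimv_eq0 => /(bound p q).2[i0 [bi h1 h2 o2 _]].
have [x [y [li c]]] := at_cell_blk l_int bi.
have [a1 a2] := at_wt K_char0 li; have [b1 b2] := at_wt K_char0 lj0.
have ex : x = - a%:Z + p%:Z.
  apply/eqP; rewrite -subr_eq0 -(intr_eq0_char0 _ K_char0) rmorphB rmorphD /= -a1 h1 b1.
  by rewrite -pmulrn subrr.
have ey : y = q%:Z.
  apply/eqP; rewrite -subr_eq0 -(intr_eq0_char0 _ K_char0) rmorphB /= -a2 h2 b2.
  by rewrite add0r -pmulrn subrr.
have x0 : x = 0 by apply: rowB' c.
rewrite x0 ey in c li; have /andP[_ qb] := row_range rB' nBb (c : B' q%:Z 0).
have nBq : ~~ B 0 (q%:Z + 1).
  apply/negP => c'; have [u lu] := at_cell_ex td c'; have := td_e2 td u i0.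
  by rewrite o2 li lu /= rmorphD !eqxx.
split; first by clear - ex x0; lia.
apply/eqP; rewrite eqn_leq; apply/andP; split; first by clear - qb; lia.
rewrite leqNgt; apply: contra nBq => lt; case/and3P: nb => Bb0 _ _.
by apply: cvB B0 Bb0 _ _; clear - lt; lia.
Qed.

End OffBlockCount.

(** * The classification *)

Lemma half_not_int (x : rat) : x \is a Num.int -> x - 1 / 2%:R \is a Num.int -> False.
Proof.
move=> xi hi; have : (1 / 2%:R : rat) \is a Num.int.
  by rewrite -[1 / _](subKr x) rpredB.
move=> /intrP[n en]; have : (n * 2)%:~R = 1%:~R :> rat by rewrite intrM -en divfK.
by move/intr_inj; lia.
Qed.

Lemma unique_ne_corner G : integral G -> symmetric_region (cell G) ->
  (exists! a, sw_corner G a /\ (a.1 <= 0 /\ a.2 <= 0)) <->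
  (exists2 pq : nat * nat, nec (cell G) pq.1%:Z pq.2%:Z &
    forall p q : nat, nec (cell G) p%:Z q%:Z -> (p, q) = pq).
Proof.
move=> int rG; split=> [[a [[ca [a1 a2]] ua]]|[[p q] c ua]].
  have [aG _ _] := ca; have [i [j [ea _]]] := integral_cell int aG.
  rewrite ea /= -[0]/(0%:~R) !ler_int in ca a1 a2 ua.
  have ei : i = - (absz i)%:Z by clear - a1; lia.
  have ej : j = - (absz j)%:Z by clear - a2; lia.
  exists (absz i, absz j) => /= [|p q c].
    by move/swcP: ca; rewrite {1}ei {1}ej swc_nec // !opprK.
  have /ua : sw_corner G ((- p%:Z)%:~R, (- q%:Z)%:~R) /\
      (((- p%:Z)%:~R : rat) <= 0%:~R /\ ((- q%:Z)%:~R : rat) <= 0%:~R).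
    split; first by apply/swcP; rewrite swc_nec // !opprK.
    by rewrite !ler_int; clear; lia.
  by case=> /intr_inj e1 /intr_inj e2; congr (_, _); [clear - e1 | clear - e2]; lia.
exists ((- p%:Z)%:~R, (- q%:Z)%:~R); split.
  split; first by apply/swcP; rewrite swc_nec // !opprK.
  by rewrite /= -[0]/(0%:~R) !ler_int; clear; lia.
move=> a [ca [a1 a2]]; have [aG _ _] := ca; have [i [j [ea _]]] := integral_cell int aG.
rewrite ea /= -[0]/(0%:~R) !ler_int in ca a1 a2 *.
have ei : i = - (absz i)%:Z by clear - a1; lia.
have ej : j = - (absz j)%:Z by clear - a2; lia.
have /ua [e1 e2] : nec (cell G) (absz i)%:Z (absz j)%:Z.
  by move/swcP: ca; rewrite {1}ei {1}ej swc_nec // !opprK.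
by rewrite ei ej e1 e2.
Qed.

(** When [G2] is a point, condition (ii) thus implies condition (i), and a single criterion remains
    in that case. *)
Lemma unique_swc_sw G : integral G -> symmetric_region (cell G) -> unique_swc (cell G) ->
  exists! a, sw_corner G a /\ (a.1 <= 0 /\ a.2 <= 0).
Proof.
move=> int rG uniq; have [i [j [c i0 j0]]] := sw_below rG (sr_origin rG).
exists (i%:~R, j%:~R); split.
  by split; [apply/swcP | rewrite /= -[0]/(0%:~R) !ler_int].
move=> a [ca _]; have [aG _ _] := ca; have [i' [j' [ea _]]] := integral_cell int aG.
by rewrite ea in ca *; move/swcP/(uniq _ _ _ _ c): ca => [-> ->].
Qed.

Lemma fixed_cells (N : nat) (lab : 'I_N -> 'I_3 * (rat * rat)) (s : 'I_N -> 'I_N) i :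
    injective lab ->
    (forall i, lab (s i) = (blk lab i, (- (lab i).2.1, - (lab i).2.2))) ->
  (s i == i) = ((lab i).2 == (0, 0)).
Proof.
move=> linj ls; rewrite -(inj_eq linj) ls.
have dbl (x : rat) : (- x == x) = (x == 0).
  by rewrite eq_sym -addr_eq0 -mulr2n -mulr_natl mulf_eq0.
rewrite [X in _ == X]surjective_pairing !xpair_eqE eqxx /=.
by rewrite [X in _ = (X == _)]surjective_pairing xpair_eqE -!dbl.
Qed.

Lemma wonderful_D (K : closedFieldType) r (J : 'M[K]_(natural_dim TypeD r)) e h
    (G1 G2 G3 : diagram) :
    [pchar K] =i pred0 -> classical_form TypeD J ->
    distinguished (classical TypeD J) e h ->
    typeD_associated r J e h G1 G2 G3 ->
  wonderful (classical TypeD J) r e h <-> typeD_condition G2 G3.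
Proof.
move=> K0 [Ju Jt] [[eg e12 _ _] _ _] [[skcs card_r nint1 G23] [v mb]].
have [P [lab [Pu hw1 hw2 td]]] := model_coordinates mb Ju Jt eg e12.
set G := tnth _ in td mb.
have skG k : skew_diagram (G k) by have [] := skcs _ (mem_tnth k [tuple G1; G2; G3]).
have csG k : centrally_symmetric (G k) by have [] := skcs _ (mem_tnth k [tuple G1; G2; G3]).
set J' := cj_form J P in td; set f1 := cj P e.1 in td; set f2 := cj P e.2 in td.
have gm := typeD_graded K0 td skG; have [s fi ls] := typeD_involution K0 td csG.
pose wt1' := wt1 K lab; pose wt2' := wt2 K lab.
have [m mP] := weight_bound_ex K0 wt1' wt2'.
have dimE p q : \dim (weight_centralizer (classical TypeD J) e h p q) =
    \dim (weight_centralizer (form_algebra J') (f1, f2) (diagw wt1', diagw wt2') p q).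
  by rewrite -(cj_weight_centralizer TypeD J Pu) /cj_pair hw1 hw2.
have we := wonderfulE K0 r (g := classical TypeD J) (e := e) (h := h) (m0 := m).
have {we}-> : wonderful (classical TypeD J) r e h <->
   (\sum_(p < m) \sum_(q < m) \dim (weight_centralizer (form_algebra J') (f1, f2) (diagw wt1', diagw wt2') p%:R q%:R) = r)%N.
  rewrite we => [|p q le]; last first.
    by apply/eqP; rewrite -dimv_eq0 dimE (weight_centralizer_bound _ _ _ mP) ?dimv0.
  by under eq_bigr do under eq_bigr do rewrite dimE.
have [cnt le_off] := split_count K0 gm fi (td_unit td) (td_symm td) (td_e1g td) (td_e2g td) mP.
rewrite -/wt1' -/wt2' in cnt le_off *.
set Tot := (\sum_(p < m) _)%N in cnt le_off *.
set Off := (\sum_(p < m) _)%N in cnt le_off.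
have linj := td_inj td; have fixE i := fixed_cells i linj ls.
pose k0 : 'I_3 := @Ordinal 3 0 isT; pose k1 : 'I_3 := @Ordinal 3 1 isT; pose k2 : 'I_3 := @Ordinal 3 2 isT.
have three (k : 'I_3) : [\/ k = k0, k = k1 | k = k2].
  case: k => -[|[|[|//]]] lt; [constructor 1|constructor 2|constructor 3]; exact: val_inj.
have no0 i : blk lab i = k0 -> (lab i).2.1 \is a Num.int -> False.
  move=> b0 int; have iG := td_in td i; rewrite -/(blk lab i) b0 in iG.
  by have [h1 _] := nint1 _ iG; apply: half_not_int int h1.
case: G23 => [[e2 e3]|[[ne2 ne3] [int2 int3] G23 ne3o]].
  have all0 i : blk lab i = k0.
    have iG := td_in td i; rewrite -/(blk lab i) in iG.
    by case: (three (blk lab i)) => // bi; rewrite bi /G /tnth /= ?e2 ?e3 in iG.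
  have Off0 : Off = 0%N.
    rewrite /Off big1 // => p _; rewrite big1 // => q _; apply/eqP; rewrite dimv_eq0.
    rewrite -subv0; apply/subvP => X /weight_centralizer_diag[/memv_capP[_ /mask_spaceP Xo] _ _ _].
    rewrite memv0; apply/eqP/matrixP => i j; rewrite mxE; apply/eqP; apply: contraT => /Xo.
    by rewrite !all0 eqxx.
  (* A non-integral diagram misses the origin, so no vector is paired with itself. *)
  rewrite (_ : [set i | s i == i] = set0) ?cards0 in cnt; last first.
    apply/setP => i; rewrite !inE fixE; apply/negP => /eqP z.
    by apply: (no0 i) => //; rewrite z.
  split=> _; first by constructor 1.
  have E t : ((t - 0) * 2 + 0 = 2 * r -> t = r)%N by clear; lia.
  by apply: E; rewrite -[RHS]cnt Off0.
have o2 : (0, 0) \in G2.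
  have : (0, 0) \in (G2 `&` G3)%fset by rewrite G23 inE.
  by rewrite inE => /andP[].
have o3 : (0, 0) \in G3.
  have : (0, 0) \in (G2 `&` G3)%fset by rewrite G23 inE.
  by rewrite inE => /andP[].
have [sk2 cs2] : skew_diagram G2 /\ centrally_symmetric G2 := conj (skG k1) (csG k1).
have [sk3 cs3] : skew_diagram G3 /\ centrally_symmetric G3 := conj (skG k2) (csG k2).
have r2 := diagram_region sk2 cs2 int2 o2; have r3 := diagram_region sk3 cs3 int3 o3.
(* The two copies of the origin, in [G2] and [G3], are the only vectors paired with themselves; they
   lower the block-diagonal count to [r - 1]. *)
have fix2 : #|[set i | s i == i]| = 2.
  have [i1 l1] := td_surj td (o2 : (0, 0) \in G k1).
  have [i2 l2] := td_surj td (o3 : (0, 0) \in G k2).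
  rewrite (_ : [set i | s i == i] = [set i1; i2]).
    by rewrite cards2; case: eqP => // i12; rewrite i12 l2 in l1.
  apply/setP => i; rewrite !inE fixE; apply/eqP/orP => [z|[]/eqP->]; rewrite ?l1 ?l2 //.
  have li : lab i = (blk lab i, (0, 0)) by rewrite -z /blk -surjective_pairing.
  case: (three (blk lab i)) => bi; rewrite bi in li.
  - by case: (no0 i bi); rewrite z.
  - by left; apply/eqP/linj; rewrite li l1.
  - by right; apply/eqP/linj; rewrite li l2.
have only12 p q i j : shift_by wt1' wt2' (fun=> tt) p q i j -> blk lab i != blk lab j ->
    blk lab i = k1 /\ blk lab j = k2 \/ blk lab i = k2 /\ blk lab j = k1.
  rewrite /shift_by /= pmulrn => /andP[+ _]; rewrite wtP // => /eqP x_ij.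
  have int i' : blk lab i' != k0 -> (lab i').2.1 \is a Num.int.
    have iG := td_in td i'; rewrite -/(blk lab i') in iG.
    case: (three (blk lab i')) => bi; rewrite bi ?eqxx // in iG * => _.
      by have [] := int2 _ iG; rewrite subr0.
    by have [] := int3 _ iG; rewrite subr0.
  have n0 : blk lab i != k0 /\ blk lab j != k0 \/ blk lab i = k0 /\ blk lab j = k0.
    have [bi|bi] := eqVneq (blk lab i) k0; have [bj|bj] := eqVneq (blk lab j) k0; auto.
    - by case: (no0 i bi); rewrite x_ij rpredD ?int // intr_int.
    - by case: (no0 j bj); rewrite -(addrK (p%:~R) (lab j).2.1) -x_ij rpredB ?int // intr_int.
  case: n0 => [[]|[-> ->]]; last by rewrite eqxx.
  by case: (three (blk lab i)) => ->; case: (three (blk lab j)) => ->; rewrite ?eqxx //; auto.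
have Off_cond : (Tot = r <-> Off = 1)%N.
  have E t o : (o <= t -> (t - o) * 2 + 2 = 2 * r -> t = r <-> o = 1)%N by clear; lia.
  by rewrite fix2 in cnt; apply: E le_off cnt.
rewrite Off_cond {Off_cond}.
have corner_sw : typeD_condition G2 G3 <->
    G2 = origin /\ (exists! a, sw_corner G3 a /\ (a.1 <= 0 /\ a.2 <= 0)) \/
    rectangular G2 /\ rectangular G3.
  split=> [[[z _]|c|c]|[c|c]]; last 2 first.
  - by constructor 2.
  - by constructor 3.
  - by rewrite z eqxx in ne2.
  - by left.
  - by right.
rewrite corner_sw {corner_sw}.
have [G2o|ne2o] := eqVneq G2 origin.
  have pt i j : cell (G k1) i j = (i == 0) && (j == 0).
    by rewrite /cell /G /tnth /= G2o inE xpair_eqE !intr_eq0.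
  rewrite (off_count_point K0 td skG csG (k := k1) (l := k2) isT only12 mP int2 int3 r2 pt).
  rewrite -(unique_ne_corner int3 r3); split=> [c|[[]//|[_ /(rectangularE int3 r3)]]]; first by left.
  exact: unique_swc_sw.
have nbr G' : G' != origin -> integral G' -> symmetric_region (cell G') -> cell G' 1 0 || cell G' 0 1.
  move=> neo int rG; have [a [aG a0]] : exists a, a \in G' /\ a != (0, 0).
    apply: NNPP => no; case/eqP: neo; apply/fsetP => a; rewrite inE.
    apply/idP/eqP => [aG|->]; last exact: (sr_origin rG).
    by apply/eqP; apply: contraT => a0; case: no; exists a.
  have [i [j [ea c]]] := integral_cell int aG; apply: (region_neighbour rG c).
  by apply: contra a0; rewrite ea => /eqP[-> ->].
have meet i j : cell G2 i j -> cell G3 i j -> i = 0 /\ j = 0.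
  move=> c2 c3; have : ((i%:~R, j%:~R) : rat * rat) \in (G2 `&` G3)%fset.
    by rewrite inE; apply/andP.
  by rewrite G23 inE xpair_eqE !intr_eq0 => /andP[/eqP-> /eqP->].
have rectE : G2 = origin /\ (exists! a, sw_corner G3 a /\ (a.1 <= 0 /\ a.2 <= 0)) \/
    rectangular G2 /\ rectangular G3 <-> unique_swc (cell G2) /\ unique_swc (cell G3).
  rewrite -(rectangularE int2 r2) -(rectangularE int3 r3).
  by split=> [[[/eqP]|]|]; [rewrite (negbTE ne2o) | | right].
rewrite rectE {rectE}.
have [c2|nc2] := boolP (cell G2 1 0).
  have c3 : cell G3 0 1.
    by case/orP: (nbr _ ne3o int3 r3) => // c3; have [] := meet _ _ c2 c3.
  exact: (off_count_cross K0 td skG csG (k := k1) (l := k2) isT only12 mP int2 int3 r2 r3 meet c2 c3).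
(* Now [G3] is the horizontal diagram, so the roles of [G2] and [G3] are exchanged. *)
have c2 : cell G2 0 1 by have := nbr _ ne2o int2 r2; rewrite (negbTE nc2).
have c3 : cell G3 1 0.
  by case/orP: (nbr _ ne3o int3 r3) => // c3; have [] := meet _ _ c2 c3.
have only21 p q i j (sh : shift_by wt1' wt2' (fun=> tt) p q i j) (ne : blk lab i != blk lab j) :=
  proj1 (or_comm _ _) (only12 p q i j sh ne).
have meet' i j (c : cell G3 i j) (c' : cell G2 i j) := meet i j c' c.
rewrite (and_comm (unique_swc _)).
exact: (off_count_cross K0 td skG csG (k := k2) (l := k1) isT only21 mP int3 int2 r3 r2 meet' c3 c2).
Qed.

Theorem corollary5p3 (K : closedFieldType) (K_char0 : [pchar K] =i pred0)
    (T : lie_type) (r : nat) (J : 'M[K]_(natural_dim T r))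
    (e h : 'M[K]_(natural_dim T r) * 'M[K]_(natural_dim T r))
    (G1 G2 G3 : diagram) :
  simple_rank T r ->
  classical_form T J ->
  distinguished (classical T J) e h ->
  (T = TypeD -> typeD_associated r J e h G1 G2 G3) ->
  wonderful (classical T J) r e h <->
    (T = TypeA \/ T = TypeB \/ T = TypeC) \/
    (T = TypeD /\ typeD_condition G2 G3).
Proof.
move=> rk Jf de assoc; have [TD|nD] := classic (T = TypeD).
  subst T; have := wonderful_D K_char0 Jf de (assoc erefl) => ->.
  by split=> [c|[[|[]]|[]]] //; right.
split=> _; last exact: wonderful_ABC K_char0 rk Jf de nD.
by left; case: (T) nD => nD; [left | right; left | right; right | case: nD].
Qed.
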